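(* Let $B=(B_s)_{s\ge 0}$ and $\tilde B=(\tilde B_s)_{s\ge 0}$ be two independent standard one-dimensional Brownian motions with $B_0=\tilde B_0=0$, and let $\int_0^1\!\int_0^1\delta_0(B_s-\tilde B_r)\,ds\,dr$ denote their mutual intersection local time up to time $1$. For $p>0$, $$\mathbb E\bigg[\int_0^1\!\!\int_0^1\delta_0(B_s-\tilde B_r)\,ds\,dr\bigg]^{-p}<\infty$$ (the expectation of the $(-p)$-th power of the mutual intersection local time) if and only if $p<\frac23$.
   Context: $\delta_0$ is the Dirac delta function on $\mathbb R$. The mutual intersection local time is the random variable $$\int_0^1\!\!\int_0^1\delta_0(B_s-\tilde B_r)\,ds\,dr=\int_{-\infty}^\infty L(1,x)\,\tilde L(1,x)\,dx,$$ where $L(t,x)$ and $\tilde L(t,x)$, $(t,x)\in\mathbb R^+\times\mathbb R$, are the (jointly continuous) local times of $B$ and $\tilde B$, respectively, normalized as occupation densities with respect to Lebesgue measure: $\int_0^t f(B_s)\,ds=\int_{\mathbb R} f(x)L(t,x)\,dx$ for every bounded Borel function $f$, and similarly for $\tilde B$ and $\tilde L$. The expectation is that of the random variable $X^{-p}$ with $X$ the mutual intersection local time (with $0^{-p}=+\infty$). *)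

(* Defs.v *)
From HB Require Import structures.
From mathcomp Require Import all_boot all_order all_algebra.
From mathcomp Require Import all_classical all_reals all_analysis.
Set Implicit Arguments.
Unset Strict Implicit.
Unset Printing Implicit Defensive.
Import Order.TTheory GRing.Theory Num.Theory.
Import numFieldNormedType.Exports.
Local Open Scope classical_set_scope.
Local Open Scope ring_scope.

(* Processes are families indexed by all of R; only the times 0 <= t are ever
   constrained or used. *)

(* Taking A i := setT for some of the i gives the product rule for every
   subfamily. *)
Definition mutually_independent (R : realType) (d : measure_display)
    (T : measurableType d) (P : probability T R) (n : nat)
    (X : nat -> T -> R) : Prop :=
  forall A : nat -> set R, (forall i, measurable (A i)) ->
    P (\bigcap_(i < n) (X i @^-1` A i))
    = (\big[*%E/1%E]_(i < n) P (X i @^-1` A i))%E.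

(* normal_prob takes the standard deviation, not the variance. *)
Definition standard_brownian_motion (R : realType) (d : measure_display)
    (T : measurableType d) (P : probability T R)
    (B : R -> {RV P >-> R}) : Prop :=
  [/\ {ae P, forall w, B 0 w = 0},
      (forall (n : nat) (t : nat -> R), 0 <= t 0%N ->
        (forall i, t i <= t i.+1) ->
        mutually_independent
          P n (fun i => B (t i.+1) \- B (t i))),
      (forall s t : R, 0 <= s -> s < t ->
        forall A : set R, measurable A ->
        P ((B t \- B s) @^-1` A)
        = normal_prob 0 (Num.sqrt (t - s)) A)
    & {ae P, forall w,
        {within `[0, +oo[%classic, continuous (fun t : R => B t w)}}].

Definition sigma_process (R : realType) (d : measure_display)
    (T : measurableType d) (P : probability T R)
    (B : R -> {RV P >-> R}) : set (set T) :=
  <<s [set E | exists t : R, exists A : set R,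
         [/\ 0 <= t, measurable A & E = B t @^-1` A] ] >>.

Definition independent_processes (R : realType) (d : measure_display)
    (T : measurableType d) (P : probability T R)
    (B B' : R -> {RV P >-> R}) : Prop :=
  forall E F : set T, sigma_process B E -> sigma_process B' F ->
    P (E `&` F) = (P E * P F)%E.

Definition is_local_time (R : realType) (d : measure_display)
    (T : measurableType d) (P : probability T R)
    (B : R -> {RV P >-> R}) (L : R -> R -> {RV P >-> R}) : Prop :=
  {ae P, forall w,
    {within [set tx : R * R | 0 <= tx.1],
       continuous (fun tx : R * R => L tx.1 tx.2 w)}} /\
  {ae P, forall w, forall (t : R) (f : R -> R), 0 <= t ->
    measurable_fun setT f -> (exists M : R, forall x, `|f x| <= M) ->
    (\int[lebesgue_measure]_(s in `[0%R, t]) (f (B s w))%:E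
     = \int[lebesgue_measure]_x (f x * L t x w)%:E)%E}.

(* The double integral of delta_0 (B_s - B'_r) over [0,1]^2, as a function of
   the local times L, L' of B, B'. *)
Definition mutual_intersection_local_time (R : realType) (d : measure_display)
    (T : measurableType d) (P : probability T R)
    (L L' : R -> R -> {RV P >-> R}) (w : T) : \bar R :=
  (\int[lebesgue_measure]_x (L 1 x w * L' 1 x w)%:E)%E.

(* x^{-p} is (x `^ p)^-1 because 0^-1 = +oo and +oo^-1 = 0 in \bar R, whereas
   0 `^ (- p) = 0 and +oo `^ (- p) = +oo for p != 0. *)
Definition neg_moment (R : realType) (d : measure_display)
    (T : measurableType d) (P : probability T R)
    (X : T -> \bar R) (p : R) : \bar R :=
  (\int[P]_w (X w `^ p)^-1)%E.

(* Main.v *)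
Require Import Defs.
From HB Require Import structures.
From mathcomp Require Import all_boot all_order all_algebra.
From mathcomp Require Import all_classical all_reals all_analysis.
From mathcomp Require Import measurable_realfun ring lra zify.
Set Implicit Arguments.
Unset Strict Implicit.
Unset Printing Implicit Defensive.
Import Order.TTheory GRing.Theory Num.Theory.
Import numFieldNormedType.Exports.
Local Open Scope classical_set_scope.
Local Open Scope ring_scope.


(* By Brownian scaling, the intersection local time X is below eps = a^3 roughly
   when the two paths separate for good after time a^2: X is then the integral over
   an interval of length of order a of the product of two local times of order a.
   Two independent paths started at 0 stay apart up to time 1 after having spread
   by a with probability of order a^2, so P(X <= eps) is eps^(2/3) up to logarithms
   and E X^(-p) is finite if and only if p < 2/3.

   For the lower bound on P(X <= a^3), B ends its first a^2 units of time well
   below 0 and then never returns near 0, while B' does the opposite.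
   For the upper bound, cover the range of the paths by levels at distance of order
   a.  When a path first passes a level, it has a fixed chance rho, independently
   of the past, of charging an interval of length of order a next to that level
   with local time of order a within time a^2.  Among M^2 levels that both paths
   pass, the probability that no level is charged by both is at most
   2 (M + 1) (1 - rho)^M; here M is taken of order log (1/a).  Moreover, with
   probability 1 - O(M^4 a^2) there is one side on which both paths pass all of
   these levels, because a path fails to pass height c with probability O(c), and
   fails on both sides with probability O(c^2). *)

(** * Gaussian estimates *)

(** Apart from independence, the two processes enter through their common law [mu], whose events
    involve countably many times only. Continuity and local times are no such events. Local time is
    therefore encoded by dyadic averages of [bump] functions, and translated back at almost every
    sample point, where the path is continuous and the occupation formula holds. Stopping times are
    replaced by passages along a grid, so that the Markov property at finitely many deterministic
    times suffices. The price is the overshoot at a passage, controlled by [jumps]. Their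
    probability tends to 0 without a rate, so the grid is chosen last, once the scale [a] and the
    number of levels are fixed. Bounds on local time are random. Deterministic constants come from
    countably many events that cover almost all paths: one of them has positive probability. At
    scale [a = 2 ^ - k] the intersection is of order [8 ^ - k] and the probability of order
    [4 ^ - k]. The logarithms are a factor [k ^ 4] in the upper bound, absorbed by the strict
    inequality [p < 2 / 3]; the lower bound has no such loss, which settles [p = 2 / 3]. *)

Section pushforward_measure.
Context d d' (T1 : measurableType d) (T2 : measurableType d') (R : realType).

Definition pushm (m : {measure set T1 -> \bar R}) (f : T1 -> T2)
    (mf : measurable_fun setT f) : {measure set T2 -> \bar R} :=
  measure_function_pushforward__canonical__measure_function_Measure m mf.

End pushforward_measure.

Section lebesgue_scaling.
Context {R : realType}.
Notation mu := (@lebesgue_measure R).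

(** By uniqueness of Lebesgue measure it is enough to compare both sides on intervals []a, b]].
    Negative [c] is included for the sake of reflections. *)
Lemma lebesgue_measure_scale (c : R) (A : set R) : c != 0 -> measurable A ->
  mu A = (`|c|%:E * mu (( *%R c) @^-1` A))%E.
Proof.
move=> c0 mA.
have mc : measurable_fun setT ( *%R c : measurableTypeR R -> measurableTypeR R).
  exact: mulrl_measurable.
pose m : {measure set (measurableTypeR R) -> \bar R} :=
  mscale (NngNum (normr_ge0 c)) (pushm mu mc).
apply: (@lebesgue_measure_unique _ m _ A mA) => _ [[a b] _ <-] /=.
rewrite /mscale/= /pushforward.
have [c_gt0|c_le0] := ltP 0 c.
  have -> : ( *%R c) @^-1` `]a, b]%classic = `]c^-1 * a, c^-1 * b]%classic.
    apply/seteqP; split => x /=; rewrite !in_itv/= => /andP[h1 h2].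
      by rewrite !ltr_pdivrMl ?ler_pdivlMl// h1 h2.
    by move: h1 h2; rewrite !ltr_pdivrMl ?ler_pdivlMl// => -> ->.
  rewrite !lebesgue_measure_itv/= !lte_fin ltr_pM2l ?invr_gt0//.
  case: ifPn => _; last by rewrite mule0.
  by rewrite gtr0_norm// -!EFinB -EFinM; congr EFin; field.
have c_lt0 : c < 0 by rewrite lt_neqAle c0.
have -> : ( *%R c) @^-1` `]a, b]%classic = `[c^-1 * b, c^-1 * a[%classic.
  apply/seteqP; split => x /=; rewrite !in_itv/= => /andP[h1 h2].
    by rewrite ler_ndivrMl// ltr_ndivlMl// h1 h2.
  by move: h1 h2; rewrite ler_ndivrMl// ltr_ndivlMl// => -> ->.
rewrite !lebesgue_measure_itv/= !lte_fin ltr_nM2l ?invr_lt0//.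
case: ifPn => _; last by rewrite mule0.
by rewrite ltr0_norm// -!EFinB -EFinM; congr EFin; field.
Qed.

Lemma ge0_integral_scale (c : R) (f : R -> \bar R) : c != 0 ->
  measurable_fun setT f -> (forall x, (0 <= f x)%E) ->
  (\int[mu]_x f x = `|c|%:E * \int[mu]_x f (c * x)%R)%E.
Proof.
move=> c0 mf f0.
have mc : measurable_fun setT ( *%R c : measurableTypeR R -> measurableTypeR R).
  exact: mulrl_measurable.
pose m : {measure set (measurableTypeR R) -> \bar R} :=
  mscale (NngNum (normr_ge0 c)) (pushm mu mc).
transitivity (\int[m]_x f x)%E.
  apply: eq_measure_integral => A mA _.
  exact: lebesgue_measure_scale.
rewrite ge0_integral_mscale//=; congr (_ * _)%E.
by rewrite (@ge0_integral_pushforward _ _ (measurableTypeR R) (measurableTypeR R) R ( *%R c) mc mu setT f).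
Qed.

End lebesgue_scaling.

Section normal_estimates.
Context {R : realType}.
Notation mu := (@lebesgue_measure R).

Lemma normal_prob_scale (c s : R) (A : set R) : c != 0 -> 0 < s ->
  measurable A ->
  normal_prob 0 s (( *%R c) @^-1` A) = normal_prob 0 (`|c| * s) A.
Proof.
move=> c0 s0 mA.
have mc : measurable_fun setT ( *%R c : measurableTypeR R -> measurableTypeR R).
  exact: mulrl_measurable.
have cs0 : 0 < `|c| * s by rewrite mulr_gt0 ?normr_gt0.
have mpdf u : measurable_fun setT
    ((fun x => (normal_pdf 0 u x)%:E) \_ A : measurableTypeR R -> \bar R).
  apply/(measurable_restrictT _ _).1 => //.
  by apply/measurable_EFinP; apply: measurable_funTS; exact: measurable_normal_pdf.
have pdf0 u x : (0 <= ((fun x => (normal_pdf 0 u x)%:E) \_ A) x)%E.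
  by rewrite erestrict_ge0// => y _; rewrite lee_fin normal_pdf_ge0.
rewrite /normal_prob [RHS]integral_mkcond [LHS]integral_mkcond.
apply: (etrans _ (esym (ge0_integral_scale c0 (mpdf (`|c| * s)) (pdf0 _)))).
rewrite -ge0_integralZl//=; last first.
  exact: (measurableT_comp (mpdf _) mc).
apply: eq_integral => x _; rewrite !patchE.
have -> : (x \in ( *%R c) @^-1` A) = (c * x \in A) by apply/idP/idP; rewrite !inE.
case: ifPn => _; last by rewrite mule0.
rewrite -EFinM; congr EFin.
rewrite !normal_pdfE ?gt_eqF// /normal_peak /normal_fun !subr0.
have -> : (`|c| * s) ^+ 2 * pi *+ 2 = `|c| ^+ 2 * (s ^+ 2 * pi *+ 2) by ring.
rewrite sqrtrM ?sqr_ge0// sqrtr_sqr normr_id invfM mulrA mulrA divff ?normr_eq0// mul1r.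
congr (_ * expR _); rewrite !exprMn (real_normK (num_real c)); field.
by rewrite c0 gt_eqF.
Qed.

Lemma normal_probN (s : R) (A : set R) : 0 < s -> measurable A ->
  normal_prob 0 s (-%R @^-1` A) = normal_prob 0 s A.
Proof.
move=> s0 mA; have := @normal_prob_scale (-1) s A _ s0 mA.
rewrite normrN1 mul1r => <-; last by rewrite oppr_eq0 oner_eq0.
by congr (normal_prob _ _ _); apply/seteqP; split => x /=; rewrite mulN1r.
Qed.

(** The standard normal density is at most 1, as [2 * pi >= 1]. *)
Lemma normal_prob_le (A : set R) : measurable A ->
  (normal_prob 0 1 A <= mu A)%E.
Proof.
move=> mA; rewrite /normal_prob.
apply: (@le_trans _ _ (\int[mu]_(x in A) 1%:E)%E); last first.
  by rewrite integral_cst// mul1e.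
apply: ge0_le_integral => //.
- by move=> x _; rewrite lee_fin normal_pdf_ge0.
- by apply/measurable_EFinP; apply: measurable_funTS; exact: measurable_normal_pdf.
- move=> x _; rewrite lee_fin (le_trans (normal_pdf_ub _ _ _)) ?oner_neq0//.
  rewrite /normal_peak invf_le1 ?sqrtr_gt0 ?mulrn_wgt0 ?mulr_gt0 ?pi_gt0//.
  rewrite -[leLHS]sqrtr1 ler_wsqrtr// expr1n mul1r mulr2n.
  have := @pi_ge2 R; lra.
Qed.

(** The constant is the density at [M], its minimum over [[- M, M]]. *)
Lemma normal_prob_itv_ge (M : R) : exists2 c : R, 0 < c &
  forall u v : R, - M <= u -> u <= v -> v <= M ->
    ((c * (v - u))%:E <= normal_prob 0 1 `[u, v[)%E.
Proof.
pose c : R := normal_peak 1 * expR (- M ^+ 2 / (1 ^+ 2 *+ 2)).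
have c0 : 0 < c by rewrite mulr_gt0 ?expR_gt0// normal_peak_gt0 ?oner_neq0.
exists c => //.
move=> u v Mu uv vM; have M0 : 0 <= M by lra.
rewrite /normal_prob.
apply: (@le_trans _ _ (\int[mu]_(x in `[u, v[) c%:E)%E).
  rewrite integral_cst//= lebesgue_measure_itv/= lte_fin.
  case: ifPn => [_|]; first by rewrite -EFinB -EFinM.
  by rewrite -leNgt mule0 lee_fin => vu; rewrite mulr_ge0_le0 ?(ltW c0)// subr_le0.
apply: ge0_le_integral => //.
- by move=> x _; rewrite lee_fin mulr_ge0 ?normal_peak_ge0 ?expR_ge0.
- by apply/measurable_EFinP; apply: measurable_funTS; exact: measurable_normal_pdf.
- move=> x /=; rewrite in_itv/= => /andP[ux xv].
  rewrite lee_fin normal_pdfE ?oner_neq0// ler_wpM2l ?normal_peak_ge0//.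
  rewrite /normal_fun subr0 ler_expR ler_wpM2r ?invr_ge0 ?mulrn_wge0 ?expr1n//.
  rewrite lerN2 -[leLHS]real_normK ?num_real// lerXn2r ?nnegrE//.
  by rewrite ler_norml (le_trans Mu ux) (le_trans (ltW xv) vM).
Qed.

End normal_estimates.

(** * The Markov property in law *)

Section generated_sigma_algebra.
Context d (T : measurableType d) (R : realType).

Lemma eq_finite_measure_generated (G : set (set T))
    (m1 m2 : {measure set T -> \bar R}) :
  G `<=` measurable -> setI_closed G -> G setT -> (m1 setT < +oo)%E ->
  (forall A, G A -> m1 A = m2 A) -> forall E, <<s G >> E -> m1 E = m2 E.
Proof.
move=> Gm GI GT mT m12 E; apply: (g_sigma_algebra_measure_unique G Gm (fun=> setT)) => //.
by apply/seteqP; split => // x _; exists 0%N.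
Qed.

End generated_sigma_algebra.

Section cylinder_algebra.
Context {I : choiceType} {R : realType}.

Definition cylinder (D : set I) : set (set (I -> R)) :=
  [set E | exists K : seq I, exists A : I -> set R,
    [/\ forall s, s \in K -> D s, forall s, measurable (A s)
      & E = [set x | forall s, s \in K -> A s (x s)] ] ].

Definition paths (D : set I) := g_sigma_algebraType (cylinder D).

Lemma cylinder_setI (D : set I) : setI_closed (cylinder D).
Proof.
move=> _ _ [K1 [A1 [D1 m1 ->]]] [K2 [A2 [D2 m2 ->]]].
exists (K1 ++ K2), (fun s => (if s \in K1 then A1 s else setT) `&`
                             (if s \in K2 then A2 s else setT)); split.
- by move=> s; rewrite mem_cat => /orP[/D1|/D2].
- by move=> s; apply: measurableI; case: ifP.
- apply/seteqP; split => x /=.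
    by move=> [h1 h2] s _; split; case: ifP => // /[dup] sK _; [exact: h1|exact: h2].
  move=> h; split => s sK; have := h s; rewrite mem_cat sK ?orbT => /(_ isT)[];
  by case: ifP.
Qed.

Lemma cylinderT (D : set I) : cylinder D setT.
Proof.
exists [::], (fun=> setT); split => //.
by apply/seteqP; split.
Qed.

Lemma measurable_eval (D : set I) (s : I) : D s ->
  measurable_fun setT ((fun x => x s) : paths D -> R).
Proof.
move=> Ds _ A mA; rewrite setTI; apply: sub_sigma_algebra.
exists [:: s], (fun=> A); split => //.
  by move=> u; rewrite inE => /eqP ->.
apply/seteqP; split => x /=.
  by move=> As u; rewrite inE => /eqP ->.
by move=> /(_ s); rewrite inE eqxx; apply.
Qed.

Lemma measurable_path d (T : measurableType d) (D : set I) (X : I -> T -> R) :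
  (forall s, D s -> measurable_fun setT (X s)) ->
  measurable_fun setT ((fun w s => X s w) : T -> paths D).
Proof.
move=> mX; apply: (@measurability _ _ T (paths D) setT _ (cylinder D)) => //.
move=> _ [_ [K [A [KD mA ->]]] <-]; rewrite setTI.
elim: K KD => [|s K IH] KD.
  rewrite (_ : _ @^-1` _ = setT)//; first by apply/seteqP; split.
rewrite (_ : _ @^-1` _ = X s @^-1` A s `&`
    (fun w s => X s w) @^-1` [set x | forall s, s \in K -> A s (x s)]).
  apply: measurableI; last by apply: IH => u uK; apply: KD; rewrite inE uK orbT.
  rewrite -[X in measurable X]setTI; apply: mX => //.
  by apply: KD; rewrite mem_head.
apply/seteqP; split => w /=.
  move=> h; split; first by apply: h; rewrite mem_head.
  by move=> u uK; apply: h; rewrite inE uK orbT.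
by move=> [h1 h2] u; rewrite inE => /predU1P[->//|/h2].
Qed.

End cylinder_algebra.

Lemma measurable_preimageT d d' (T : measurableType d) (U : measurableType d')
    (F : T -> U) (A : set U) :
  measurable_fun setT F -> measurable A -> measurable (F @^-1` A).
Proof. by move=> mF mA; rewrite -[X in measurable X]setTI; exact: mF. Qed.

Section markov.
Context d (T : measurableType d) (R : realType) (P : probability T R).

(** A pi-lambda argument with [E] fixed: both sides are finite measures in [C] that agree on a
    generating pi-system. Independence of two families follows by one use for each factor. *)
Lemma eq_joint_generated d' (S : measurableType d') (G : set (set S))
    (E : set T) (F F' : T -> S) (k : \bar R) :
  measurable = <<s G >> -> setI_closed G -> G setT -> measurable E ->
  measurable_fun setT F -> measurable_fun setT F' ->
  (0 <= k)%E -> (k < +oo)%E ->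
  (forall C, G C -> P (E `&` F @^-1` C) = (k * P (F' @^-1` C))%E) ->
  forall C, measurable C -> P (E `&` F @^-1` C) = (k * P (F' @^-1` C))%E.
Proof.
move=> mG GI GT mE mF mF' k0 koo h C mC.
have kfin : k \is a fin_num by rewrite ge0_fin_numE.
have fk0 : 0 <= fine k by rewrite fine_ge0.
pose m1 : {measure set S -> \bar R} := pushm (mrestr P mE) mF.
pose m2 : {measure set S -> \bar R} := mscale (NngNum fk0) (pushm P mF').
have m1E B : m1 B = P (E `&` F @^-1` B).
  by rewrite /m1 /= /pushforward /mrestr setIC.
have m2E B : m2 B = (k * P (F' @^-1` B))%E.
  by rewrite /m2 /= /mscale /= fineK.
rewrite -m1E -m2E; apply: (@eq_finite_measure_generated _ _ _ G) => //.
- by rewrite mG; exact: sub_sigma_algebra.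
- rewrite m1E setIT (le_lt_trans (probability_le1 P mE))// ltry//.
- by move=> B GB; rewrite m1E m2E h.
- by rewrite -mG.
Qed.

(** Padding with 0 beyond [n] lets vectors of all lengths live in a single path space over [nat]. *)
Definition vector (n : nat) (X : nat -> T -> R) (w : T) : nat -> R :=
  fun i => if (i < n)%N then X i w else 0.

Lemma measurable_vector n X : (forall i, measurable_fun setT (X i)) ->
  measurable_fun setT (vector n X : T -> @paths nat R setT).
Proof.
move=> mX; apply: (@measurable_path _ _ _ _ _ (fun i w => vector n X w i)) => i _.
by rewrite /vector; case: (i < n)%N.
Qed.

(** A condition on a coordinate beyond the length bears on the padding value 0, so it is either void
    or impossible. *)
Lemma cylinder_vector n (X : nat -> T -> R) (K : seq nat) (A : nat -> set R) :
  vector n X @^-1` [set x | forall i, i \in K -> A i (x i)] =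
  (if `[< forall i, i \in K -> (n <= i)%N -> A i 0 >] then
   \bigcap_(i < n) (X i @^-1` (if i \in K then A i else setT)) else set0).
Proof.
apply/seteqP; split => w; rewrite /vector/=.
  move=> h; case: ifPn => [_ i /= ni|/asboolP[i iK ni]].
    by case: ifPn => // /h; rewrite ni.
  by have := h _ iK; rewrite ltnNge ni.
case: ifPn => // /asboolP h0 h i iK; case: ifPn => ni.
  by have := h _ ni; rewrite iK.
by apply: h0 => //; rewrite leqNgt.
Qed.

(** Marginals determine the joint law of independent variables, so [Z] can stand in for the last [m]
    of them rescaled by [c]. The product rule is checked on cylinders, then extended to one factor
    at a time. *)
Lemma independent_vectors (n m : nat) (X Z : nat -> T -> R) (c : R)
    (C1 C2 : set (@paths nat R setT)) :
  (forall i, measurable_fun setT (X i)) ->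
  (forall i, measurable_fun setT (Z i)) ->
  mutually_independent P (n + m) X -> mutually_independent P m Z ->
  (forall j A, (j < m)%N -> measurable A ->
     P ((fun w => c * X (n + j)%N w) @^-1` A) = P (Z j @^-1` A)) ->
  measurable C1 -> measurable C2 ->
  P (vector n X @^-1` C1 `&` vector m (fun j w => c * X (n + j)%N w) @^-1` C2) =
  (P (vector n X @^-1` C1) * P (vector m Z @^-1` C2))%E.
Proof.
move=> mX mZ iX iZ XZ mC1 mC2.
pose Y := fun j w => c * X (n + j)%N w.
have mY j : measurable_fun setT (Y j) by exact: measurable_funM.
have mvX := measurable_vector n mX.
have mvY := measurable_vector m mY.
have mvZ := measurable_vector m mZ.
have finP A : measurable A -> (P A < +oo)%E.
  by move=> mA; rewrite (le_lt_trans (probability_le1 P mA))// ltry.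
have cyl C1' C2' : @cylinder nat R setT C1' -> @cylinder nat R setT C2' ->
    P (vector n X @^-1` C1' `&` vector m Y @^-1` C2') =
    (P (vector n X @^-1` C1') * P (vector m Z @^-1` C2'))%E.
  move=> [K1 [A1 [_ mA1 ->]]] [K2 [A2 [_ mA2 ->]]].
  rewrite !cylinder_vector.
  case: ifP => _; last by rewrite set0I !measure0 mul0e.
  case: ifP => _; last by rewrite setI0 !measure0 mule0.
  pose A1' i := if i \in K1 then A1 i else setT.
  pose A2' i := if i \in K2 then A2 i else setT.
  have mA1' i : measurable (A1' i) by rewrite /A1'; case: ifP.
  have mA2' i : measurable (A2' i) by rewrite /A2'; case: ifP.
  pose A i := if (i < n)%N then A1' i else ( *%R c) @^-1` (A2' (i - n)%N).
  have mA i : measurable (A i).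
    rewrite /A; case: ifP => // _; apply: measurable_preimageT => //; exact: mulrl_measurable.
  rewrite (_ : _ `&` _ = \bigcap_(i < n + m) (X i @^-1` A i)); last first.
    apply/seteqP; split => w /=.
      move=> [h1 h2] i /= inm; rewrite /A; case: ltnP => ni /=; first exact: h1.
      have im : (i - n < m)%N by rewrite ltn_subLR.
      by have := h2 _ im; rewrite /Y/= subnKC.
    move=> h; split => i /= ni.
      by have := h i (leq_trans ni (leq_addr _ _)); rewrite /A/= ni.
    have := h (n + i)%N; rewrite /= ltn_add2l => /(_ ni).
    by rewrite /A/= ltnNge leq_addr/= addKn.
  rewrite iX// big_split_ord/=; congr (_ * _)%E.
    pose A0 i := if (i < n)%N then A1' i else setT.
    have mA0 i : measurable (A0 i) by rewrite /A0; case: ifP.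
    have -> : \bigcap_(i < n) (X i @^-1` A1' i) =
        \bigcap_(i < n + m) (X i @^-1` A0 i).
      rewrite /A0; apply/seteqP; split => w h i /= ni.
        by case: ifPn => // /h.
      by have := h i (leq_trans ni (leq_addr _ _)); rewrite /= ni.
    rewrite iX// big_split_ord/= [X in _ = (_ * X)%E]big1 ?mule1.
      by apply: eq_bigr => i _; rewrite /A /A0 ltn_ord.
    by move=> i _; rewrite /A0 ltnNge leq_addr/= preimage_setT probability_setT.
  rewrite (iZ A2')//; apply: eq_bigr => i _.
  transitivity (P ((fun w => c * X (n + i)%N w) @^-1` A2' i)); last exact: XZ.
  by rewrite /A ltnNge leq_addr/= addKn.
have step1 C1' : @cylinder nat R setT C1' ->
    P (vector n X @^-1` C1' `&` vector m Y @^-1` C2) =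
    (P (vector n X @^-1` C1') * P (vector m Z @^-1` C2))%E.
  move=> cC1.
  have mC1' : measurable (C1' : set (@paths nat R setT)) by exact: sub_sigma_algebra.
  apply: (@eq_joint_generated _ (@paths nat R setT) (@cylinder nat R setT)) => //.
  - exact: cylinder_setI.
  - exact: cylinderT.
  - exact: (measurable_preimageT mvX mC1').
  - exact: finP (measurable_preimageT mvX mC1').
  - by move=> C cC; exact: cyl.
rewrite setIC muleC.
apply: (@eq_joint_generated _ (@paths nat R setT) (@cylinder nat R setT)) => //.
- exact: cylinder_setI.
- exact: cylinderT.
- exact: (measurable_preimageT mvY mC2).
- exact: finP (measurable_preimageT mvZ mC2).
- by move=> C cC; rewrite setIC muleC; exact: step1.
Qed.

End markov.

Section grid.
Context {R : realType}.

(** A cylinder constrains finitely many times; sorting [0 :: U] turns them into a grid, continued by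
    the constant [t]. Times may repeat. *)
Lemma exists_grid (U : seq R) (t : R) : 0 <= t ->
  (forall u, u \in U -> 0 <= u <= t) ->
  exists g : nat -> R, exists n : nat, exists ix : R -> nat,
    [/\ g 0%N = 0, forall i, g i <= g i.+1, forall i, (n <= i)%N -> g i = t
      & forall u, u \in U -> (ix u <= n)%N /\ g (ix u) = u].
Proof.
move=> t0 Ut; pose s : seq R := sort <=%R (0 :: U).
have mem_s (u : R) : (u \in s) = (u \in 0 :: U) by rewrite mem_sort.
have s_ge0 (u : R) : u \in s -> 0 <= u <= t.
  by rewrite mem_s inE => /predU1P[->|/Ut//]; rewrite lexx.
have sorted_s : sorted <=%R s by exact/sort_sorted/le_total.
exists (nth t s), (size s), (index^~ s); split.
- have s0 : (0 < size s)%N by rewrite size_sort.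
  apply/le_anti/andP; split; last by have /andP[] := s_ge0 _ (mem_nth t s0).
  have i0 : (index (0%R : R) s < size s)%N by rewrite index_mem mem_s mem_head.
  rewrite -[leRHS](nth_index t (_ : 0 \in s)) ?mem_s ?mem_head//.
  by rewrite (sorted_leq_nth le_trans lexx t sorted_s)// inE.
- move=> i; have [si|si] := ltnP i.+1 (size s).
    by rewrite (sorted_leq_nth le_trans lexx t sorted_s)// inE// ltnW.
  rewrite [leRHS]nth_default//; have [si'|si'] := ltnP i (size s).
    by have /andP[] := s_ge0 _ (mem_nth t si').
  by rewrite nth_default.
- by move=> i si; rewrite nth_default.
- move=> u uU; have us : u \in s by rewrite mem_s inE uU orbT.
  by rewrite nth_index// ltnW// index_mem.
Qed.

(** Recovers the value of a path at time [s] from its increments along a grid, [ix s] being the rank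
    of [s] in that grid. *)
Definition psum (ix : R -> nat) (x : nat -> R) : R -> R :=
  fun s => \sum_(j < ix s) x j.

Lemma measurable_psum ix (D : set R) (C : set (paths D)) : measurable C ->
  measurable (psum ix @^-1` C : set (@paths nat R setT)).
Proof.
apply: measurable_preimageT.
apply: (@measurable_path R R _ (@paths nat R setT) D (fun s x => psum ix x s)).
move=> s _; apply: measurable_sum => j; exact: measurable_eval.
Qed.

End grid.

Section brownian.
Context d (T : measurableType d) (R : realType) (P : probability T R).
Implicit Types W : R -> T -> R.

(** The start at 0 holds everywhere, so that values are exact sums of increments. Continuity is kept
    apart, since it is not a property of the finite-dimensional laws. *)
Definition brownian W : Prop :=
  [/\ forall t, measurable_fun setT (W t),
      forall w, W 0 w = 0,
      forall (n : nat) (t : nat -> R), 0 <= t 0%N ->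
        (forall i, t i <= t i.+1) ->
        mutually_independent P n (fun i => W (t i.+1) \- W (t i))
    & forall s t : R, 0 <= s -> s < t -> forall A : set R, measurable A ->
        P ((W t \- W s) @^-1` A) = normal_prob 0 (Num.sqrt (t - s)) A].

Definition path W (w : T) : R -> R := fun s => W s w.

(** Brownian rescaling of the piece of path on [[t, t + h]] to unit time. *)
Definition shift (t h : R) (x : R -> R) : R -> R :=
  fun s => (x (t + h * s) - x t) / Num.sqrt h.

Lemma telescope_path (g : nat -> R) (x : R -> R) (k : nat) :
  \sum_(j < k) (x (g j.+1) - x (g j)) = x (g k) - x (g 0%N).
Proof.
rewrite -(big_mkord xpredT (fun j => x (g j.+1) - x (g j))).
by rewrite telescope_sumr.
Qed.

Lemma brownian_increment_scale W W' (s t s' t' c : R) (A : set R) :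
  brownian W -> brownian W' -> 0 <= s -> s <= t -> 0 <= s' -> s' <= t' ->
  0 < c -> t' - s' = c ^+ 2 * (t - s) -> measurable A ->
  P ((fun w => c * (W t w - W s w)) @^-1` A) = P ((W' t' \- W' s') @^-1` A).
Proof.
move=> [_ _ _ gW] [_ _ _ gW'] s0 st s'0 st' c0 e mA.
(* Grids may repeat a time, and the Gaussian clause of [brownian] does not cover null increments. *)
move: st; rewrite le_eqVlt => /predU1P[st|st].
  move: e; rewrite st subrr mulr0 => /eqP; rewrite subr_eq0 => /eqP ->.
  by congr (P _); apply/seteqP; split => w /=; rewrite !subrr mulr0.
have st'2 : s' < t' by rewrite -subr_gt0 e mulr_gt0 ?exprn_gt0// subr_gt0.
rewrite gW'// e sqrtrM ?exprn_ge0 ?(ltW c0)// sqrtr_sqr.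
rewrite -normal_prob_scale ?gt_eqF// ?sqrtr_gt0 ?subr_gt0//.
rewrite -gW//; apply: measurable_preimageT => //; exact: mulrl_measurable.
Qed.

(** Two facts in one. For [W' = W] it is the Markov property at [t] combined with Brownian scaling;
    for [t = 0], [h = 1] and [C1 = setT] it says that any two Brownian motions have the same law. *)
Lemma brownian_markov W W' (t h : R) (C1 : set (paths `[0, t]%classic))
    (C2 : set (paths `[0, 1]%classic)) :
  brownian W -> brownian W' -> 0 <= t -> 0 < h ->
  measurable C1 -> measurable C2 ->
  P (path W @^-1` (C1 `&` shift t h @^-1` C2)) =
  (P (path W @^-1` C1) * P (path W' @^-1` C2))%E.
Proof.
move=> bW bW' t0 h0 mC1 mC2.
have [mW W0 iW gW] := bW; have [mW' W'0 iW' gW'] := bW'.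
have finP A : measurable A -> (P A < +oo)%E.
  by move=> mA; rewrite (le_lt_trans (probability_le1 P mA))// ltry.
have mp (D : set R) V : (forall s, measurable_fun setT (V s)) ->
    measurable_fun setT (path V : T -> paths D).
  by move=> mV; exact: (@measurable_path R R _ T D V).
pose Y : R -> T -> R := fun s w => shift t h (path W w) s.
have mY s : measurable_fun setT (Y s).
  apply: (@measurable_funM _ _ _ _ (W (t + h * s) \- W t) (cst _)) => //.
  exact: measurable_funB.
have cyl (D1 D2 : set (R -> R)) : cylinder `[0, t]%classic D1 ->
    cylinder `[0, 1]%classic D2 ->
    P (path W @^-1` D1 `&` path Y @^-1` D2) =
    (P (path W @^-1` D1) * P (path W' @^-1` D2))%E.
  move=> [K1 [A1 [K1t mA1 ->]]] [K2 [A2 [K2t mA2 ->]]].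
  have [|g [n [ix [g0 gS gn gix]]]] := @exists_grid R K1 t t0.
    by move=> u /K1t; rewrite /= in_itv.
  have [|g' [m [ix' [g'0 g'S g'm gix']]]] := @exists_grid R K2 1 ler01.
    by move=> u /K2t; rewrite /= in_itv.
  have g_ge0 i : 0 <= g i.
    by elim: i => [|i IH]; [rewrite g0|exact: le_trans (gS i)].
  have g'_ge0 i : 0 <= g' i.
    by elim: i => [|i IH]; [rewrite g'0|exact: le_trans (g'S i)].
  (* The grid of the past is continued by the image of the second grid under [s -> t + h * s]; both
     give [t] at rank [n]. *)
  pose G i := if (i <= n)%N then g i else t + h * g' (i - n)%N.
  have GD i : G (n + i)%N = t + h * g' i.
    rewrite /G -[X in (_ <= X)%N]addn0 leq_add2l leqn0 addKn.
    by case: eqP => // ->; rewrite addn0 g'0 mulr0 addr0 gn.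
  have GS i : G i <= G i.+1.
    have [ni|ni] := ltnP i n; first by rewrite /G ni (ltnW ni).
    rewrite -(subnKC ni) -addnS !GD lerD2l ler_pM2l//.
  pose X i : T -> R := W (G i.+1) \- W (G i).
  pose Z i : T -> R := W' (g' i.+1) \- W' (g' i).
  pose E1 : set (R -> R) := [set x | forall s, s \in K1 -> A1 s (x s)].
  pose E2 : set (R -> R) := [set x | forall s, s \in K2 -> A2 s (x s)].
  have mE1 : measurable (E1 : set (paths `[0, t]%classic)).
    by apply: sub_sigma_algebra; exists K1, A1.
  have mE2 : measurable (E2 : set (paths `[0, 1]%classic)).
    by apply: sub_sigma_algebra; exists K2, A2.
  have -> : path W @^-1` E1 = vector n X @^-1` (psum ix @^-1` E1).
    have e w s : s \in K1 -> psum ix (vector n X w) s = path W w s.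
      move=> /gix[ixn gs]; rewrite /psum.
      rewrite (eq_bigr (fun j : 'I_(ix s) => path W w (g j.+1) - path W w (g j))).
        by rewrite telescope_path gs g0 /path W0 subr0.
      move=> j _; have jn : (j < n)%N by exact: leq_trans ixn.
      by rewrite /vector jn /X /= /G jn (ltnW jn).
    by apply/seteqP; split => w /= h1 s sK; have := h1 s sK; rewrite e.
  have -> : path Y @^-1` E2 =
      vector m (fun j w => (Num.sqrt h)^-1 * X (n + j)%N w) @^-1` (psum ix' @^-1` E2).
    have e w s : s \in K2 ->
        psum ix' (vector m (fun j w => (Num.sqrt h)^-1 * X (n + j)%N w) w) s =
        path Y w s.
      move=> /gix'[ixn gs]; rewrite /psum.
      pose H i := t + h * g' i.
      rewrite (eq_bigr (fun j : 'I_(ix' s) =>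
        (Num.sqrt h)^-1 * (path W w (H j.+1) - path W w (H j)))).
        rewrite -mulr_sumr telescope_path /H gs g'0 mulr0 addr0.
        by rewrite mulrC.
      move=> j _; have jn : (j < m)%N by exact: leq_trans ixn.
      by rewrite /vector jn /X /= -addnS !GD.
    by apply/seteqP; split => w /= h1 s sK; have := h1 s sK; rewrite e.
  have -> : path W' @^-1` E2 = vector m Z @^-1` (psum ix' @^-1` E2).
    have e w s : s \in K2 -> psum ix' (vector m Z w) s = path W' w s.
      move=> /gix'[ixn gs]; rewrite /psum.
      rewrite (eq_bigr (fun j : 'I_(ix' s) => path W' w (g' j.+1) - path W' w (g' j))).
        by rewrite telescope_path gs g'0 /path W'0 subr0.
      move=> j _; have jn : (j < m)%N by exact: leq_trans ixn.
      by rewrite /vector jn.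
    by apply/seteqP; split => w /= h1 s sK; have := h1 s sK; rewrite e.
  apply: independent_vectors.
  - by move=> i; exact: measurable_funB.
  - by move=> i; exact: measurable_funB.
  - by apply: iW => //; rewrite /G /= g0.
  - by apply: iW' => //; rewrite g'0.
  - move=> j A jm mA; apply: brownian_increment_scale => //.
    + by rewrite GD addr_ge0// mulr_ge0// ltW.
    + by rewrite invr_gt0 sqrtr_gt0.
    + rewrite exprVn sqr_sqrtr ?(ltW h0)// -addnS !GD; field.
      by rewrite gt_eqF.
  - exact: measurable_psum mE1.
  - exact: measurable_psum mE2.
have step1 D1 : cylinder `[0, t]%classic D1 ->
    P (path W @^-1` D1 `&` path Y @^-1` C2) =
    (P (path W @^-1` D1) * P (path W' @^-1` C2))%E.
  move=> cD1.
  have mD1 : measurable (path W @^-1` D1).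
    apply: (measurable_preimageT (mp `[0, t]%classic W mW)).
    exact: sub_sigma_algebra.
  apply: (@eq_joint_generated _ _ _ _ _ (paths `[0, 1]%classic)
    (cylinder `[0, 1]%classic)) => //.
  - exact: cylinder_setI.
  - exact: cylinderT.
  - exact: mp.
  - exact: mp.
  - exact: finP.
  - by move=> C cC; exact: cyl.
rewrite preimage_setI setIC muleC.
apply: (@eq_joint_generated _ _ _ _ _ (paths `[0, t]%classic)
    (cylinder `[0, t]%classic)) => //.
- exact: cylinder_setI.
- exact: cylinderT.
- exact: (measurable_preimageT (mp _ Y mY) mC2).
- exact: mp.
- exact: mp.
- exact: finP (measurable_preimageT (mp _ W' mW') mC2).
- by move=> C cC; rewrite setIC muleC; exact: step1.
Qed.

End brownian.

(** * Discretized Brownian paths *)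

Section real_probability.
Context d (T : measurableType d) (R : realType) (P : probability T R).
Implicit Types A B : set T.

Definition pr A : R := fine (P A).

Lemma prE A : measurable A -> P A = (pr A)%:E.
Proof. by move=> mA; rewrite /pr fineK// fin_num_measure. Qed.

Lemma pr_ge0 A : 0 <= pr A.
Proof. by rewrite /pr fine_ge0. Qed.

Lemma pr_le1 A : measurable A -> pr A <= 1.
Proof. by move=> mA; rewrite -lee_fin -prE// probability_le1. Qed.

Lemma pr_setT : pr setT = 1.
Proof. by rewrite /pr probability_setT. Qed.

Lemma pr_set0 : pr set0 = 0.
Proof. by rewrite /pr measure0. Qed.

Lemma le_pr A B : measurable A -> measurable B -> A `<=` B -> pr A <= pr B.
Proof. by move=> mA mB AB; rewrite -lee_fin -!prE// le_measure// inE. Qed.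

Lemma pr_setDI A B : measurable A -> measurable B ->
  pr A = pr (A `\` B) + pr (A `&` B).
Proof.
move=> mA mB; apply: EFin_inj; rewrite EFinD -!prE ?(measureDI _ mA mB)//.
- exact: measurableI.
- exact: measurableD.
Qed.

Lemma pr_setC A : measurable A -> pr (~` A) = 1 - pr A.
Proof.
by move=> mA; have := pr_setDI measurableT mA; rewrite setTI setTD pr_setT; lra.
Qed.

Lemma pr_setU_le A B : measurable A -> measurable B ->
  pr (A `|` B) <= pr A + pr B.
Proof.
move=> mA mB; rewrite (pr_setDI (measurableU _ _ mA mB) mA) addrC lerD//.
- by apply: le_pr => //; apply: measurableI => //; exact: measurableU.
- apply: le_pr => //; first by apply: measurableD => //; exact: measurableU.
  by move=> x [[]].
Qed.

Lemma pr_le_cover (I : eqType) (s : seq I) (F : I -> set T) A :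
  measurable A -> (forall i, i \in s -> measurable (F i)) ->
  (forall x, A x -> exists2 i, i \in s & F i x) ->
  pr A <= \sum_(i <- s) pr (F i).
Proof.
elim: s A => [|i s IH] A mA mF AF.
  rewrite big_nil (_ : A = set0) ?pr_set0//.
  by apply/seteqP; split => // x /AF[].
have mFi : measurable (F i) by apply: mF; rewrite mem_head.
rewrite big_cons (pr_setDI mA mFi) addrC lerD//.
  by apply: le_pr => //; exact: measurableI.
apply: IH.
- exact: measurableD.
- by move=> j js; apply: mF; rewrite inE js orbT.
- move=> x [/AF[j]]; rewrite inE => /predU1P[->//|js Fj _]; by exists j.
Qed.

Lemma sum_pr_le_disjoint (I : eqType) (s : seq I) (F : I -> set T) A :
  measurable A -> uniq s -> (forall i, i \in s -> measurable (F i)) ->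
  (forall i, i \in s -> F i `<=` A) ->
  (forall i j x, i \in s -> j \in s -> F i x -> F j x -> i = j) ->
  \sum_(i <- s) pr (F i) <= pr A.
Proof.
elim: s A => [|i s IH] A mA /=; first by rewrite big_nil pr_ge0.
move=> /andP[is_ us] mF FA tF.
have mFi : measurable (F i) by apply: mF; rewrite mem_head.
rewrite big_cons (pr_setDI mA mFi) addrC lerD//.
  apply: IH => //.
  - exact: measurableD.
  - by move=> j js; apply: mF; rewrite inE js orbT.
  - move=> j js x Fjx; split; first by apply: (FA j) => //; rewrite inE js orbT.
    move=> Fix; move: is_; rewrite (tF i j x) ?mem_head ?inE ?js ?orbT//.
  - by move=> j k x js ks; apply: tF; rewrite inE ?js ?ks orbT.
apply: le_pr => //; first exact: measurableI.
by move=> x Fix; split => //; apply: (FA i) => //; rewrite mem_head.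
Qed.

Lemma pr_bigcap_ge (F : nat -> set T) (c : R) :
  (forall n, measurable (F n)) -> (forall n m, (n <= m)%N -> F m `<=` F n) ->
  (forall n, c <= pr (F n)) -> c <= pr (\bigcap_n F n).
Proof.
move=> mF dF cF.
have mI : measurable (\bigcap_n F n) by exact: bigcapT_measurable.
have h : (P \o F) x @[x --> \oo] --> P (\bigcap_n F n).
  apply: nonincreasing_cvg_mu => //.
    by rewrite (le_lt_trans (probability_le1 P (mF 0%N)))// ltry.
  by move=> n m nm; apply/subsetPset; exact: dF.
rewrite -lee_fin -prE// -(cvg_lim _ h)//.
apply: lime_ge; first by apply/cvg_ex; eexists; exact: h.
by apply: nearW => n /=; rewrite prE// lee_fin.
Qed.

Lemma pr_nonincreasing_small (F : nat -> set T) (e : R) :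
  (forall n, measurable (F n)) -> (forall n m, (n <= m)%N -> F m `<=` F n) ->
  pr (\bigcap_n F n) = 0 -> 0 < e -> exists N, pr (F N) < e.
Proof.
move=> mF dF F0 e0; apply: contrapT => /forallNP h.
have := @pr_bigcap_ge F e mF dF; rewrite F0 leNgt e0 => H.
suff : false by []; apply: H => n; rewrite leNgt; apply/negP; exact: h.
Qed.

Lemma pr_bigcup0 (F : nat -> set T) : (forall n, measurable (F n)) ->
  (forall n, pr (F n) = 0) -> pr (\bigcup_n F n) = 0.
Proof.
move=> mF F0.
rewrite /pr (_ : P _ = 0%E)//; apply/eqP; rewrite eq_le measure_ge0 andbT.
have mU : measurable (\bigcup_n F n) by exact: bigcupT_measurable.
apply: (le_trans (measure_sigma_subadditive P mF mU _)) => //.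
by rewrite eseries0// => n _ _; rewrite -[LHS]/(P (F n)) (prE (mF n)) F0.
Qed.

End real_probability.

Section measurable_sets.
Context d (T : measurableType d) (R : realType).

Lemma measurable_forall_imp (Q : nat -> Prop) (F : nat -> set T) :
  (forall j, Q j -> measurable (F j)) ->
  measurable [set x | forall j, Q j -> F j x].
Proof.
move=> mF.
rewrite (_ : [set x | _] = \bigcap_j (if `[< Q j >] then F j else setT)).
  by apply: bigcapT_measurable => j; case: asboolP => // /mF.
apply/seteqP; split => x /= h j.
  by move=> _; case: asboolP => // /h.
by have := h j I; case: asboolP.
Qed.

Lemma measurable_exists_and (Q : nat -> Prop) (F : nat -> set T) :
  (forall j, Q j -> measurable (F j)) ->
  measurable [set x | exists2 j, Q j & F j x].
Proof.
move=> mF.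
rewrite (_ : [set x | _] = \bigcup_j (if `[< Q j >] then F j else set0)).
  by apply: bigcupT_measurable => j; case: asboolP => // /mF.
apply/seteqP; split => x /= [j].
  by move=> Qj Fj; exists j => //; case: asboolP.
by move=> _; case: asboolP => // Qj Fj; exists j.
Qed.

Lemma measurable_set_le (f : T -> R) (k : R) : measurable_fun setT f ->
  measurable [set x | f x <= k].
Proof.
move=> mf; rewrite (_ : [set x | _] = f @^-1` `]-oo, k]).
  by apply: measurable_preimageT => //; exact: measurable_itv.
by apply/seteqP; split => x /=; rewrite in_itv.
Qed.

Lemma measurable_set_lt (f : T -> R) (k : R) : measurable_fun setT f ->
  measurable [set x | f x < k].
Proof.
move=> mf; rewrite (_ : [set x | _] = f @^-1` `]-oo, k[).
  by apply: measurable_preimageT => //; exact: measurable_itv.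
by apply/seteqP; split => x /=; rewrite in_itv.
Qed.

Lemma measurable_set_ge (f : T -> R) (k : R) : measurable_fun setT f ->
  measurable [set x | k <= f x].
Proof.
move=> mf; rewrite (_ : [set x | _] = f @^-1` `[k, +oo[).
  by apply: measurable_preimageT => //; exact: measurable_itv.
by apply/seteqP; split => x /=; rewrite in_itv/= andbT.
Qed.

Lemma measurable_set_gt (f : T -> R) (k : R) : measurable_fun setT f ->
  measurable [set x | k < f x].
Proof.
move=> mf; rewrite (_ : [set x | _] = f @^-1` `]k, +oo[).
  by apply: measurable_preimageT => //; exact: measurable_itv.
by apply/seteqP; split => x /=; rewrite in_itv/= andbT.
Qed.

End measurable_sets.

Section path_sets.
Context {R : realType}.

Lemma measurable_paths_sub (D D' : set R) (C : set (R -> R)) : D `<=` D' ->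
  measurable (C : set (@paths R R D)) -> measurable (C : set (@paths R R D')).
Proof.
move=> DD' mC.
apply: (@measurable_preimageT _ _ (paths D') (paths D) id C) => //.
apply: (@measurable_path R R _ (paths D') D (fun s x => x s)) => s /DD'.
exact: measurable_eval.
Qed.

Lemma measurable_shift (t h : R) (D : set R) (C : set (R -> R)) :
  D t -> (forall s, 0 <= s -> s <= 1 -> D (t + h * s)) ->
  measurable (C : set (@paths R R `[0, 1]%classic)) ->
  measurable (shift t h @^-1` C : set (@paths R R D)).
Proof.
move=> Dt Dth mC.
apply: (@measurable_preimageT _ _ (paths D) (paths `[0, 1]%classic)) => //.
apply: (@measurable_path R R _ (paths D) _ (fun s x => shift t h x s)) => s /=.
rewrite in_itv/= => /andP[s0 s1].
apply: (@measurable_funM _ _ _ _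
  (fun x : paths D => x (t + h * s) - x t) (cst _)) => //.
by apply: measurable_funB; apply: measurable_eval => //; exact: Dth.
Qed.

End path_sets.

Section wiener.
Context {R : realType}.
Notation Omega := (@paths R R `[0, 1]%classic).

(* The last clause replaces path continuity, which is not an event of Omega. *)
Definition wiener (mu : probability Omega R) : Prop :=
  [/\ pr mu [set x | x 0 <> 0] = 0,
      forall (t h : R) (C1 C2 : set (R -> R)), 0 <= t -> 0 < h -> t + h <= 1 ->
        measurable (C1 : set (@paths R R `[0, t]%classic)) ->
        measurable (C2 : set Omega) ->
        pr mu (C1 `&` shift t h @^-1` C2) = pr mu C1 * pr mu C2,
      forall A : set R, measurable A ->
        mu [set x | A (x 1)] = normal_prob 0 1 A
    & forall eta e : R, 0 < eta -> 0 < e -> exists N, forall n, (N <= n)%N ->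
        pr mu [set x | exists2 i, (i < n)%N &
                eta < x (i.+1%:R / n%:R) - x (i%:R / n%:R)] < e].

(** For distinct [i] these events are disjoint, and each depends on the path up to time [i / n]
    only. Summing over [i] thus replaces the strong Markov property. *)
Definition passage (n : nat) (k : R) (i : nat) : set (R -> R) :=
  [set x | k <= x (i%:R / n%:R) /\ forall j, (j < i)%N -> x (j%:R / n%:R) < k].

Definition reaches (n : nat) (k : R) : set (R -> R) :=
  [set x | exists2 i, (i <= n)%N & k <= x (i%:R / n%:R)].

Definition jumps (n : nat) (eta : R) : set (R -> R) :=
  [set x | exists2 i, (i < n)%N & eta < x (i.+1%:R / n%:R) - x (i%:R / n%:R)].

Lemma grid_itv (n i : nat) : (i <= n)%N -> 0 <= (i%:R / n%:R : R) <= 1.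
Proof.
move=> ni; apply/andP; split; first by rewrite divr_ge0.
have [->|n0] := posnP n; first by rewrite invr0 mulr0.
by rewrite ler_pdivrMr ?ltr0n// mul1r ler_nat.
Qed.

Lemma le_grid (n i j : nat) : (i <= j)%N -> i%:R / n%:R <= j%:R / n%:R :> R.
Proof. by move=> ij; rewrite ler_wpM2r ?invr_ge0// ler_nat. Qed.

Lemma measurable_passage n k i (t : R) : i%:R / n%:R <= t ->
  measurable (passage n k i : set (@paths R R `[0, t]%classic)).
Proof.
move=> it.
have me j : (j <= i)%N -> measurable_fun setT
    ((fun x => x (j%:R / n%:R)) : @paths R R `[0, t]%classic -> R).
  move=> ji; apply: measurable_eval; rewrite /= in_itv/= divr_ge0//=.
  by rewrite (le_trans _ it)// le_grid.
apply: measurableI; first exact: (measurable_set_ge k (me i (leqnn i))).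
by apply: measurable_forall_imp => j /ltnW ji; exact: (measurable_set_lt k (me j ji)).
Qed.

Lemma measurable_ev (s : R) : 0 <= s <= 1 ->
  measurable_fun setT ((fun x => x s) : Omega -> R).
Proof. by move=> s01; apply: measurable_eval; rewrite /= in_itv. Qed.

Lemma measurable_reaches n k : measurable (reaches n k : set Omega).
Proof.
apply: measurable_exists_and => j jn.
exact: (measurable_set_ge k (measurable_ev (grid_itv jn))).
Qed.

Lemma measurable_jumps n eta : measurable (jumps n eta : set Omega).
Proof.
apply: measurable_exists_and => j jn.
apply: (@measurable_set_gt _ _ _ (fun x : Omega => x (j.+1%:R / n%:R) - x (j%:R / n%:R))).
by apply: measurable_funB; apply: measurable_ev; apply: grid_itv => //; exact: ltnW.
Qed.

Lemma passage_uniq n k i j x : passage n k i x -> passage n k j x -> i = j.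
Proof.
move=> [ki hi] [kj hj]; have [ij|ji|//] := ltngtP i j.
  by have := hj _ ij; rewrite ltNge ki.
by have := hi _ ji; rewrite ltNge kj.
Qed.

Lemma reaches_passage n k x i : k <= x (i%:R / n%:R) ->
  exists2 j, (j <= i)%N & passage n k j x.
Proof.
move=> ki; have ex : exists j, k <= x (j%:R / n%:R) by exists i.
exists (ex_minn ex); first by case: ex_minnP => m _; apply.
case: ex_minnP => m km hm; split => // j jm.
by rewrite ltNge; apply/negP => /hm; rewrite leqNgt jm.
Qed.

Variables (mu : probability Omega R) (hmu : wiener mu).

(** The rescaled increment after [t] is independent of [C] and standard normal, hence symmetric. The
    case [t = 1] is apart because the Markov property needs a positive duration. *)
Lemma wiener_increment_sym (t : R) (C : set (R -> R)) (A : set R) :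
  0 <= t -> t <= 1 -> measurable (C : set (@paths R R `[0, t]%classic)) ->
  measurable A ->
  pr mu (C `&` [set x | A (x 1 - x t)]) = pr mu (C `&` [set x | A (- (x 1 - x t))]).
Proof.
have [_ mk ga _] := hmu.
move=> t0; rewrite le_eqVlt => /predU1P[-> _ _|t1 mC mA].
  by congr (pr _ (_ `&` _)); apply/seteqP; split => x /=; rewrite subrr oppr0.
have t1' : 0 < 1 - t by rewrite subr_gt0.
pose c := Num.sqrt (1 - t).
have c0 : 0 < c by rewrite sqrtr_gt0.
have E (B : set R) : [set x : R -> R | B (x 1 - x t)] =
    shift t (1 - t) @^-1` [set y | (( *%R c) @^-1` B) (y 1)].
  have tE : t + (1 - t) * 1 = 1 by ring.
  have cK u : c * (u / Num.sqrt (1 - t)) = u by rewrite mulrC divfK ?gt_eqF.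
  by apply/seteqP; split => x /=; rewrite /shift tE cK.
have mcB (B : set R) : measurable B -> measurable (( *%R c) @^-1` B).
  by move=> mB; apply: measurable_preimageT => //; exact: mulrl_measurable.
have mev (B : set R) : measurable B ->
    measurable ([set y | (( *%R c) @^-1` B) (y 1)] : set Omega).
  move=> mB; apply: (@measurable_preimageT _ _ Omega _ (fun y : Omega => y 1)).
    by apply: measurable_ev; rewrite ler01 lexx.
  exact: mcB.
have mNA : measurable (-%R @^-1` A).
  by apply: measurable_preimageT => //; exact: oppr_measurable.
have tE : t + (1 - t) <= 1 by rewrite addrC subrK.
have H (B : set R) : measurable B -> pr mu (C `&` [set x | B (x 1 - x t)]) =
    pr mu C * fine (normal_prob 0 1 (( *%R c) @^-1` B)).
  move=> mB; rewrite E (mk t (1 - t) C _ t0 t1' tE mC (mev B mB)).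
  by congr (_ * fine _); exact: ga (mcB B mB).
rewrite (H A mA) [RHS](H _ mNA); congr (_ * fine _).
rewrite -[LHS]normal_probN//; last exact: mcB.
by congr (normal_prob _ _ _); apply/seteqP; split => x /=; rewrite mulrN.
Qed.

End wiener.

(** * The reflection principle along a grid *)

Section reflection.
Context {R : realType}.
Notation Omega := (@paths R R `[0, 1]%classic).
Variables (mu : probability Omega R) (hmu : wiener mu).

Let nu : probability _ R := normal_prob (0 : R) 1.

Lemma wiener_time1 (A : set R) : measurable A ->
  pr mu [set x | A (x 1)] = pr nu A.
Proof. by have [_ _ ga _] := hmu; move=> mA; rewrite /pr ga. Qed.

Lemma measurable_ev1 : measurable_fun setT ((fun x => x 1) : Omega -> R).
Proof. by apply: measurable_ev; rewrite ler01 lexx. Qed.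

Lemma measurable_passage1 n k i : (i <= n)%N ->
  measurable (passage n k i : set Omega).
Proof.
move=> ni; apply: (@measurable_paths_sub _ `[0, i%:R / n%:R]%classic).
  move=> s /=; rewrite !in_itv/= => /andP[-> /le_trans]; apply.
  by have /andP[] := @grid_itv R _ _ ni.
exact: measurable_passage.
Qed.

(** At the passage the path is at or above [k], so ending at most at [k - y] means a later increment
    of at most [- y]; the reflected increment leads to at least [k + y]. The overshoot works in the
    right direction, hence no error term. *)
Lemma reflection_le n (k y : R) : (0 < n)%N -> 0 <= y ->
  pr mu (reaches n k `&` [set x | x 1 <= k - y]) <= pr mu [set x | k + y <= x 1].
Proof.
move=> n0 y0.
have gridn : n%:R / n%:R = 1 :> R by rewrite divff// pnatr_eq0 -lt0n.
pose F i := passage n k i `&` [set x | x 1 - x (i%:R / n%:R) <= - y].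
pose F' i := passage n k i `&` [set x | - (x 1 - x (i%:R / n%:R)) <= - y].
have mdiff i : (i <= n)%N ->
    measurable_fun setT (fun x : Omega => x 1 - x (i%:R / n%:R)).
  move=> ni; apply: measurable_funB; first exact: measurable_ev1.
  exact: (measurable_ev (grid_itv ni)).
have mF i : (i <= n)%N -> measurable (F i : set Omega).
  move=> ni; apply: measurableI; first exact: measurable_passage1.
  exact: (measurable_set_le (- y) (mdiff i ni)).
have mF' i : (i <= n)%N -> measurable (F' i : set Omega).
  move=> ni; apply: measurableI; first exact: measurable_passage1.
  apply: (@measurable_set_le _ _ _ (fun x : Omega => - (x 1 - x (i%:R / n%:R)))).
  exact: (measurable_funN (mdiff i ni)).
apply: (@le_trans _ _ (\sum_(i <- iota 0 n.+1) pr mu (F i))).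
  apply: pr_le_cover.
  - apply: measurableI; first exact: measurable_reaches.
    exact: (measurable_set_le (k - y) measurable_ev1).
  - by move=> i; rewrite mem_iota/= add0n ltnS => /mF.
  - move=> x [[i ni ki] x1]; have [j ji pj] := reaches_passage ki.
    exists j; first by rewrite mem_iota/= add0n ltnS (leq_trans ji).
    split => //=; case: pj => kj _; move: x1 => /=; lra.
rewrite (eq_big_seq (fun i => pr mu (F' i))); last first.
  move=> i; rewrite mem_iota/= add0n ltnS => ni.
  have /andP[g0 g1] := @grid_itv R _ _ ni.
  apply: (wiener_increment_sym hmu (A := [set u | u <= - y]) g0 g1).
    exact: measurable_passage.
  by rewrite (_ : [set u | _] = `]-oo, - y]%classic)//; apply/seteqP; split => u /=; rewrite in_itv.
apply: sum_pr_le_disjoint.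
- exact: (measurable_set_ge (k + y) measurable_ev1).
- exact: iota_uniq.
- by move=> i; rewrite mem_iota/= add0n ltnS => /mF'.
- by move=> i _ x [[ki _] /= xi]; lra.
- by move=> i j x _ _ [pi _] [pj _]; exact: passage_uniq pi pj.
Qed.

(** Without a jump larger than [eta] the overshoot stays below [eta], so ending at or above
    [k + eta] requires a positive increment after the passage. A negative one is equally likely and
    excludes it, whence the factor 2. *)
Lemma reflection_ge n (k eta : R) : (0 < n)%N -> 0 < k -> 0 < eta ->
  2 * pr mu [set x | k + eta <= x 1] <=
  pr mu (reaches n k) + 2 * pr mu (jumps n eta).
Proof.
move=> n0 k0 eta0; have [mu0 _ _ _] := hmu.
have gridn : n%:R / n%:R = 1 :> R by rewrite divff// pnatr_eq0 -lt0n.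
pose F i := passage n k i `&` [set x | 0 < x 1 - x (i%:R / n%:R)].
pose F' i := passage n k i `&` [set x | 0 < - (x 1 - x (i%:R / n%:R))].
have mdiff i : (i <= n)%N ->
    measurable_fun setT (fun x : Omega => x 1 - x (i%:R / n%:R)).
  move=> ni; apply: measurable_funB; first exact: measurable_ev1.
  exact: (measurable_ev (grid_itv ni)).
have mF i : (i <= n)%N -> measurable (F i : set Omega).
  move=> ni; apply: measurableI; first exact: measurable_passage1.
  exact: (measurable_set_gt 0 (mdiff i ni)).
have mF' i : (i <= n)%N -> measurable (F' i : set Omega).
  move=> ni; apply: measurableI; first exact: measurable_passage1.
  apply: (@measurable_set_gt _ _ _ (fun x : Omega => - (x 1 - x (i%:R / n%:R)))).
  exact: (measurable_funN (mdiff i ni)).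
have m0 : measurable ([set x | x 0 <> 0] : set Omega).
  rewrite (_ : [set x | _] = (fun x : Omega => x 0) @^-1` (~` [set 0]))//.
  apply: measurable_preimageT => //; last exact: measurableC.
  by apply: measurable_ev; rewrite lexx ler01.
have m1 : measurable ([set x | k + eta <= x 1] : set Omega).
  exact: (measurable_set_ge (k + eta) measurable_ev1).
have mJ := @measurable_jumps R n eta.
have H1 : pr mu [set x | k + eta <= x 1] <=
    pr mu (jumps n eta) + \sum_(i <- iota 0 n.+1) pr mu (F i).
  pose U := [set x | exists2 i, (i <= n)%N & F i x].
  have mU : measurable (U : set Omega) by exact: measurable_exists_and.
  apply: (@le_trans _ _ (pr mu (jumps n eta `|` ([set x | x 0 <> 0] `|` U)))); last first.
    rewrite (le_trans (pr_setU_le _ mJ (measurableU _ _ m0 mU)))// lerD2l.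
    rewrite (le_trans (pr_setU_le _ m0 mU))// mu0 add0r.
    apply: pr_le_cover => //.
      by move=> i; rewrite mem_iota/= add0n ltnS; exact: mF.
    by move=> x [i ni Fi]; exists i => //; rewrite mem_iota/= add0n ltnS.
  apply: le_pr => //.
    by apply: measurableU => //; exact: measurableU.
  move=> x /= kx; have [Jx|nJ] := pselect (jumps n eta x); first by left.
  have [x0|x0] := pselect (x 0 = 0); last by right; left.
  right; right.
  have kn : k <= x (n%:R / n%:R) by rewrite gridn; lra.
  have [j jn pj] := reaches_passage kn.
  exists j => //.
  split => //=; case: j jn pj => [|j] jn [kj hj].
    by move: kj; rewrite mul0r x0; lra.
  have := hj j (ltnSn j).
  have : x (j.+1%:R / n%:R) - x (j%:R / n%:R) <= eta.
    by rewrite leNgt; apply/negP => h; apply: nJ; exists j.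
  lra.
have H2 : 2 * (\sum_(i <- iota 0 n.+1) pr mu (F i)) <= pr mu (reaches n k).
  have e : \sum_(i <- iota 0 n.+1) pr mu (F i) = \sum_(i <- iota 0 n.+1) pr mu (F' i).
    apply: eq_big_seq => i; rewrite mem_iota/= add0n ltnS => ni.
    have /andP[g0 g1] := @grid_itv R _ _ ni.
    apply: (wiener_increment_sym hmu (A := [set u | 0 < u]) g0 g1).
      exact: measurable_passage.
    by rewrite (_ : [set u | _] = `]0, +oo[%classic)//; apply/seteqP; split => u /=; rewrite in_itv/= andbT.
  rewrite mulr_natl mulr2n [X in X + _ <= _]e -big_split/=.
  apply: (@le_trans _ _ (\sum_(i <- iota 0 n.+1) pr mu (passage n k i))).
    rewrite big_seq [leRHS]big_seq; apply: ler_sum => i.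
    rewrite -[0%N :: iota 1 n]/(iota 0 n.+1) mem_iota/= add0n ltnS => ni.
    have mp := measurable_passage1 k ni.
    rewrite (pr_setDI mu mp (mF i ni)) lerD//.
      apply: le_pr; [exact: mF'|apply: measurableD => //; exact: mF|].
      by move=> x [pi /= h]; split => //; move=> [_ /=]; lra.
    by apply: le_pr; [exact: mF|apply: measurableI => //; exact: mF|move=> x [pi h]; split].
  apply: sum_pr_le_disjoint.
  - exact: measurable_reaches.
  - exact: iota_uniq.
  - by move=> i; rewrite mem_iota/= add0n ltnS => ni; exact: measurable_passage1.
  - by move=> i; rewrite mem_iota/= add0n ltnS => ni x [ki _]; exists i.
  - by move=> i j x _ _; exact: passage_uniq.
move: H1 H2; lra.
Qed.

End reflection.

Section wiener_estimates.
Context {R : realType}.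
Notation Omega := (@paths R R `[0, 1]%classic).
Variables (mu : probability Omega R) (hmu : wiener mu).

Let nu : probability _ R := normal_prob (0 : R) 1.

(** Dyadic times make this an event of countably many coordinates; for a continuous path they bound
    the whole path. *)
Definition stays_below (k y : R) : set (R -> R) :=
  [set x | (forall n i, (i <= 2 ^ n)%N -> x (i%:R / (2 ^ n)%:R) < k) /\
           x 1 <= k - y].

Lemma measurable_stays_below k y : measurable (stays_below k y : set Omega).
Proof.
apply: measurableI; last exact: (measurable_set_le (k - y) (@measurable_ev1 R)).
have mF n : measurable ([set x : R -> R | forall i, (i <= 2 ^ n)%N ->
    x (i%:R / (2 ^ n)%:R) < k] : set Omega).
  apply: measurable_forall_imp => i ni.
  exact: (measurable_set_lt k (measurable_ev (grid_itv ni))).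
have := bigcapT_measurable mF; congr measurable.
by apply/seteqP; split => [x h n|x h n _]; [exact: h n I|exact: h].
Qed.

Lemma normal_tail_sym (a : R) :
  pr nu `]-oo, a]%classic = pr nu `[- a, +oo[%classic.
Proof.
rewrite /pr /= -normal_probN//; congr (fine (normal_prob _ _ _)).
by apply/seteqP; split => u /=; rewrite !in_itv/= andbT lerNl.
Qed.

Lemma normal_itv_tail (a b : R) : a <= b -> pr nu `[a, +oo[%classic =
  pr nu `[a, b[%classic + pr nu `[b, +oo[%classic.
Proof.
move=> ab; rewrite [LHS](@pr_setDI _ _ _ nu _ `[b, +oo[%classic)//.
congr (pr nu _ + pr nu _); apply/seteqP; split => u /=; rewrite !in_itv/= !andbT.
- by move=> [-> /negP]; rewrite -ltNge.
- by move=> /andP[-> ub]; split => //; apply/negP; rewrite -ltNge.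
- by case.
- by move=> bu; split => //; exact: le_trans bu.
Qed.

(** By symmetry the mass of [[y - k, y + k[] is the probability of ending at most at [k - y], minus
    that of ending at least at [k + y], which by reflection bounds the paths to be discarded. Dyadic
    grids are nested, so continuity from above gives the limit. *)
Lemma wiener_stays_below (k y : R) : 0 <= k -> 0 <= y ->
  pr nu `[y - k, y + k[%classic <= pr mu (stays_below k y).
Proof.
move=> k0 y0.
pose F n := [set x : R -> R | (forall i, (i <= 2 ^ n)%N ->
   x (i%:R / (2 ^ n)%:R) < k) /\ x 1 <= k - y].
have mF n : measurable (F n : set Omega).
  apply: measurableI; last exact: (measurable_set_le (k - y) (@measurable_ev1 R)).
  apply: measurable_forall_imp => i ni.
  exact: (measurable_set_lt k (measurable_ev (grid_itv ni))).
have -> : stays_below k y = \bigcap_n F n.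
  apply/seteqP; split => x.
    by move=> [h x1] n _; split => // i; exact: h.
  move=> h; split; first by move=> n i; have [+ _] := h n I; exact.
  by have [] := h 0%N I.
apply: pr_bigcap_ge => //.
  move=> n m nm x [h x1]; split => // i ni.
  have e : (2 ^ m = 2 ^ n * 2 ^ (m - n))%N by rewrite -expnD subnKC.
  have := h (i * 2 ^ (m - n))%N; rewrite e leq_mul2r ni orbT => /(_ isT).
  by rewrite !natrM invfM mulrACA divff ?mulr1// pnatr_eq0 expn_eq0.
move=> n; have n0 : (0 < 2 ^ n)%N by rewrite expn_gt0.
have m1 : measurable ([set x : R -> R | x 1 <= k - y] : set Omega).
  exact: (measurable_set_le (k - y) (@measurable_ev1 R)).
have mG := @measurable_reaches R (2 ^ n) k.
have e1 : pr mu [set x | x 1 <= k - y] = pr nu `[y - k, +oo[%classic.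
  by rewrite -[y - k]opprB -normal_tail_sym -(wiener_time1 hmu).
have e2 : pr mu [set x | k + y <= x 1] = pr nu `[y + k, +oo[%classic.
  rewrite [y + k]addrC -(wiener_time1 hmu)//.
  by congr (pr mu _); apply/seteqP; split => x /=; rewrite in_itv/= andbT.
have := reflection_le hmu k n0 y0; rewrite e2 setIC.
have := pr_setDI mu m1 mG; rewrite e1.
have := @normal_itv_tail (y - k) (y + k).
have -> : pr mu ([set x | x 1 <= k - y] `\` reaches (2 ^ n) k) = pr mu (F n).
  congr (pr mu _); apply/seteqP; split => x.
    move=> [x1 nr]; split => // i ni; rewrite ltNge; apply/negP => ki.
    by apply: nr; exists i.
  move=> [h x1]; split => // -[i ni]; rewrite leNgt h//.
have : y - k <= y + k by lra.
move=> + /[dup] => /[swap] _ h1 /(_ h1) ->; lra.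
Qed.

(** Up to jumps, reflection bounds the left side by the normal mass of an interval of length
    [2 * (k + eta)], and the density is at most 1. *)
Lemma wiener_not_reaches n (k eta : R) : (0 < n)%N -> 0 < k -> 0 < eta ->
  pr mu (~` reaches n k) <= 2 * (k + eta) + 2 * pr mu (jumps n eta).
Proof.
move=> n0 k0 eta0; have := reflection_ge hmu n0 k0 eta0.
have -> : pr mu [set x | k + eta <= x 1] = pr nu `[k + eta, +oo[%classic.
  rewrite -(wiener_time1 hmu)//.
  by congr (pr mu _); apply/seteqP; split => x /=; rewrite in_itv/= andbT.
rewrite (@pr_setC _ _ _ mu _ (@measurable_reaches R n k)).
have k1 : - (k + eta) <= k + eta by lra.
have := normal_itv_tail k1; rewrite -normal_tail_sym.
have : pr nu `[(- (k + eta)), (k + eta)[%classic <= 2 * (k + eta).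
  rewrite -lee_fin -prE//= (le_trans (normal_prob_le _))//.
  rewrite lebesgue_measure_itv/= lte_fin; case: ifPn => _; rewrite -?EFinB lee_fin; lra.
have : 1 = pr nu `]-oo, (k + eta)[%classic + pr nu `[k + eta, +oo[%classic.
  rewrite -(pr_setT nu) (@pr_setDI _ _ _ nu _ `[k + eta, +oo[%classic)//.
  rewrite setTI setTD; congr (pr nu _ + _); apply/seteqP; split => u /=; rewrite !in_itv/= andbT.
    by move/negP; rewrite -ltNge.
  by move=> ku; apply/negP; rewrite -ltNge.
have : pr nu `]-oo, (k + eta)[%classic <= pr nu `]-oo, (k + eta)]%classic.
  by apply: le_pr => // u /=; rewrite !in_itv/= => /ltW.
move: (pr nu `]-oo, (k + eta)[%classic) => p1.
move: (pr nu `]-oo, (k + eta)]%classic) => p2.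
move: (pr nu `[k + eta, +oo[%classic) => p3.
lra.
Qed.

(** The two times make two independent increments small, one below [b] and the other below [2 * b],
    each with probability of order [b]. This crude square is all that is asked of a path that fails
    to attain a height on both sides. *)
Lemma wiener_confined (b : R) : 0 <= b ->
  pr mu [set x | `|x (1 / 2)| < b /\ `|x 1| < b] <= 16 * b ^+ 2.
Proof.
have [mu0 mk _ _] := hmu; move=> b0.
pose h : R := 1 / 2.
pose c : R := Num.sqrt h.
have h0 : 0 < h by rewrite divr_gt0.
have c0 : 0 < c by rewrite sqrtr_gt0.
pose S r := [set x : R -> R | `|x 1| < r / c].
have mn1 : measurable_fun setT ((fun x => `|x 1|) : Omega -> R).
  exact: (measurableT_comp (@normr_measurable _ _) (@measurable_ev1 R)).
have mS r : measurable (S r : set Omega) by exact: (measurable_set_lt (r / c) mn1).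
have prS r : 0 <= r -> pr mu (S r) <= 2 * r / c.
  move=> r0.
  have -> : S r = [set x | `](- (r / c)), (r / c)[%classic (x 1)].
    by apply/seteqP; split => x; rewrite /S/= in_itv/= ltr_norml.
  rewrite (wiener_time1 hmu)// -lee_fin -prE//= (le_trans (normal_prob_le _))//.
  rewrite lebesgue_measure_itv/= lte_fin.
  have rc0 : 0 <= r / c by rewrite divr_ge0// ltW.
  by case: ifPn => _; rewrite -?EFinB lee_fin; lra.
have sh r : [set x : R -> R | `|x (h + h * 1) - x h| < r] = shift h h @^-1` S r.
  apply/seteqP; split => x; rewrite /S/shift/= -/c normrM normfV (ger0_norm (ltW c0));
  by rewrite ltr_pM2r// invr_gt0.
have sh0 r : [set x : R -> R | `|x h - x 0| < r] = shift 0 h @^-1` S r.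
  apply/seteqP; split => x; rewrite /S/shift/= -/c mulr1 add0r normrM normfV (ger0_norm (ltW c0));
  by rewrite ltr_pM2r// invr_gt0.
have mC : measurable ([set x : R -> R | `|x h - x 0| < b] :
    set (@paths R R `[0, h]%classic)).
  apply: (@measurable_set_lt _ _ _
    (fun x : @paths R R `[0, h]%classic => `|x h - x 0|)).
  apply: (measurableT_comp (@normr_measurable _ _)).
  by apply: measurable_funB; apply: measurable_eval; rewrite /= in_itv/= lexx ltW.
have m0 : measurable ([set x | x 0 <> 0] : set Omega).
  rewrite (_ : [set x | _] = (fun x : Omega => x 0) @^-1` (~` [set 0]))//.
  apply: measurable_preimageT => //; last exact: measurableC.
  by apply: measurable_ev; rewrite lexx ler01.
have hh : h + h <= 1 by rewrite /h; lra.
have m2 : measurable (shift h h @^-1` S (2 * b) : set Omega).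
  apply: measurable_shift (mS _).
    by rewrite /= in_itv/= (ltW h0)/= /h; lra.
  move=> s s0 s1; rewrite /= in_itv/=; apply/andP; split; rewrite /h; lra.
have mC1 : measurable ([set x : R -> R | `|x h - x 0| < b] : set Omega).
  apply: measurable_paths_sub mC => s /=; rewrite !in_itv/= => /andP[-> sh1]/=.
  by rewrite (le_trans sh1)// /h; lra.
have mA : measurable ([set x : R -> R | `|x h| < b /\ `|x 1| < b] : set Omega).
  apply: measurableI; last exact: (measurable_set_lt b mn1).
  apply: (@measurable_set_lt _ _ _ (fun x : Omega => `|x h|)).
  apply: (measurableT_comp (@normr_measurable _ _)).
  by apply: measurable_ev; rewrite (ltW h0)/= /h; lra.
apply: (@le_trans _ _ (pr mu ([set x | x 0 <> 0] `|`
    ([set x | `|x h - x 0| < b] `&` shift h h @^-1` S (2 * b))))).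
  apply: le_pr => //; first by apply: measurableU => //; exact: measurableI.
  move=> x [xh x1]; have [x0|x0] := pselect (x 0 = 0); last by left.
  right; split; first by rewrite /= x0 subr0.
  rewrite -sh /= mulr1 (_ : h + h = 1); last by rewrite /h; lra.
  rewrite (le_lt_trans (ler_normB _ _))//; move: xh x1; rewrite -/h; lra.
rewrite (le_trans (pr_setU_le _ m0 (measurableI _ _ mC1 m2)))// mu0 add0r.
have h0' := ltW h0; rewrite mk//.
have -> : pr mu [set x | `|x h - x 0| < b] = pr mu (S b).
  rewrite sh0 -[X in pr _ X]setTI mk//.
    by rewrite pr_setT mul1r.
  by rewrite add0r /h; lra.
have b20 : 0 <= 2 * b by rewrite mulr_ge0.
apply: (le_trans (ler_pM (pr_ge0 _ _) (pr_ge0 _ _) (prS b b0) (prS (2 * b) b20))).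
have c2 : c ^+ 2 = h by rewrite sqr_sqrtr// ltW.
have -> : 2 * b / c * (2 * (2 * b) / c) = 8 * b ^+ 2 / c ^+ 2.
  by field; rewrite gt_eqF.
by rewrite c2 /h le_eqVlt; apply/orP; left; apply/eqP; field.
Qed.

End wiener_estimates.

(** * Path continuity and the law of Brownian motion *)

Section path_continuity.
Context {R : realType}.

Lemma continuous_within_abs (f : R -> R) :
  {within `[0, +oo[%classic, continuous f} -> continuous (fun t : R => f `|t|).
Proof.
move=> /subspace_continuousP cf t.
have := cf `|t|; rewrite /= in_itv/= normr_ge0/= => /(_ isT).
apply: cvg_comp; move=> U; rewrite /within/= => -[e /= e0 he].
exists e => //= y ty; apply: he => /=.
  by rewrite (le_lt_trans (ler_dist_dist _ _)).
by rewrite in_itv/= normr_ge0.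
Qed.

Lemma continuous_dist (g : R -> R) (x e : R) : continuous g -> 0 < e ->
  exists2 r : R, 0 < r & forall y, `|x - y| < r -> `|g x - g y| < e.
Proof.
move=> cg e0; have /cvgrPdist_lt/(_ _ e0)[r /= r0 hr] := cg x.
by exists r => // y; exact: hr.
Qed.

Lemma uniformly_continuous_segment (g : R -> R) (a b eta : R) :
  continuous g -> 0 < eta -> exists2 delta : R, 0 < delta &
    forall x y, a <= x <= b -> `|x - y| < delta -> `|g x - g y| < eta.
Proof.
move=> cg eta0.
have := @segment_compact R a b; move=> /compact_near_coveringP.
move=> /(_ R 0^'+ (fun e x => forall y, `|x - y| < e -> `|g x - g y| < eta)).
case.
  move=> x _; have eta20 : 0 < eta / 2 by rewrite divr_gt0.
  have [r r0 hr] := continuous_dist x cg eta20.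
  exists (ball x (r / 2), [set e | e < r / 2]).
    split; first by apply: nbhsx_ballx; rewrite divr_gt0.
    by apply: nbhs_right_lt; rewrite divr_gt0.
  move=> [x' e] [/= xx' er] y x'y.
  have h1 : `|g x - g x'| < eta / 2.
    by apply: hr => /=; move: xx'; rewrite /ball/=; move: r0; lra.
  have h2 : `|g x - g y| < eta / 2.
    apply: hr => /=; rewrite -(subrKA x') (le_lt_trans (ler_normD _ _))//.
    move: xx'; rewrite /ball/=; lra.
  rewrite -(subrKA (g x)) (le_lt_trans (ler_normD _ _))//.
  rewrite distrC; lra.
move=> r /= r0 hr; exists (r / 2); first by rewrite divr_gt0.
move=> x y xab xy; apply: (hr (r / 2)) => //=.
- by rewrite sub0r normrN gtr0_norm ?divr_gt0//; lra.
- by rewrite divr_gt0.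
Qed.

Lemma eventually_no_jumps (x : R -> R) (eta : R) : continuous x -> 0 < eta ->
  exists N, forall n, (N <= n)%N -> ~ jumps n eta x.
Proof.
move=> cx eta0.
have [delta d0 h] := @uniformly_continuous_segment x 0 1 eta cx eta0.
exists (Num.truncn delta^-1).+1 => n Nn [i ni].
have n0 : (0 < n)%N by exact: leq_trans Nn.
apply/negP; rewrite -leNgt ltW// (le_lt_trans (ler_norm _))// distrC.
apply: h; first by apply: grid_itv; exact: ltnW.
rewrite distrC -mulrBl -natr1 [_ + 1]addrC addrK mul1r gtr0_norm ?invr_gt0 ?ltr0n//.
rewrite invf_plt ?posrE ?ltr0n//.
by rewrite (lt_le_trans (truncnS_gt _))// ler_nat.
Qed.

End path_continuity.

Section wiener_law.
Context d (T : measurableType d) (R : realType) (P : probability T R).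
Notation Omega := (@paths R R `[0, 1]%classic).

(* [`|t|] makes the paths continuous on the whole line; [B 0] is subtracted because
   it vanishes only almost surely. *)
Definition centered (B : R -> {RV P >-> R}) : R -> T -> R :=
  fun t w => B `|t| w - B 0 w.

Lemma brownian_centered (B : R -> {RV P >-> R}) :
  standard_brownian_motion B -> brownian P (centered B).
Proof.
move=> [_ iB gB _]; split.
- by move=> t; exact: measurable_funB.
- by move=> w; rewrite /centered normr0 subrr.
- move=> n t t0 tS.
  have t_ge0 i : 0 <= t i by elim: i => // i IH; exact: le_trans (tS i).
  rewrite (_ : (fun i => _) = (fun i => B (t i.+1) \- B (t i))); first exact: iB.
  apply/funext => i; apply/funext => w; rewrite /centered/= !ger0_norm//; ring.
- move=> s t s0 st A mA; rewrite -gB//; congr (P _).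
  apply/seteqP; split => w /=; rewrite /centered !ger0_norm// ?(le_trans s0) ?(ltW st)//;
  by rewrite opprB addrA subrK.
Qed.

Lemma continuous_centered (B : R -> {RV P >-> R}) :
  standard_brownian_motion B ->
  {ae P, forall w, continuous (fun t => centered B t w)}.
Proof.
move=> [_ _ _]; apply: filterS => w cB.
by move=> t; apply: cvgB; [exact: continuous_within_abs cB t|exact: cvg_cst].
Qed.

Lemma brownianN W : brownian P W -> brownian P (fun t w => - W t w).
Proof.
move=> [mW W0 iW gW]; split.
- by move=> t; exact: measurable_funN.
- by move=> w; rewrite W0 oppr0.
- move=> n t t0 tS A mA.
  have e i : ((fun w => - W (t i.+1) w) \- (fun w => - W (t i) w)) @^-1` A i =
      (W (t i.+1) \- W (t i)) @^-1` (-%R @^-1` A i).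
    by apply/seteqP; split => w /=; rewrite opprB opprK addrC.
  have mNA i : measurable (-%R @^-1` A i).
    by apply: measurable_preimageT => //; exact: oppr_measurable.
  apply: etrans (etrans (iW n t t0 tS _ mNA) _).
    by congr (P _); apply: eq_bigcapr => i _; exact: e.
  by apply: eq_bigr => i _; congr (P _); exact/esym/e.
- move=> s t s0 st A mA.
  rewrite -normal_probN ?sqrtr_gt0 ?subr_gt0// -gW//; last first.
    by apply: measurable_preimageT => //; exact: oppr_measurable.
  by congr (P _); apply/seteqP; split => w /=; rewrite opprB opprK addrC.
Qed.

Lemma pr_negligible (A : set T) : measurable A -> P.-negligible A -> pr P A = 0.
Proof. by move=> mA /(negligibleP _ mA); rewrite /pr => ->. Qed.

Lemma measurable_pathT (D : set R) W : (forall t, measurable_fun setT (W t)) ->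
  measurable_fun setT (path W : T -> @paths R R D).
Proof. by move=> mW; exact: (@measurable_path R R _ T D W). Qed.

(** [mu] is the image of [P] under [W], and [brownian_markov] at [t = 0] and [h = 1] identifies it
    with the law of any other Brownian motion. *)
Lemma wiener_law W : brownian P W ->
  {ae P, forall w, continuous (fun t => W t w)} ->
  exists mu : probability Omega R, wiener mu /\
    forall W', brownian P W' -> forall C : set (R -> R),
      measurable (C : set Omega) -> pr P (path W' @^-1` C) = pr mu C.
Proof.
move=> bW cW; have [mW W0 _ gW] := bW.
have mp V : brownian P V -> measurable_fun setT (path V : T -> Omega).
  by move=> [mV _ _ _]; exact: measurable_pathT.
pose X : {mfun T >-> Omega} := mfun_Sub (mem_set (mp _ bW)).
have XE : (X : T -> Omega) = path W by exact: mfun_valP.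
pose mu : probability Omega R := distribution P X.
have muE C : pr mu C = pr P (path W @^-1` C).
  by rewrite /pr /mu /= /distribution /pushforward XE.
have law V : brownian P V -> forall C : set (R -> R),
    measurable (C : set Omega) -> pr P (path V @^-1` C) = pr mu C.
  move=> bV C mC; rewrite muE.
  have := @brownian_markov _ _ _ P V W 0 1 setT C bV bW (lexx 0) ltr01 measurableT mC.
  rewrite setTI preimage_setT probability_setT mul1e /pr => <-; congr (fine (P _)).
  have [_ V0 _ _] := bV.
  apply/seteqP; split => w /=; congr C; apply/funext => s;
  by rewrite /shift/path V0 sqrtr1 divr1 subr0 add0r mul1r.
exists mu; split => //; split.
- rewrite muE (_ : _ @^-1` _ = set0) ?pr_set0//.
  by apply/seteqP; split => // w /=; rewrite /path W0.
- move=> t h C1 C2 t0 h0 th mC1 mC2; rewrite !muE.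
  have := @brownian_markov _ _ _ P W W t h C1 C2 bW bW t0 h0 mC1 mC2.
  rewrite /pr => ->; rewrite fineM// fin_num_measure//.
    exact: (measurable_preimageT (measurable_pathT mW) mC1).
  exact: (measurable_preimageT (mp _ bW) mC2).
- move=> A mA; rewrite /mu /= /distribution /pushforward XE.
  rewrite -[in RHS]sqrtr1 -[in RHS](subr0 1) -gW//.
  by congr (P _); apply/seteqP; split => w /=; rewrite /path W0 subr0.
(* The events that some grid with at least [N] steps shows a jump decrease to a null set, because
   almost every path is uniformly continuous on [[0, 1]]. *)
- move=> eta e eta0 e0.
  pose F N := path W @^-1` [set x | exists2 n, (N <= n)%N & jumps n eta x].
  have mF N : measurable (F N).
    apply: (measurable_preimageT (mp _ bW)).
    by apply: measurable_exists_and => n _; exact: measurable_jumps.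
  have [|//|N FN] := pr_nonincreasing_small (P := P) mF _ _ e0.
  + by move=> n m nm w [k mk hk]; exists k => //; exact: leq_trans mk.
  + apply: pr_negligible; first exact: bigcapT_measurable.
    apply: negligibleS cW => w hw /= cw.
    have [N hN] := eventually_no_jumps cw eta0.
    by have [n Nn] := hw N I; exact: hN.
  + exists N => n Nn; rewrite muE; apply: le_lt_trans FN.
    apply: le_pr => //.
      exact: (measurable_preimageT (mp _ bW) (@measurable_jumps R n eta)).
    by move=> w hw; exists n.
Qed.

End wiener_law.

(** * Passage levels and lucky blocks *)

Section blocks.
Context {R : realType}.
Notation Omega := (@paths R R `[0, 1]%classic).
Variables (mu : probability Omega R) (hmu : wiener mu).
Variables (r q m : nat) (r0 : (0 < r)%N) (q0 : (0 < q)%N) (mrq : (m + r <= r * q)%N).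
Variables (D : set (R -> R)) (mD : measurable (D : set Omega)).
Variables (lam eta Lam : R) (Lam0 : 0 < Lam).
Hypothesis D_lam : forall x, D x -> forall j, (j <= r)%N -> x (j%:R / r%:R) < lam.
Let h : R := q%:R^-1.
Hypothesis Lam_ge : lam * Num.sqrt h + eta <= Lam.
Let n := (r * q)%N.
Let tm (i : nat) : R := i%:R / n%:R.
Let lev (k : nat) : R := k.+1%:R * Lam.

(** Unit time consists of [q] blocks of [r] grid steps, each of duration [h]. Passages after step
    [m] are discarded, since [m + r <= r * q] then leaves room for a whole block. *)
Definition lucky (k : nat) : set (R -> R) :=
  [set x | exists2 i, (i <= m)%N & passage n (lev k) i x /\ D (shift (tm i) h x)].

Let h0 : 0 < h. Proof. by rewrite invr_gt0 ltr0n. Qed.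
Let n0 : (0 < n)%N. Proof. by rewrite muln_gt0 r0. Qed.
Let tmS j : tm j + h = tm (j + r).
Proof.
rewrite /tm /h /n natrM natrD; field.
by rewrite !pnatr_eq0 -!lt0n r0 q0.
Qed.

Let measurable_shiftD (j : nat) (t : R) : tm j + h <= t ->
  measurable (shift (tm j) h @^-1` D : set (@paths R R `[0, t]%classic)).
Proof.
have j0 : 0 <= tm j by rewrite /tm divr_ge0.
move=> jt; apply: measurable_shift mD => [|s s0 s1]; rewrite /= in_itv/=.
  by rewrite j0 (le_trans _ jt)// lerDl ltW.
rewrite addr_ge0 ?mulr_ge0 ?(ltW h0)//= (le_trans _ jt)// lerD2l.
by rewrite ler_piMr// ltW.
Qed.

Lemma measurable_lucky k : measurable (lucky k : set Omega).
Proof.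
apply: measurable_exists_and => i im; apply: measurableI.
  by apply: measurable_passage1; rewrite (leq_trans im)// (leq_trans _ mrq)// leq_addr.
apply: measurable_shiftD; rewrite tmS.
by have /andP[] := @grid_itv R n (i + r) (leq_trans (leq_add im (leqnn r)) mrq).
Qed.

(** Only blocks completed by step [i] are inspected. This keeps the event in the past of [tm i], so
    that the Markov property applies to the block that starts there. *)
Let failed (S : pred nat) (k i : nat) : set (R -> R) :=
  passage n (lev k) i `&`
  [set x | forall l, (l < k)%N /\ S l -> forall j, (j + r <= i)%N ->
     (~` (passage n (lev l) j `&` shift (tm j) h @^-1` D)) x].

Let measurable_failed S k i :
  measurable (failed S k i : set (@paths R R `[0, tm i]%classic)).
Proof.
apply: measurableI; first exact: measurable_passage.
apply: (@measurable_forall_imp _ (@paths R R `[0, tm i]%classic) (fun l => (l < k)%N /\ S l)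
  (fun l => [set x | forall j, (j + r <= i)%N ->
     (~` (passage n (lev l) j `&` shift (tm j) h @^-1` D)) x])) => l _.
apply: measurable_forall_imp => j ji; apply: measurableC; apply: measurableI.
  apply: measurable_passage; apply: le_grid; exact: leq_trans (leq_addr _ _) ji.
by apply: measurable_shiftD; rewrite tmS; exact: le_grid.
Qed.

Let measurable_failed1 S k i : (i <= m)%N ->
  measurable (failed S k i : set Omega).
Proof.
move=> im; apply: measurable_paths_sub (@measurable_failed S k i).
move=> s /=; rewrite !in_itv/= => /andP[-> /le_trans]; apply.
have im' : (i <= n)%N by rewrite (leq_trans im)// (leq_trans _ mrq)// leq_addr.
by have /andP[] := @grid_itv R n i im'.
Qed.

Let failed_any S k : set (R -> R) := [set x | exists2 i, (i <= m)%N & failed S k i x].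

Let measurable_failed_any S k : measurable (failed_any S k : set Omega).
Proof. by apply: measurable_exists_and => i; exact: measurable_failed1. Qed.

Let lev_lt k l : (k <= l)%N -> lev k <= lev l.
Proof. by move=> kl; rewrite /lev ler_pM2r// ler_nat ltnS. Qed.

Let failed_pred S k i x : failed S k.+1 i x ->
  exists2 i', (i' <= i)%N & failed S k i' x.
Proof.
move=> [[ki _] hf].
have ki' : lev k <= x (i%:R / n%:R) by exact: le_trans (lev_lt (leqnSn k)) ki.
have [i' i'i pi'] := reaches_passage ki'.
exists i' => //; split => // l [lk Sl] j ji.
by apply: hf; [split => //; exact: ltnW|exact: leq_trans i'i].
Qed.

(* A block that meets D stays below [lam] after rescaling, so the next level is
   first passed only after the block, unless a single grid step exceeds [eta];
   hence the outcome of a block is known when the next level is passed. *)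
Let failed_step (S : pred nat) k : S k ->
  pr mu (failed_any S k.+1) <=
  (1 - pr mu D) * pr mu (failed_any S k) + pr mu (jumps n eta).
Proof.
move=> Sk; have [mu0 mk _ _] := hmu.
pose F i := failed S k i `&` shift (tm i) h @^-1` (~` D).
have mF i : (i <= m)%N -> measurable (F i : set Omega).
  move=> im; apply: measurableI; first exact: measurable_failed1.
  rewrite preimage_setC; apply: measurableC; apply: measurable_shiftD.
  rewrite tmS.
  by have /andP[] := @grid_itv R n (i + r) (leq_trans (leq_add im (leqnn r)) mrq).
have m0 : measurable ([set x | x 0 <> 0] : set Omega).
  rewrite (_ : [set x | _] = (fun x : Omega => x 0) @^-1` (~` [set 0]))//.
  apply: measurable_preimageT => //; last exact: measurableC.
  by apply: measurable_ev; rewrite lexx ler01.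
pose U := [set x | exists2 i, (i <= m)%N & F i x].
have mU : measurable (U : set Omega) by exact: measurable_exists_and.
have mJ := @measurable_jumps R n eta.
have sub : failed_any S k.+1 `<=` [set x | x 0 <> 0] `|` (jumps n eta `|` U).
  move=> x [i' i'm fi'].
  have [x0|x0] := pselect (x 0 = 0); last by left.
  have [Jx|nJ] := pselect (jumps n eta x); first by right; left.
  right; right; have [i ii' fi] := failed_pred fi'.
  exists i; first exact: leq_trans i'm.
  split => //= Dx; have [[ki hi] _] := fi.
  have [ri|ri] := leqP (i + r) i'.
    by have [_ /(_ k (conj (ltnSn k) Sk) i ri)] := fi'; apply; split => //; case: fi.
  have : x (i%:R / n%:R) <= lev k + eta.
    case: i {fi Dx ri} ii' ki hi => [|i] ii' ki hi.
      by move: ki; rewrite mul0r x0 /lev leNgt mulr_gt0 ?ltr0n.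
    have := hi i (ltnSn i).
    have ni : (i < n)%N.
      by rewrite (leq_trans ii')// (leq_trans i'm)// (leq_trans _ mrq)// leq_addr.
    have : x (i.+1%:R / n%:R) - x (i%:R / n%:R) <= eta.
      by rewrite leNgt; apply/negP => hh; apply: nJ; exists i.
    lra.
  have [[ki' _] _] := fi'.
  have jr : (i' - i <= r)%N by rewrite leq_subLR ltnW.
  have := D_lam Dx jr; rewrite /shift.
  have -> : tm i + h * ((i' - i)%:R / r%:R) = i'%:R / n%:R.
    rewrite natrB// /tm /h /n natrM; field.
    by rewrite !pnatr_eq0 -!lt0n r0 q0.
  rewrite ltr_pdivrMr ?sqrtr_gt0//; move: ki'; rewrite /lev -/(tm i).
  rewrite -natr1 mulrDl mul1r; move: Lam_ge; lra.
have e i : (i <= m)%N -> pr mu (F i) = (1 - pr mu D) * pr mu (failed S k i).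
  move=> im; rewrite /F mk//.
  - by rewrite mulrC pr_setC.
  - by rewrite /tm divr_ge0.
  - rewrite tmS.
    by have /andP[] := @grid_itv R n (i + r) (leq_trans (leq_add im (leqnn r)) mrq).
  - exact: measurableC.
have mUU := measurableU _ _ m0 (measurableU _ _ mJ mU).
apply: (le_trans (@le_pr _ _ _ mu _ _ (@measurable_failed_any S k.+1) mUU sub)).
rewrite (le_trans (pr_setU_le _ m0 (measurableU _ _ mJ mU)))// mu0 add0r.
rewrite (le_trans (pr_setU_le _ mJ mU))// addrC lerD2r.
apply: (@le_trans _ _ (\sum_(i <- iota 0 m.+1) pr mu (F i))).
  apply: pr_le_cover => //.
    by move=> i; rewrite mem_iota/= add0n ltnS; exact: mF.
  by move=> x [i im Fi]; exists i => //; rewrite mem_iota/= add0n ltnS.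
rewrite (eq_big_seq (fun i => (1 - pr mu D) * pr mu (failed S k i))); last first.
  by move=> i; rewrite mem_iota/= add0n ltnS; exact: e.
rewrite -mulr_sumr ler_wpM2l ?subr_ge0 ?pr_le1//.
apply: sum_pr_le_disjoint.
- exact: measurable_failed_any.
- exact: iota_uniq.
- by move=> i; rewrite mem_iota/= add0n ltnS; exact: measurable_failed1.
- by move=> i; rewrite mem_iota/= add0n ltnS => im x fx; exists i.
- by move=> i j x _ _ [pi _] [pj _]; exact: passage_uniq pi pj.
Qed.

(** Induction on the levels: a level of [S] costs a factor [1 - pr mu D] and one jump term, another
    level costs nothing. General [S] are needed because the levels to be tested will be those
    charged by the other path. *)
Lemma pr_no_lucky (S : pred nat) (N : nat) :
  pr mu ([set x | exists2 i, (i <= m)%N & lev N <= x (tm i)] `&`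
         [set x | forall k, (k < N)%N /\ S k -> (~` lucky k) x]) <=
  (1 - pr mu D) ^+ (count S (iota 0 N)) + N%:R * pr mu (jumps n eta).
Proof.
have mA : measurable ([set x | exists2 i, (i <= m)%N & lev N <= x (tm i)] : set Omega).
  apply: measurable_exists_and => j jm.
  have jn : (j <= n)%N by rewrite (leq_trans jm)// (leq_trans _ mrq)// leq_addr.
  exact: (measurable_set_ge (lev N) (measurable_ev (grid_itv jn))).
have mB : measurable ([set x | forall k, (k < N)%N /\ S k -> (~` lucky k) x] : set Omega).
  by apply: measurable_forall_imp => k _; apply: measurableC; exact: measurable_lucky.
have rho0 : 0 <= 1 - pr mu D by rewrite subr_ge0 pr_le1.
have rho1 : 1 - pr mu D <= 1 by rewrite gerBl pr_ge0.
apply: (@le_trans _ _ (pr mu (failed_any S N))).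
  apply: le_pr => //; first exact: measurableI.
  move=> x [[i im ki] nl]; have [j ji pj] := reaches_passage ki.
  exists j; first exact: leq_trans im.
  split => // l lS j' j'j [pl Dl]; apply: (nl l lS); exists j' => //.
  by rewrite (leq_trans (leq_addr r j'))// (leq_trans j'j)// (leq_trans ji).
elim: N {mA mB} => [|k IH].
  by rewrite mul0r addr0 expr0 pr_le1.
rewrite -addn1 iotaD count_cat /= add0n addn0 natrD mulrDl mul1r addn1.
case: (boolP (S k)) => /= Sk.
  rewrite addn1 exprS (le_trans (failed_step Sk))// addrA lerD2r.
  apply: (le_trans (ler_wpM2l rho0 IH)); rewrite mulrDr lerD2l.
  by rewrite ler_piMl// mulr_ge0// pr_ge0.
rewrite addn0; apply: (@le_trans _ _ (pr mu (failed_any S k))).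
  apply: le_pr => // x [i im fi]; have [i' i'i fi'] := failed_pred fi.
  by exists i' => //; exact: leq_trans im.
by rewrite (le_trans IH)// lerD2l lerDl pr_ge0.
Qed.

End blocks.

(** * Occupation densities on dyadic grids *)

Section riemann.
Context {R : realType}.
Notation mu := (@lebesgue_measure R).
Variables (g : R -> R) (mg : measurable_fun setT g) (g0 : forall x, 0 <= g x).

Let mEg (D : set R) : measurable_fun D (fun x => (g x)%:E).
Proof. by apply/measurable_EFinP; exact: measurable_funTS. Qed.

Lemma ge0_integral_chasles (u v w : R) : u <= v -> v <= w ->
  (\int[mu]_(x in `]u, w]) (g x)%:E =
   \int[mu]_(x in `]u, v]) (g x)%:E + \int[mu]_(x in `]v, w]) (g x)%:E)%E.
Proof.
move=> uv vw.
rewrite (@itv_bndbnd_setU _ _ (BRight u) (BRight v) (BRight w)) ?bnd_simp//.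
apply: ge0_integral_setU => //.
- exact: mEg.
- by move=> x _; rewrite lee_fin.
- apply/disj_setPS => x []/=; rewrite !in_itv/= => /andP[_ xv] /andP[vx _].
  by move: vx; rewrite ltNge xv.
Qed.

Lemma le_integral_itv (u v M : R) : u <= v ->
  (forall x, u < x -> x <= v -> g x <= M) ->
  (\int[mu]_(x in `]u, v]) (g x)%:E <= (M * (v - u))%:E)%E.
Proof.
move=> uv gM; apply: (@le_trans _ _ (\int[mu]_(x in `]u, v]) M%:E)%E).
  apply: ge0_le_integral => //.
  - by move=> x _; rewrite lee_fin.
  - exact: mEg.
  - by move=> x /=; rewrite in_itv/= => /andP[ux xv]; rewrite lee_fin gM.
rewrite integral_cst//= lebesgue_measure_itv/= lte_fin.
case: ifPn => [_|]; first by rewrite -EFinB -EFinM.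
rewrite -leNgt => vu; have -> : v = u by apply/le_anti; rewrite uv vu.
by rewrite subrr mulr0 mule0.
Qed.

Lemma ge_integral_itv (u v M : R) : u <= v ->
  (forall x, u < x -> x <= v -> M <= g x) ->
  ((M * (v - u))%:E <= \int[mu]_(x in `]u, v]) (g x)%:E)%E.
Proof.
move=> uv gM; have [M0|M0] := leP 0 M; last first.
  apply: (@le_trans _ _ 0%E); first by rewrite lee_fin mulr_le0_ge0 ?(ltW M0)// subr_ge0.
  by apply: integral_ge0 => x _; rewrite lee_fin.
apply: (@le_trans _ _ (\int[mu]_(x in `]u, v]) M%:E)%E); last first.
  apply: ge0_le_integral => //.
  - exact: mEg.
  - by move=> x /=; rewrite in_itv/= => /andP[ux xv]; rewrite lee_fin gM.
rewrite integral_cst//= lebesgue_measure_itv/= lte_fin.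
case: ifPn => [_|]; first by rewrite -EFinB -EFinM.
rewrite -leNgt => vu; have -> : v = u by apply/le_anti; rewrite uv vu.
by rewrite subrr mulr0 mule0.
Qed.

Definition riemann (s h : R) (n : nat) : R :=
  h / (2 ^ n)%:R * \sum_(i < 2 ^ n) g (s + h * (i%:R / (2 ^ n)%:R)).

Lemma riemann_cvg (s h e : R) : continuous g -> 0 < h -> 0 < e ->
  exists n0, forall n, (n0 <= n)%N ->
    (\int[mu]_(x in `]s, (s + h)%R]) (g x)%:E <= (riemann s h n + e)%:E)%E /\
    ((riemann s h n - e)%:E <= \int[mu]_(x in `]s, (s + h)%R]) (g x)%:E)%E.
Proof.
move=> cg h0 e0; have e'0 : 0 < e / h by rewrite divr_gt0.
have [delta d0 hd] := @uniformly_continuous_segment R g s (s + h) _ cg e'0.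
exists (Num.truncn (h / delta)).+1 => n n0n.
have N0 : (0 < 2 ^ n)%N by rewrite expn_gt0.
pose N := (2 ^ n)%N; pose c (k : nat) : R := s + h * (k%:R / N%:R).
have N0' : 0 < N%:R :> R by rewrite ltr0n.
have cS k : c k.+1 = c k + h / N%:R by rewrite /c -natr1; field; rewrite gt_eqF.
have hN0 : 0 < h / N%:R by rewrite divr_gt0.
have hNd : h / N%:R < delta.
  rewrite ltr_pdivrMr// mulrC -ltr_pdivrMr//.
  rewrite (lt_le_trans (truncnS_gt _))// ler_nat (leq_trans n0n)//.
  exact/ltnW/ltn_expl.
have c_s k : (k <= N)%N -> s <= c k <= s + h.
  move=> kN; rewrite lerDl mulr_ge0 ?divr_ge0 ?(ltW h0)//=.
  by rewrite lerD2l ler_piMr ?(ltW h0)// ler_pdivrMr// mul1r ler_nat.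
have near k x : (k < N)%N -> c k < x -> x <= c k.+1 -> `|g (c k) - g x| < e / h.
  move=> kN cx xc; apply: hd; first exact/c_s/ltnW.
  rewrite distrC gtr0_norm ?subr_gt0// (le_lt_trans _ hNd)//.
  by rewrite lerBlDl -cS.
have up k : (k <= N)%N -> (\int[mu]_(x in `]s, (c k)]) (g x)%:E <=
    (h / N%:R * \sum_(i < k) (g (c i) + e / h))%:E)%E.
  elim: k => [|k IH] kN.
    rewrite big_ord0 mulr0 /c mul0r mulr0 addr0.
    by rewrite set_itvoc0 integral_set0.
  have /andP[sc _] := c_s k (ltnW kN).
  have cc : c k <= c k.+1 by rewrite cS lerDl ltW.
  rewrite (ge0_integral_chasles sc cc) big_ord_recr/= mulrDr EFinD.
  apply: leeD; first exact/IH/ltnW.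
  rewrite [X in (_ <= X%:E)%E](_ : _ = (g (c k) + e / h) * (c k.+1 - c k)).
    apply: le_integral_itv => // x cx xc.
    by have := near _ _ kN cx xc; rewrite ltr_norml; lra.
  by rewrite cS; ring.
have dn k : (k <= N)%N -> ((h / N%:R * \sum_(i < k) (g (c i) - e / h))%:E <=
    \int[mu]_(x in `]s, (c k)]) (g x)%:E)%E.
  elim: k => [|k IH] kN.
    by rewrite big_ord0 mulr0; apply: integral_ge0 => x _; rewrite lee_fin.
  have /andP[sc _] := c_s k (ltnW kN).
  have cc : c k <= c k.+1 by rewrite cS lerDl ltW.
  rewrite (ge0_integral_chasles sc cc) big_ord_recr/= mulrDr EFinD.
  apply: leeD; first exact/IH/ltnW.
  rewrite [X in (X%:E <= _)%E](_ : _ = (g (c k) - e / h) * (c k.+1 - c k)).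
    apply: ge_integral_itv => // x cx xc.
    by have := near _ _ kN cx xc; rewrite ltr_norml; lra.
  by rewrite cS; ring.
have cN : c N = s + h by rewrite /c divff ?mulr1// gt_eqF.
have eN : h / N%:R * (e / h * N%:R) = e by field; rewrite !gt_eqF.
have sU : h / N%:R * \sum_(i < N) (g (c i) + e / h) = riemann s h n + e.
  by rewrite big_split/= mulrDr sumr_const card_ord -(mulr_natr (e / h)) eN.
have sD : h / N%:R * \sum_(i < N) (g (c i) - e / h) = riemann s h n - e.
  by rewrite sumrB mulrBr sumr_const card_ord -(mulr_natr (e / h)) eN.
have := up N (leqnn N); have := dn N (leqnn N).
by rewrite cN sU sD.
Qed.

End riemann.

Section occupation.
Context {R : realType}.
Notation Omega := (@paths R R `[0, 1]%classic).
Notation mu := (@lebesgue_measure R).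

(* The bump of height 1 and half-width 1/m centered at (j1 - j2)/m. *)
Definition bump (m j1 j2 : nat) (u : R) : R :=
  Num.max 0 (1 - `|m%:R * u - (j1%:R - j2%:R)|).

Definition occ (n : nat) (f x : R -> R) : R :=
  (2 ^ n)%:R^-1 * \sum_(i < 2 ^ n) f (x (i%:R / (2 ^ n)%:R)).

(** The upper limit of [occ n f x] is at most [c], spelled with countable quantifiers to be an event
    of paths. [occ_ge] does the same for the lower limit. *)
Definition occ_le (f : R -> R) (c : R) : set (R -> R) :=
  [set x | forall l : nat, exists n0, forall n, (n0 <= n)%N ->
     occ n f x <= c + l.+1%:R^-1].

Definition occ_ge (f : R -> R) (c : R) : set (R -> R) :=
  [set x | forall l : nat, exists n0, forall n, (n0 <= n)%N ->
     c <= occ n f x + l.+1%:R^-1].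

(** A bump has integral [1 / m] and the centres range over [[-2, 2]]: this is the averaged form of
    an occupation density at most [K] there. *)
Definition occ_bounded (K : R) : set (R -> R) :=
  [set x | forall m j1 j2 : nat, (0 < m)%N -> (j1 <= 2 * m)%N ->
     (j2 <= 2 * m)%N -> occ_le (bump m j1 j2) (K / m%:R) x].

(** Averaged form of an occupation density at least [delta] around [y], tested by bumps of
    half-width at most [delta]. *)
Definition occ_charged (y delta : R) : set (R -> R) :=
  [set x | forall m j1 j2 : nat, delta^-1 <= m%:R ->
     `|(j1%:R - j2%:R) / m%:R - y| <= delta ->
     occ_ge (bump m j1 j2) (delta / m%:R) x].

Lemma bump_ge0 m j1 j2 u : 0 <= bump m j1 j2 u.
Proof. by rewrite /bump le_max lexx. Qed.

Lemma bump_le1 m j1 j2 u : bump m j1 j2 u <= 1.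
Proof. by rewrite /bump ge_max ler01 gerBl normr_ge0. Qed.

Lemma continuous_bump m j1 j2 : continuous (bump m j1 j2).
Proof.
move=> u; have c1 : {for u, continuous (fun=> 0 : R^o)} by exact: cvg_cst.
have c2 : {for u, continuous (fun u : R => 1 - `|m%:R * u - (j1%:R - j2%:R)| : R^o)}.
  apply: cvgB; first exact: cvg_cst.
  apply: cvg_norm; apply: cvgB; last exact: cvg_cst.
  by apply: cvgM; [exact: cvg_cst|exact: cvg_id].
exact: (continuous_max c1 c2).
Qed.

Lemma measurable_occ n f : continuous f ->
  measurable_fun setT (occ n f : Omega -> R).
Proof.
move=> cf; apply: measurable_funM; first exact: measurable_cst.
apply: measurable_sum => i; apply: (measurableT_comp (continuous_measurable_fun cf)).
by apply: measurable_ev; apply: grid_itv; exact/ltnW.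
Qed.

Lemma measurable_occ_le f c : continuous f -> measurable (occ_le f c : set Omega).
Proof.
move=> cf.
have m1 l n0 n : measurable ([set x | occ n f x <= c + l.+1%:R^-1] : set Omega).
  exact: (measurable_set_le _ (measurable_occ n cf)).
have m2 l n0 : measurable ([set x | forall n, (n0 <= n)%N ->
    occ n f x <= c + l.+1%:R^-1] : set Omega).
  by apply: measurable_forall_imp => n _; exact: m1.
have := bigcapT_measurable (fun l => bigcupT_measurable _ (m2 l)).
congr measurable; apply/seteqP; split => x /= h l.
  by have [n0 _ hn0] := h l I; exists n0.
by move=> _; have [n0 hn0] := h l; exists n0.
Qed.

Lemma measurable_occ_ge f c : continuous f -> measurable (occ_ge f c : set Omega).
Proof.
move=> cf.
have m1 l n0 n : measurable ([set x | c <= occ n f x + l.+1%:R^-1] : set Omega).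
  apply: (@measurable_set_ge _ _ _ (fun x : Omega => occ n f x + l.+1%:R^-1)).
  by apply: measurable_funD; [exact: measurable_occ|exact: measurable_cst].
have m2 l n0 : measurable ([set x | forall n, (n0 <= n)%N ->
    c <= occ n f x + l.+1%:R^-1] : set Omega).
  by apply: measurable_forall_imp => n _; exact: m1.
have := bigcapT_measurable (fun l => bigcupT_measurable _ (m2 l)).
congr measurable; apply/seteqP; split => x /= h l.
  by have [n0 _ hn0] := h l I; exists n0.
by move=> _; have [n0 hn0] := h l; exists n0.
Qed.

Lemma measurable_occ_bounded K : measurable (occ_bounded K : set Omega).
Proof.
pose F m j1 j2 := [set x : R -> R | (0 < m)%N /\ (j1 <= 2 * m)%N /\
  (j2 <= 2 * m)%N -> occ_le (bump m j1 j2) (K / m%:R) x].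
have mF m j1 j2 : measurable (F m j1 j2 : set Omega).
  have [h|h] := pselect ((0 < m)%N /\ (j1 <= 2 * m)%N /\ (j2 <= 2 * m)%N).
    have := @measurable_occ_le _ (K / m%:R) (@continuous_bump m j1 j2).
    by congr measurable; apply/seteqP; split => x /=; [move=> ? _|exact].
  rewrite (_ : F _ _ _ = setT); first exact: measurableT.
  by apply/seteqP; split => // x _ /h.
have := bigcapT_measurable (fun m => bigcapT_measurable (fun j1 =>
  bigcapT_measurable (mF m j1))).
congr measurable; apply/seteqP; split => x /= h m.
  by move=> j1 j2 m0 j1m j2m; apply: (h m I j1 I j2 I).
by move=> _ j1 _ j2 _ [m0 [j1m j2m]]; exact: h.
Qed.

Lemma measurable_occ_charged y delta : measurable (occ_charged y delta : set Omega).
Proof.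
pose F m j1 j2 := [set x : R -> R | delta^-1 <= m%:R /\
     `|(j1%:R - j2%:R) / m%:R - y| <= delta ->
     occ_ge (bump m j1 j2) (delta / m%:R) x].
have mF m j1 j2 : measurable (F m j1 j2 : set Omega).
  have [h|h] := pselect (delta^-1 <= m%:R /\
     `|(j1%:R - j2%:R) / m%:R - y| <= delta).
    have := @measurable_occ_ge _ (delta / m%:R) (@continuous_bump m j1 j2).
    by congr measurable; apply/seteqP; split => x /=; [move=> ? _|exact].
  rewrite (_ : F _ _ _ = setT); first exact: measurableT.
  by apply/seteqP; split => // x _ /h.
have := bigcapT_measurable (fun m => bigcapT_measurable (fun j1 =>
  bigcapT_measurable (mF m j1))).
congr measurable; apply/seteqP; split => x /= h m.
  by move=> j1 j2 m0 j12; apply: (h m I j1 I j2 I).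
by move=> _ j1 _ j2 _ [m0 j12]; exact: h.
Qed.

Section shifted.
Variables (b f : R -> R) (t h : R).
Hypotheses (cb : continuous b) (cf : continuous f) (f0 : forall u, 0 <= f u).
Hypothesis h0 : 0 < h.
Let g (u : R) : R := f ((b u - b t) / Num.sqrt h).

Let cg : continuous g.
Proof.
move=> u; have c1 : {for u, continuous (fun u => (b u - b t) / Num.sqrt h)}.
  apply: cvgM; last exact: cvg_cst.
  by apply: cvgB; [exact: cb|exact: cvg_cst].
by apply: (@continuous_comp _ _ _ (fun u => (b u - b t) / Num.sqrt h) f) => //; exact: cf.
Qed.

Let riemannE n : riemann g t h n = h * occ n f (shift t h b).
Proof. by rewrite /riemann /occ mulrA. Qed.

Let I := (\int[mu]_(u in `]t, (t + h)%R]) (g u)%:E)%E.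

Let bracket e : 0 < e -> exists n0, forall n, (n0 <= n)%N ->
  (I <= (h * occ n f (shift t h b) + e)%:E)%E /\
  ((h * occ n f (shift t h b) - e)%:E <= I)%E.
Proof.
move=> e0; have mg := continuous_measurable_fun cg.
have [n0 hn0] := riemann_cvg mg (fun u => f0 _) t cg h0 e0.
by exists n0 => n /hn0; rewrite riemannE.
Qed.

Let small (e : R) : 0 < e -> exists l : nat, l.+1%:R^-1 < e.
Proof.
move=> e0; exists (Num.truncn e^-1); rewrite invf_plt ?posrE//.
exact: truncnS_gt.
Qed.

(** For a continuous path the dyadic averages are Riemann sums that converge, so the condition on
    the rescaled block is exactly one on a time integral. This links events of paths to local
    times. *)
Lemma occ_le_shiftP (c : R) : occ_le f c (shift t h b) <-> (I <= (h * c)%:E)%E.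
Proof.
split => [oc|Ic l].
  apply/lee_addgt0Pr => e e0.
  have e20 : 0 < e / 2 by rewrite divr_gt0.
  have [l hl] := small (divr_gt0 e20 h0).
  have [n1 hn1] := oc l; have [n2 hn2] := bracket e20.
  have := hn1 (maxn n1 n2) (leq_maxl _ _); have [] := hn2 (maxn n1 n2) (leq_maxr _ _).
  move=> I1 _ o1; apply: (le_trans I1); rewrite -EFinD lee_fin.
  have : h * occ (maxn n1 n2) f (shift t h b) <= h * (c + e / 2 / h).
    by rewrite ler_pM2l// (le_trans o1)// lerD2l ltW.
  have -> : h * (c + e / 2 / h) = h * c + e / 2 by field; rewrite gt_eqF.
  lra.
have e0 : 0 < h * l.+1%:R^-1 by rewrite mulr_gt0 ?invr_gt0.
have [n0 hn0] := bracket e0; exists n0 => n /hn0[_ /le_trans/(_ Ic)].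
by rewrite lee_fin lerBlDr -mulrDr ler_pM2l.
Qed.

Lemma occ_ge_shiftP (c : R) : occ_ge f c (shift t h b) <-> ((h * c)%:E <= I)%E.
Proof.
split => [oc|Ic l].
  apply/lee_addgt0Pr => e e0.
  have e20 : 0 < e / 2 by rewrite divr_gt0.
  have [l hl] := small (divr_gt0 e20 h0).
  have [n1 hn1] := oc l; have [n2 hn2] := bracket e20.
  have := hn1 (maxn n1 n2) (leq_maxl _ _); have [] := hn2 (maxn n1 n2) (leq_maxr _ _).
  move=> _ I1 o1; apply: (@le_trans _ _ ((h * occ (maxn n1 n2) f (shift t h b) - e / 2)%:E + e%:E)%E); last first.
    by rewrite leeD2r.
  rewrite -EFinD lee_fin.
  have : h * c <= h * (occ (maxn n1 n2) f (shift t h b) + e / 2 / h).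
    by rewrite ler_pM2l// (le_trans o1)// lerD2l ltW.
  have -> : h * (occ (maxn n1 n2) f (shift t h b) + e / 2 / h) =
    h * occ (maxn n1 n2) f (shift t h b) + e / 2 by field; rewrite gt_eqF.
  lra.
have e0 : 0 < h * l.+1%:R^-1 by rewrite mulr_gt0 ?invr_gt0.
have [n0 hn0] := bracket e0; exists n0 => n /hn0[/(le_trans Ic) + _].
by rewrite lee_fin -mulrDr ler_pM2l.
Qed.

End shifted.

End occupation.

(** * Local times *)

Section local_time.
Context {R : realType}.
Notation mu := (@lebesgue_measure R).

(** The deterministic notion, for one sample path. Of joint continuity only continuity in space is
    kept. *)
Definition local_time (b : R -> R) (l : R -> R -> R) : Prop :=
  [/\ continuous b, forall t, 0 <= t -> continuous (l t)
    & forall (t : R) (f : R -> R), 0 <= t -> measurable_fun setT f ->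
      (forall x, 0 <= f x) -> (exists M : R, forall x, f x <= M) ->
      (\int[mu]_(s in `[0%R, t]) (f (b s))%:E = \int[mu]_x (f x * l t x)%:E)%E].

Variables (b : R -> R) (l : R -> R -> R) (hl : local_time b l).

Let cb : continuous b. Proof. by case: hl. Qed.

Let cl t : 0 <= t -> continuous (l t). Proof. by case: hl => _ + _; apply. Qed.

Let occupation (t : R) (f : R -> R) : 0 <= t -> measurable_fun setT f ->
  (forall x, 0 <= f x) -> (exists M : R, forall x, f x <= M) ->
  (\int[mu]_(s in `[0%R, t]) (f (b s))%:E = \int[mu]_x (f x * l t x)%:E)%E.
Proof. by case: hl => _ _; apply. Qed.

Let ind (u v : R) : R -> R := \1_(`]u, v]%classic).

Let mind u v : measurable_fun setT (ind u v).
Proof. exact: measurable_indic. Qed.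

Let ind_ge0 u v x : 0 <= ind u v x.
Proof. by rewrite /ind indicE. Qed.

Let ind_le1 u v x : ind u v x <= 1.
Proof. by rewrite /ind indicE lern1 leq_b1. Qed.

Let indE u v x : ind u v x = if (u < x) && (x <= v) then 1 else 0.
Proof. by rewrite /ind indicE mem_setE in_itv/=; case: ifP. Qed.

Let integral_ind (g : R -> R) u v :
  (\int[mu]_x (ind u v x * g x)%:E = \int[mu]_(x in `]u, v]) (g x)%:E)%E.
Proof.
rewrite [RHS]integral_mkcond; apply: eq_integral => x _.
by rewrite patchE mem_setE in_itv/= indE; case: ifP; rewrite ?mul1r ?mul0r.
Qed.

Let ml t : 0 <= t -> measurable_fun setT (l t).
Proof. by move=> t0; exact: (continuous_measurable_fun (cl t0)). Qed.

(** A negative value would persist on an interval by continuity, and the time spent in that interval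
    would be negative. *)
Lemma local_time_ge0 t x : 0 <= t -> 0 <= l t x.
Proof.
move=> t0; rewrite leNgt; apply/negP => lx0.
have e0 : 0 < - l t x / 2 by rewrite divr_gt0// oppr_gt0.
have [r r0 hr] := continuous_dist x (cl t0) e0.
pose u := x - r / 2.
have neg y : u < y -> y <= x -> - l t x / 2 <= - l t y.
  move=> uy yx; have : `|x - y| < r.
    by rewrite ger0_norm ?subr_ge0//; rewrite /u in uy; move: r0; lra.
  by move=> /hr; rewrite ltr_norml; lra.
have := occupation t0 (@mind u x) (@ind_ge0 u x) (ex_intro _ 1 (@ind_le1 u x)).
rewrite integral_ind [X in _ = X -> _]integralE.
rewrite [X in _ = (X - _)%E -> _](_ : _ = 0%E); last first.
  apply: integral0_eq => y /=; rewrite in_itv/= => /andP[uy yx].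
  rewrite funeposE; apply/max_idPr; rewrite lee_fin.
  by have := neg y uy yx; lra.
rewrite sub0e => e.
have : (0 <= \int[mu]_(s in `[0%R, t]) (ind u x (b s))%:E)%E.
  by apply: integral_ge0 => s _; rewrite lee_fin.
rewrite e leNgt => /negP; apply; rewrite oppe_lt0.
apply: (@lt_le_trans _ _ ((- l t x / 2 * (x - u))%:E)).
  by rewrite lte_fin mulr_gt0// /u; lra.
pose g y : R := Num.max (- l t y) 0.
have mg : measurable_fun setT g.
  apply: measurable_maxr; last exact: measurable_cst.
  exact: (measurable_funN (ml t0)).
have -> : (\int[mu]_(y in `]u, x]) (fun y : R => (l t y)%:E)^\- y =
    \int[mu]_(y in `]u, x]) (g y)%:E)%E.
  by apply: eq_integral => y _; rewrite funenegE EFin_max.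
apply: ge_integral_itv => //.
- by move=> y; rewrite /g le_max lexx orbT.
- by rewrite /u; lra.
- by move=> y uy yx; rewrite /g le_max neg.
Qed.

(** The time spent in a short interval grows with [t]; continuity in space carries this over to the
    densities. *)
Lemma local_time_nondecreasing s t x : 0 <= s -> s <= t -> l s x <= l t x.
Proof.
move=> s0 st; have t0 := le_trans s0 st.
rewrite leNgt; apply/negP => lts.
have e0 : 0 < (l s x - l t x) / 3 by rewrite divr_gt0// subr_gt0.
have [r1 r10 hr1] := continuous_dist x (cl s0) e0.
have [r2 r20 hr2] := continuous_dist x (cl t0) e0.
pose r := Num.min r1 r2; have r0 : 0 < r by rewrite lt_min r10.
pose u := x - r / 2.
have ux : u < x by rewrite /u; lra.
have near y : u < y -> y <= x -> `|x - y| < r1 /\ `|x - y| < r2.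
  move=> uy yx; apply/andP; rewrite -lt_min -/r ger0_norm ?subr_ge0//.
  by rewrite /u in uy; move: r0; lra.
have occ u' : 0 <= u' -> (\int[mu]_(v in `[0%R, u']) (ind u x (b v))%:E =
    \int[mu]_(y in `]u, x]) (l u' y)%:E)%E.
  by move=> u'0; rewrite occupation// ?integral_ind//; exists 1.
have : (\int[mu]_(v in `[0%R, s]) (ind u x (b v))%:E <=
    \int[mu]_(v in `[0%R, t]) (ind u x (b v))%:E)%E.
  apply: ge0_subset_integral => //.
  - apply/measurable_EFinP; apply: measurable_funTS.
    exact: (measurableT_comp (@mind u x) (continuous_measurable_fun cb)).
  - by move=> v _; rewrite lee_fin.
  - by move=> v /=; rewrite !in_itv/= => /andP[-> /le_trans]; apply.
rewrite !occ// leNgt => /negP; apply.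
apply: (@le_lt_trans _ _ ((l t x + (l s x - l t x) / 3) * (x - u))%:E).
  apply: le_integral_itv; [exact: ml|by move=> y; exact: local_time_ge0|exact: ltW|].
  by move=> y uy yx; have [_ /hr2] := near y uy yx; rewrite ltr_norml; lra.
apply: (@lt_le_trans _ _ ((l s x - (l s x - l t x) / 3) * (x - u))%:E).
  by rewrite lte_fin ltr_pM2r ?subr_gt0//; lra.
apply: ge_integral_itv; [exact: ml|by move=> y; exact: local_time_ge0|exact: ltW|].
by move=> y uy yx; have [/hr1 + _] := near y uy yx; rewrite ltr_norml; lra.
Qed.

(** Written as a sum, because a difference in [\bar R] calls for finiteness; [occupation_fin]
    permits the cancellation later. *)
Lemma occupation_increment s t (f : R -> R) : 0 <= s -> s <= t ->
  measurable_fun setT f -> (forall x, 0 <= f x) -> (exists M : R, forall x, f x <= M) ->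
  (\int[mu]_x (f x * l s x)%:E + \int[mu]_(v in `]s, t]) (f (b v))%:E =
   \int[mu]_x (f x * l t x)%:E)%E.
Proof.
move=> s0 st mf f0 fM; have t0 := le_trans s0 st.
rewrite -!occupation//.
have mfb : measurable_fun setT (f \o b).
  exact: (measurableT_comp mf (continuous_measurable_fun cb)).
have mE (D : set R) : measurable_fun D (fun v => (f (b v))%:E).
  by apply/measurable_EFinP; apply: measurable_funTS.
rewrite -!(integral_itv_obnd_cbnd (mE _)).
exact/esym/(@ge0_integral_chasles R (f \o b) mfb (fun x => f0 (b x)) 0 s t s0 st).
Qed.

Lemma occupation_fin t (f : R -> R) : 0 <= t -> measurable_fun setT f ->
  (forall x, 0 <= f x) -> (forall x, f x <= 1) ->
  (\int[mu]_x (f x * l t x)%:E)%E \is a fin_num.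
Proof.
move=> t0 mf f0 f1; rewrite -occupation//; last by exists 1.
have mfb : measurable_fun setT (f \o b).
  exact: (measurableT_comp mf (continuous_measurable_fun cb)).
rewrite ge0_fin_numE; last by apply: integral_ge0 => v _; rewrite lee_fin.
apply: (@le_lt_trans _ _ (\int[mu]_(v in `[0%R, t]) 1%:E)%E).
  apply: ge0_le_integral => //.
  - by move=> v _; rewrite lee_fin.
  - by apply/measurable_EFinP; apply: measurable_funTS.
  - by move=> v _; rewrite lee_fin.
rewrite integral_cst//= lebesgue_measure_itv/= mul1e.
by case: ifP => _; rewrite -?EFinB ltry.
Qed.

Lemma occupation_le s t u v c (f : R -> R) : 0 <= s -> s <= t -> u <= v ->
  0 <= c -> measurable_fun setT f ->
  (forall x, 0 <= f x) -> (forall x, f x <= 1) ->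
  (forall x, ~ (u < x /\ x <= v) -> f x = 0) ->
  (forall x, u < x -> x <= v -> l t x <= l s x + c) ->
  (\int[mu]_(r in `]s, t]) (f (b r))%:E <= (c * (v - u))%:E)%E.
Proof.
move=> s0 st uv c0 mf f0 f1 fuv lc; have t0 := le_trans s0 st.
rewrite -(leeD2lE _ _ (occupation_fin s0 mf f0 f1)).
rewrite occupation_increment//; last by exists 1.
have mls : measurable_fun setT (fun x => (f x * l s x)%:E).
  by apply/measurable_EFinP; apply: measurable_funM => //; exact: ml.
have mlt : measurable_fun setT (fun x => (f x * l t x)%:E).
  by apply/measurable_EFinP; apply: measurable_funM => //; exact: ml.
have mc : measurable_fun setT (fun x => (ind u v x * c)%:E).
  by apply/measurable_EFinP; apply: measurable_funM => //; exact: measurable_cst.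
apply: (@le_trans _ _ (\int[mu]_x ((f x * l s x)%:E + (ind u v x * c)%:E))%E).
  apply: ge0_le_integral => //.
  - by move=> x _; rewrite lee_fin mulr_ge0// local_time_ge0.
  - exact: emeasurable_funD.
  - move=> x _; rewrite -EFinD lee_fin indE; case: ifPn => [/andP[ux xv]|].
      rewrite mul1r; apply: (@le_trans _ _ (f x * (l s x + c))).
        by rewrite ler_wpM2l// lc.
      by rewrite mulrDr lerD2l ler_piMl.
    by move=> /negP nx; rewrite fuv ?mul0r ?addr0// => -[ux xv]; apply: nx; rewrite ux.
rewrite ge0_integralD//=; last 2 first.
- by move=> x _; rewrite lee_fin mulr_ge0// local_time_ge0.
- by move=> x _; rewrite lee_fin mulr_ge0.
by rewrite leeD2l// integral_ind le_integral_itv.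
Qed.

(** The height [1 / 2] is suited to a bump, which is at least that high on the middle half of its
    support. *)
Lemma occupation_ge s t u v c (f : R -> R) : 0 <= s -> s <= t -> u <= v ->
  0 <= c -> measurable_fun setT f ->
  (forall x, 0 <= f x) -> (forall x, f x <= 1) ->
  (forall x, u < x -> x <= v -> 1 / 2 <= f x) ->
  (forall x, u < x -> x <= v -> l s x + c <= l t x) ->
  ((c / 2 * (v - u))%:E <= \int[mu]_(r in `]s, t]) (f (b r))%:E)%E.
Proof.
move=> s0 st uv c0 mf f0 f1 fuv lc; have t0 := le_trans s0 st.
rewrite -(leeD2lE _ _ (occupation_fin s0 mf f0 f1)).
rewrite occupation_increment//; last by exists 1.
have c20 : 0 <= c / 2 by rewrite divr_ge0.
have mls : measurable_fun setT (fun x => (f x * l s x)%:E).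
  by apply/measurable_EFinP; apply: measurable_funM => //; exact: ml.
have mlt : measurable_fun setT (fun x => (f x * l t x)%:E).
  by apply/measurable_EFinP; apply: measurable_funM => //; exact: ml.
have mc : measurable_fun setT (fun x => (ind u v x * (c / 2))%:E).
  by apply/measurable_EFinP; apply: measurable_funM => //; exact: measurable_cst.
apply: (@le_trans _ _ (\int[mu]_x ((f x * l s x)%:E + (ind u v x * (c / 2))%:E))%E).
  rewrite ge0_integralD//=; last 2 first.
  - by move=> x _; rewrite lee_fin mulr_ge0// local_time_ge0.
  - by move=> x _; rewrite lee_fin mulr_ge0.
  by rewrite leeD2l// integral_ind ge_integral_itv.
apply: ge0_le_integral => //.
- by move=> x _; rewrite -EFinD lee_fin addr_ge0// mulr_ge0// local_time_ge0.
- exact: emeasurable_funD.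
- move=> x _; rewrite -EFinD lee_fin indE; case: ifPn => [/andP[ux xv]|_].
    rewrite mul1r; apply: (@le_trans _ _ (f x * (l s x + c))).
      rewrite mulrDr lerD2l mulrC.
      have := ler_wpM2r c0 (fuv x ux xv); lra.
    by rewrite ler_wpM2l// lc.
  by rewrite mul0r addr0 ler_wpM2l// local_time_nondecreasing.
Qed.

End local_time.

Section local_time_occupation.
Context {R : realType}.
Variables (b : R -> R) (l : R -> R -> R) (hl : local_time b l).

Let cb : continuous b. Proof. by case: hl. Qed.

Let cl t : 0 <= t -> continuous (l t). Proof. by case: hl => _ + _; apply. Qed.

(** The integer part of [m * |y|] is put in [j1] or in [j2] according to the sign of [y], the other
    index being 0. *)
Lemma exists_bump_index (m : nat) (y : R) : (0 < m)%N ->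
  exists j1 j2 : nat, [/\ `|(j1%:R - j2%:R) / m%:R - y| <= m%:R^-1,
    j1%:R <= m%:R * `|y| & j2%:R <= m%:R * `|y|].
Proof.
move=> m0; have m0' : 0 < m%:R :> R by rewrite ltr0n.
pose j := Num.truncn (m%:R * `|y|).
have my0 : 0 <= m%:R * `|y| by rewrite mulr_ge0.
have := truncn_itv my0 => /andP[j1 j2].
have key : `|j%:R / m%:R - `|y| | <= m%:R^-1.
  have -> : j%:R / m%:R - `|y| = (j%:R - m%:R * `|y|) * m%:R^-1.
    by field; rewrite gt_eqF.
  rewrite normrM [X in _ * X]gtr0_norm ?invr_gt0// ler_piMl ?invr_ge0//.
  by move: j1 j2; rewrite -/j -natr1 ler_norml; move: (m%:R * `|y|) => q; lra.
have [y0|y0] := leP 0 y.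
  exists j, 0%N; split; rewrite ?subr0//.
  by move: key; rewrite (ger0_norm y0).
exists 0%N, j; split; rewrite ?sub0r//.
by move: key; rewrite (ltr0_norm y0) mulNr -opprD normrN opprK.
Qed.

Lemma exists_large_nat (e : R) : 0 < e -> exists N : nat, forall m, (N <= m)%N ->
  (0 < m)%N /\ m%:R^-1 < e.
Proof.
move=> e0; exists (Num.truncn e^-1).+1 => m Nm.
have m0 : (0 < m)%N by exact: leq_trans Nm.
split => //; rewrite invf_plt ?posrE ?ltr0n//.
by rewrite (lt_le_trans (truncnS_gt _))// ler_nat.
Qed.

Section block.
Variables (t h : R) (t0 : 0 <= t) (h0 : 0 < h).
Let a := Num.sqrt h.
Let a0 : 0 < a. Proof. by rewrite sqrtr_gt0. Qed.
Let a20 : 0 < 2 * a. Proof. by rewrite mulr_gt0. Qed.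
Let aa : a * a = h. Proof. by rewrite -expr2 sqr_sqrtr// ltW. Qed.
Let th0 : 0 <= t + h. Proof. by rewrite addr_ge0// ltW. Qed.

Let f m j1 j2 (x : R) : R := bump m j1 j2 ((x - b t) / a).

Let mf m j1 j2 : measurable_fun setT (f m j1 j2).
Proof.
have m1 : measurable_fun setT (fun x : R => (x - b t) / a).
  apply: continuous_measurable_fun => x; apply: cvgM; last exact: cvg_cst.
  by apply: cvgB; [exact: cvg_id|exact: cvg_cst].
exact: (measurableT_comp (continuous_measurable_fun (@continuous_bump R m j1 j2)) m1).
Qed.

Let fE m j1 j2 x : (0 < m)%N -> f m j1 j2 x = Num.max 0
  (1 - m%:R / a * `|x - (b t + a * ((j1%:R - j2%:R) / m%:R))|).
Proof.
move=> m0; have m0' : 0 < m%:R :> R by rewrite ltr0n.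
rewrite /f /bump; congr (Num.max _ (1 - _)).
rewrite -[m%:R / a]gtr0_norm ?divr_gt0// -normrM; congr `|_|.
by field; rewrite !gt_eqF.
Qed.

Let local_time_near (x e : R) : 0 < e -> exists2 r, 0 < r & forall y, `|x - y| < r ->
  `|(l (t + h) x - l t x) - (l (t + h) y - l t y)| < e.
Proof.
move=> e0; have e20 : 0 < e / 2 by rewrite divr_gt0.
have [r1 r10 hr1] := continuous_dist x (cl th0) e20.
have [r2 r20 hr2] := continuous_dist x (cl t0) e20.
exists (Num.min r1 r2); first by rewrite lt_min r10.
move=> y; rewrite lt_min => /andP[/hr1 h1 /hr2 h2].
have -> : l (t + h) x - l t x - (l (t + h) y - l t y) =
  (l (t + h) x - l (t + h) y) - (l t x - l t y) by ring.
by rewrite (le_lt_trans (ler_normB _ _))//; lra.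
Qed.

(** If the local time grows by [g] near the point, the bump integrates to at least [g / 2] times
    [a / m], whereas [occ_bounded] allows [h * K / m] with [h = a ^+ 2]. Hence [g <= 2 * K * a]. *)
Lemma occ_bounded_local_time (K y : R) : 0 <= K -> `|y| <= 1 ->
  occ_bounded K (shift t h b) ->
  l (t + h) (b t + a * y) <= l t (b t + a * y) + 2 * K * a.
Proof.
move=> K0 y1 hK; set x := b t + a * y.
rewrite -lerBlDl leNgt; apply/negP => lt.
pose e := (l (t + h) x - l t x - 2 * K * a) / 2.
have e0 : 0 < e by rewrite divr_gt0// subr_gt0.
have [r r0 hr] := local_time_near x e0.
have ra0 : 0 < r / (2 * a) by rewrite divr_gt0// mulr_gt0.
have [m hm] := exists_large_nat ra0.
have [m0 mr] := hm m (leqnn m).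
have m0' : 0 < m%:R :> R by rewrite ltr0n.
have [j1 [j2 [jy jm1 jm2]]] := exists_bump_index y m0.
have jle j : j%:R <= m%:R * `|y| -> (j <= 2 * m)%N.
  move=> jm; rewrite -(ler_nat R) natrM (le_trans jm)//.
  by rewrite mulrC ler_pM2r//; lra.
have := hK m j1 j2 m0 (jle _ jm1) (jle _ jm2).
move=> /(occ_le_shiftP t cb (@continuous_bump R m j1 j2) (@bump_ge0 R m j1 j2) h0).
rewrite leNgt => /negP; apply.
pose p := b t + a * ((j1%:R - j2%:R) / m%:R).
pose w := a / m%:R / 2.
have w0 : 0 < w by rewrite !divr_gt0.
have w20 : 0 < 2 * w by rewrite mulr_gt0.
have px : `|x - p| <= a / m%:R.
  rewrite /x /p opprD addrACA subrr add0r -mulrBr normrM (gtr0_norm a0) distrC.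
  by rewrite ler_pM2l.
have aw : a / m%:R + w < r.
  have am0 : 0 < a / m%:R by rewrite divr_gt0.
  move: mr am0; rewrite (ltr_pdivlMr _ _ a20) /w.
  have -> : m%:R^-1 * (2 * a) = 2 * (a / m%:R) by ring.
  by move: (a / m%:R) => c; lra.
have near z : p - w < z -> z <= p + w -> `|z - p| <= w.
  by move=> z1 z2; rewrite ler_norml; apply/andP; split; lra.
apply: (@lt_le_trans _ _ (((2 * K * a + e) / 2 * (p + w - (p - w)))%:E)).
  rewrite lte_fin.
  have -> : h * (K / m%:R) = K * a * (2 * w).
    by rewrite -aa /w; field; rewrite gt_eqF.
  have -> : p + w - (p - w) = 2 * w by ring.
  by rewrite (ltr_pM2r w20); lra.
apply: (@occupation_ge R b l hl t (t + h) (p - w) (p + w) (2 * K * a + e) (f m j1 j2)) => //.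
- by rewrite lerDl ltW.
- by lra.
- by rewrite addr_ge0 ?(ltW e0)// mulr_ge0 ?(ltW a0)// mulr_ge0.
- by move=> z; exact: bump_ge0.
- by move=> z; exact: bump_le1.
- move=> z z1 z2; rewrite fE// le_max -/p; apply/orP; right.
  have : m%:R / a * `|z - p| <= m%:R / a * w by rewrite ler_pM2l ?divr_gt0// near.
  have -> : m%:R / a * w = 1 / 2 by rewrite /w; field; rewrite !gt_eqF.
  lra.
- move=> z z1 z2; have : `|x - z| < r.
    rewrite -(subrKA p) (le_lt_trans (ler_normD _ _))// distrC.
    rewrite (le_lt_trans _ aw)// lerD//; first by rewrite distrC.
    by rewrite distrC near.
  move=> /hr; rewrite ltr_norml => /andP[_]; rewrite /e; lra.
Qed.

(** A growth [g] of the local time gives the bump an integral of at most [g] times its support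
    length [2 * a / m], whereas [occ_charged] demands [h * delta / m] with [h = a ^+ 2]. Hence
    [g >= delta * a / 2]. *)
Lemma occ_charged_local_time (y0 delta y : R) : 0 < delta -> `|y - y0| < delta ->
  occ_charged y0 delta (shift t h b) ->
  l t (b t + a * y) + delta * a / 2 <= l (t + h) (b t + a * y).
Proof.
move=> d0 yd hd; set x := b t + a * y.
rewrite -lerBrDl leNgt; apply/negP => lt.
pose e := (delta * a / 2 - (l (t + h) x - l t x)) / 2.
have e0 : 0 < e by rewrite divr_gt0// subr_gt0.
have [r r0 hr] := local_time_near x e0.
have ra0 : 0 < Num.min (r / (2 * a)) (Num.min delta (delta - `|y - y0|)).
  by rewrite !lt_min d0 subr_gt0 yd divr_gt0// mulr_gt0.
have [m hm] := exists_large_nat ra0.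
have [m0 ] := hm m (leqnn m); rewrite !lt_min => /and3P[mr md myd].
have m0' : 0 < m%:R :> R by rewrite ltr0n.
have [j1 [j2 [jy _ _]]] := exists_bump_index y m0.
have dm : delta^-1 <= m%:R by rewrite invf_ple ?posrE// ltW.
have jy0 : `|(j1%:R - j2%:R) / m%:R - y0| <= delta.
  rewrite -(subrKA y) (le_trans (ler_normD _ _))//; lra.
have := hd m j1 j2 dm jy0.
move=> /(occ_ge_shiftP t cb (@continuous_bump R m j1 j2) (@bump_ge0 R m j1 j2) h0).
rewrite leNgt => /negP; apply.
pose p := b t + a * ((j1%:R - j2%:R) / m%:R).
pose w := a / m%:R.
have w0 : 0 < w by rewrite !divr_gt0.
have w20 : 0 < 2 * w by rewrite mulr_gt0.
have px : `|x - p| <= w.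
  rewrite /x /p opprD addrACA subrr add0r -mulrBr normrM (gtr0_norm a0) distrC.
  by rewrite ler_pM2l.
have aw : w + w < r.
  move: mr; rewrite (ltr_pdivlMr _ _ a20) /w.
  have -> : m%:R^-1 * (2 * a) = 2 * (a / m%:R) by ring.
  by move: (a / m%:R) => c; lra.
have near z : p - w < z -> z <= p + w -> `|z - p| <= w.
  by move=> z1 z2; rewrite ler_norml; apply/andP; split; lra.
have D0 : 0 <= l (t + h) x - l t x.
  by rewrite subr_ge0 (local_time_nondecreasing hl)// lerDl ltW.
apply: (@le_lt_trans _ _ (((delta * a / 2 - e) * (p + w - (p - w)))%:E)); last first.
  rewrite lte_fin.
  have -> : h * (delta / m%:R) = delta * a / 2 * (2 * w).
    by rewrite -aa /w; field; rewrite gt_eqF.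
  have -> : p + w - (p - w) = 2 * w by ring.
  by rewrite (ltr_pM2r w20); lra.
apply: (@occupation_le R b l hl t (t + h) (p - w) (p + w) (delta * a / 2 - e) (f m j1 j2)) => //.
- by rewrite lerDl ltW.
- by lra.
- by rewrite /e; lra.
- by move=> z; exact: bump_ge0.
- by move=> z; exact: bump_le1.
- move=> z nz; rewrite fE// -/p; apply/max_idPl; rewrite subr_le0.
  have mw : m%:R / a * w = 1 by rewrite /w; field; rewrite !gt_eqF.
  rewrite -[leLHS]mw ler_pM2l ?divr_gt0// leNgt; apply/negP => zw; apply: nz.
  by move: zw; rewrite ltr_norml => /andP[z1 z2]; split; lra.
- move=> z z1 z2; have : `|x - z| < r.
    rewrite -(subrKA p) (le_lt_trans (ler_normD _ _))// (le_lt_trans _ aw)// lerD//.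
    by rewrite distrC near.
  move=> /hr; rewrite ltr_norml => /andP[]; rewrite /e; lra.
Qed.

End block.

End local_time_occupation.

Section local_time_unit.
Context {R : realType}.
Notation mu := (@lebesgue_measure R).

Lemma continuous_bounded_segment (f : R -> R) (u v : R) : continuous f -> u <= v ->
  exists M : nat, forall x, u <= x -> x <= v -> f x < M%:R.
Proof.
move=> cf uv; have [|c _ hc] := @EVT_max R f u v uv.
  by apply: continuous_subspaceT => x; exact: cf.
exists (Num.truncn (f c)).+1 => x ux xv.
by rewrite (le_lt_trans _ (truncnS_gt _))// hc// in_itv/= ux xv.
Qed.

Variables (b : R -> R) (l : R -> R -> R) (hl : local_time b l).

Let cb : continuous b. Proof. by case: hl. Qed.

Let cl t : 0 <= t -> continuous (l t). Proof. by case: hl => _ + _; apply. Qed.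

(** An increase at [x] would hold on a small interval next to [x] and force the path to spend time
    there between [s] and [t]. *)
Lemma local_time_avoid s t x e : 0 <= s -> s <= t -> 0 < e ->
  (forall r, s < r -> r <= t -> e <= `|b r - x|) -> l t x <= l s x.
Proof.
move=> s0 st e0 bx; have t0 := le_trans s0 st.
rewrite leNgt; apply/negP => lst.
pose c := (l t x - l s x) / 3.
have c0 : 0 < c by rewrite divr_gt0// subr_gt0.
have [r1 r10 hr1] := continuous_dist x (cl s0) c0.
have [r2 r20 hr2] := continuous_dist x (cl t0) c0.
pose r := Num.min e (Num.min r1 r2).
have r0 : 0 < r by rewrite !lt_min e0 r10.
pose u := x - r / 2.
have ux : u < x by rewrite /u; lra.
have near y : u < y -> y <= x -> [/\ `|y - x| < e, `|x - y| < r1 & `|x - y| < r2].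
  move=> uy yx; have : `|x - y| < r.
    by rewrite ger0_norm ?subr_ge0//; rewrite /u in uy; move: r0; lra.
  by rewrite /r !lt_min => /and3P[h0 h1 h2]; split; rewrite // distrC.
pose f : R -> R := \1_(`]u, x]%classic).
have mf : measurable_fun setT f by exact: measurable_indic.
have f0 y : 0 <= f y by rewrite /f indicE.
have f1 y : f y <= 1 by rewrite /f indicE lern1 leq_b1.
have := @occupation_ge R b l hl s t u x c f s0 st (ltW ux) (ltW c0) mf f0 f1.
rewrite integral0_eq; last first.
  move=> v /=; rewrite in_itv/= => /andP[sv vt]; rewrite /f indicE mem_setE in_itv/=.
  case: (boolP (u < b v <= x)) => //; case/andP => ub bx'; have [h _ _] := near _ ub bx'.
  by move: h; rewrite ltNge bx.
move=> H; suff : (c / 2 * (x - u) <= 0).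
  by rewrite leNgt => /negP; apply; rewrite mulr_gt0 ?subr_gt0// divr_gt0.
rewrite -lee_fin; apply: H => y uy yx.
  have -> : f y = 1 by rewrite /f indicE mem_setE in_itv/= uy yx.
  lra.
by have [_ /hr1 + /hr2] := near y uy yx; rewrite !ltr_norml /c; lra.
Qed.

Lemma local_time_mass : (\int[mu]_x (l 1 x)%:E = 1)%E.
Proof.
have [_ _ ol] := hl.
have h := ol 1 (fun=> 1) ler01 (measurable_cst _) (fun=> ler01).
under eq_integral do rewrite -[l 1 _]mul1r.
rewrite -h; last by exists 1.
rewrite integral_cst//= lebesgue_measure_itv/= lte01 mul1e.
by rewrite sube0.
Qed.

Lemma local_time_pos : exists x, 0 < l 1 x.
Proof.
apply: contrapT => /forallNP h; have := local_time_mass.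
rewrite integral0_eq; last first.
  move=> x _; congr EFin; apply/le_anti/andP; split.
    by rewrite leNgt; apply/negP; exact: h.
  exact: (local_time_ge0 hl).
by move/eqP; rewrite eq_sym onee_eq0.
Qed.

Hypothesis b0 : b 0 = 0.

Let shift01 : shift 0 1 b = b.
Proof. by apply/funext => s; rewrite /shift b0 sqrtr1 divr1 subr0 add0r mul1r. Qed.

Let bump_near m j1 j2 (x : R) : (0 < m)%N ->
  bump m j1 j2 x = Num.max 0 (1 - m%:R * `|x - (j1%:R - j2%:R) / m%:R|).
Proof.
move=> m0; have m0' : 0 < m%:R :> R by rewrite ltr0n.
rewrite /bump; congr (Num.max _ (1 - _)).
have e v : m%:R * `|v| = `|m%:R * v| :> R by rewrite normrM (gtr0_norm m0').
by rewrite e; congr `|_|; field; rewrite gt_eqF.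
Qed.

Let integrandE m j1 j2 : (\int[mu]_(u in `]0%R, (0 + 1)%R])
    (bump m j1 j2 ((b u - b 0) / Num.sqrt 1))%:E =
  \int[mu]_(u in `]0%R, 1%R]) (bump m j1 j2 (b u))%:E)%E.
Proof. by rewrite add0r; apply: eq_integral => u _; rewrite b0 subr0 sqrtr1 divr1. Qed.

(** Centres in [[-2, 2]] and half-width at most 1 explain the segment [[-3, 3]]; the support length
    [2 / m] explains the factor 2. *)
Lemma occ_bounded_of_local_time (K : R) : 0 <= K ->
  (forall x, -3 <= x -> x <= 3 -> l 1 x <= K) -> occ_bounded (2 * K) b.
Proof.
move=> K0 lK m j1 j2 m0 j1m j2m; have m0' : 0 < m%:R :> R by rewrite ltr0n.
rewrite -shift01; apply/(occ_le_shiftP 0 cb (@continuous_bump R m j1 j2)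
  (@bump_ge0 R m j1 j2) ltr01).
rewrite integrandE mul1r.
pose p : R := (j1%:R - j2%:R) / m%:R.
have w0 : 0 < m%:R^-1 :> R by rewrite invr_gt0.
have w1 : m%:R^-1 <= 1 :> R by rewrite invf_le1// ler1n.
have p2 : -2 <= p /\ p <= 2.
  have h1 : j1%:R <= 2 * m%:R :> R by rewrite -natrM ler_nat.
  have h2 : j2%:R <= 2 * m%:R :> R by rewrite -natrM ler_nat.
  have h3 : 0 <= j1%:R :> R by [].
  have h4 : 0 <= j2%:R :> R by [].
  by rewrite /p ler_pdivlMr// ler_pdivrMr//; split; lra.
have -> : 2 * K / m%:R = K * (p + m%:R^-1 - (p - m%:R^-1)) by ring.
apply: (@occupation_le R b l hl 0 1 _ _ K (bump m j1 j2)) => //.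
- by lra.
- exact: (continuous_measurable_fun (@continuous_bump R m j1 j2)).
- by move=> z; exact: bump_ge0.
- by move=> z; exact: bump_le1.
- move=> z nz; rewrite bump_near// -/p; apply/max_idPl; rewrite subr_le0.
  rewrite -ler_pdivrMl// mulr1 leNgt; apply/negP => zw; apply: nz.
  by move: zw; rewrite ltr_norml => /andP[z1 z2]; split; lra.
- move=> z z1 z2; apply: (@le_trans _ _ K); first by apply: lK; lra.
  by rewrite lerDr (local_time_ge0 hl).
Qed.

Lemma local_time_start x : l 0 x = 0.
Proof.
apply/le_anti/andP; split; last exact: (local_time_ge0 hl).
rewrite leNgt; apply/negP => lx.
pose c := l 0 x / 2.
have c0 : 0 < c by rewrite divr_gt0.
have [r r0 hr] := continuous_dist x (cl (lexx 0)) c0.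
pose u := x - r / 2; have ux : u < x by rewrite /u; lra.
have [_ _ ol] := hl.
have i0 (y : R) : 0 <= \1_(`]u, x]%classic) y :> R by rewrite indicE.
have i1 : exists M : R, forall y : R, \1_(`]u, x]%classic) y <= M.
  by exists 1 => y; rewrite indicE lern1 leq_b1.
have mi : measurable_fun setT (\1_(`]u, x]%classic) : R -> R).
  exact: measurable_indic.
have := ol 0 _ (lexx 0) mi i0 i1; rewrite set_itv1 integral_set1 => e.
have : ((c * (x - u))%:E <= \int[mu]_(y in `]u, x]) (l 0 y)%:E)%E.
  apply: ge_integral_itv.
  - exact: (continuous_measurable_fun (cl (lexx 0))).
  - by move=> y; exact: (local_time_ge0 hl).
  - exact: ltW.
  - move=> y uy yx; have : `|x - y| < r.
      by rewrite ger0_norm ?subr_ge0//; rewrite /u in uy; move: r0; lra.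
    by move=> /hr; rewrite ltr_norml /c; lra.
have -> : (\int[mu]_(y in `]u, x]) (l 0 y)%:E =
    \int[mu]_y (\1_(`]u, x]%classic) y * l 0 y)%:E)%E.
  rewrite integral_mkcond; apply: eq_integral => y _.
  by rewrite patchE indicE; case: ifPn => _; rewrite ?mul1r ?mul0r.
rewrite -e lee_fin leNgt => /negP; apply.
by rewrite mulr_gt0// subr_gt0.
Qed.

(** The doubled height pays for the bump being only known to exceed [1 / 2], on an interval of
    length [1 / m]; the doubled radius contains that interval for every admissible centre. *)
Lemma occ_charged_of_local_time (y0 delta : R) : 0 < delta ->
  (forall x, `|x - y0| < 2 * delta -> 2 * delta <= l 1 x) ->
  occ_charged y0 delta b.
Proof.
move=> d0 ld m j1 j2 dm jy.
have m0' : 0 < m%:R :> R by rewrite (lt_le_trans _ dm)// invr_gt0.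
have m0 : (0 < m)%N by rewrite -(ltr0n R).
rewrite -shift01; apply/(occ_ge_shiftP 0 cb (@continuous_bump R m j1 j2)
  (@bump_ge0 R m j1 j2) ltr01).
rewrite integrandE mul1r.
pose p : R := (j1%:R - j2%:R) / m%:R; pose w : R := m%:R^-1 / 2.
have w0 : 0 < w by rewrite divr_gt0 ?invr_gt0.
have wd : w < delta.
  have : m%:R^-1 <= delta by rewrite invf_ple ?posrE.
  by rewrite /w; lra.
have -> : delta / m%:R = 2 * delta / 2 * (p + w - (p - w)).
  by rewrite /w; field; rewrite gt_eqF.
apply: (@occupation_ge R b l hl 0 1 _ _ (2 * delta) (bump m j1 j2)) => //.
- by lra.
- by rewrite mulr_ge0// ltW.
- exact: (continuous_measurable_fun (@continuous_bump R m j1 j2)).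
- by move=> z; exact: bump_ge0.
- by move=> z; exact: bump_le1.
- move=> z z1 z2; rewrite bump_near// le_max -/p; apply/orP; right.
  have zw : `|z - p| <= w by rewrite ler_norml; apply/andP; split; lra.
  have : m%:R * `|z - p| <= m%:R * w by rewrite ler_pM2l.
  have -> : m%:R * w = 1 / 2 by rewrite /w; field; rewrite gt_eqF.
  lra.
- move=> z z1 z2; rewrite local_time_start add0r ld//.
  have zw : `|z - p| <= w by rewrite ler_norml; apply/andP; split; lra.
  by rewrite -(subrKA p) (le_lt_trans (ler_normD _ _))//; move: jy zw; rewrite -/p; lra.
Qed.

(** The local time has mass 1, so it is positive somewhere and, by continuity, bounded below on an
    interval. The parameters are rounded to naturals. *)
Lemma exists_occ_charged : exists N j1 j2 : nat, (0 < N)%N /\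
  occ_charged ((j1%:R - j2%:R) / N%:R) N%:R^-1 b.
Proof.
have [y ly] := local_time_pos.
pose c := l 1 y / 2; have c0 : 0 < c by rewrite divr_gt0.
have [r r0 hr] := continuous_dist y (cl ler01) c0.
have rc0 : 0 < Num.min (r / 3) (c / 2) by rewrite lt_min !divr_gt0.
have [N hN] := exists_large_nat rc0.
have [N0] := hN N (leqnn N); rewrite lt_min => /andP[Nr Nc].
have [j1 [j2 [jy _ _]]] := exists_bump_index y N0.
exists N, j1, j2; split => //; apply: occ_charged_of_local_time.
  by rewrite invr_gt0 ltr0n.
move=> x xj; have : `|y - x| < r.
  rewrite distrC -(subrKA ((j1%:R - j2%:R) / N%:R)) (le_lt_trans (ler_normD _ _))//.
  by move: xj jy Nr; lra.
by move=> /hr; rewrite ltr_norml /c; move: Nc; rewrite /c; lra.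
Qed.

Lemma exists_occ_bounded : exists K : nat, occ_bounded K%:R b.
Proof.
have [M hM] := continuous_bounded_segment (u := -3) (v := 3) (cl ler01) ltac:(lra).
exists (2 * M)%N; rewrite natrM; apply: occ_bounded_of_local_time => // x x1 x2.
exact/ltW/hM.
Qed.

End local_time_unit.

Lemma local_timeN (R : realType) (b : R -> R) (l : R -> R -> R) :
  local_time b l -> local_time (fun s => - b s) (fun t x => l t (- x)).
Proof.
move=> hl; have [cb cl ol] := hl; split.
- by move=> s; apply: cvgN; exact: cb.
- move=> t t0 x; apply: (@continuous_comp _ _ _ -%R (l t)); last exact: cl.
  exact: opp_continuous.
- move=> t f t0 mf f0 [M fM].
  have mfN : measurable_fun setT (fun x : R => f (- x)).
    have mN : measurable_fun setT (-%R : R -> R) by exact: oppr_measurable.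
    exact: (measurableT_comp mf mN).
  rewrite (ol t (fun x => f (- x)) t0 mfN (fun x => f0 _)); last by exists M.
  rewrite (@ge0_integral_scale _ (-1)); last 3 first.
  + by rewrite oppr_eq0 oner_eq0.
  + apply/measurable_EFinP; apply: measurable_funM => //.
    exact: (continuous_measurable_fun (cl t t0)).
  + by move=> x; rewrite lee_fin mulr_ge0// (local_time_ge0 hl).
  rewrite normrN1 mul1e; apply: eq_integral => x _.
  by rewrite !mulN1r opprK.
Qed.

(** * Probability of a small intersection *)

Section setting.
Context (R : realType) (d : measure_display) (T : measurableType d).
Variable P : probability T R.
Notation Omega := (@paths R R `[0, 1]%classic).
Notation leb := (@lebesgue_measure R).

Lemma continuous_slice (f : R * R -> R) (t : R) : 0 <= t ->
  {within [set tx : R * R | 0 <= tx.1], continuous f} ->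
  continuous (fun x => f (t, x)).
Proof.
move=> t0 /subspace_continuousP cf x.
apply: cvg_comp (cf (t, x) t0) => U /nbhs_ballP[e /= e0 he].
apply/nbhs_ballP; exists e => //= y xy; apply: he => //=.
by split => //=; exact: ballxx.
Qed.

Lemma ae_local_time (B : R -> {RV P >-> R}) (L : R -> R -> {RV P >-> R}) :
  standard_brownian_motion B -> is_local_time B L ->
  {ae P, forall w, local_time (fun t => centered B t w) (fun t x => L t x w)}.
Proof.
move=> hB [cL oL]; have [B0 _ _ _] := hB.
have cW : {ae P, forall w, continuous (fun t => centered B t w) /\ B 0 w = 0}.
  by apply: filterS2 (continuous_centered hB) B0 => w.
apply: filterS3 cW cL oL => w [cWw B0w] cLw oLw; split => //.
  by move=> t t0; exact: (continuous_slice t0 cLw).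
move=> t f t0 mf f0 [M fM]; rewrite -(oLw t f t0 mf); last first.
  by exists M => x; rewrite ger0_norm.
apply: eq_integral => s; rewrite inE/= in_itv/= => /andP[s0 _].
by rewrite /centered B0w subr0 ger0_norm.
Qed.

Definition process_events (B : R -> {RV P >-> R}) : set (set T) :=
  [set E | exists t : R, exists A : set R,
     [/\ 0 <= t, measurable A & E = B t @^-1` A] ].

Lemma sigma_process_path (B : R -> {RV P >-> R}) (V : R -> T -> R)
    (C : set (R -> R)) :
  (forall t, measurable_fun setT (V t : g_sigma_algebraType (process_events B) -> R)) ->
  measurable (C : set Omega) -> sigma_process B (path V @^-1` C).
Proof.
move=> mV mC.
exact: (@measurable_preimageT _ _ (g_sigma_algebraType (process_events B)) Omega _ C
  (@measurable_pathT _ (g_sigma_algebraType (process_events B)) _ _ V mV) mC).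
Qed.

(** [centered] evaluates the process at [|t|] and at 0, which are nonnegative, so it stays within
    the sigma-algebra for which independence is assumed. *)
Lemma measurable_centered_process (B : R -> {RV P >-> R}) t :
  measurable_fun setT (centered B t : g_sigma_algebraType (process_events B) -> R).
Proof.
have mB s : 0 <= s ->
    measurable_fun setT (B s : g_sigma_algebraType (process_events B) -> R).
  move=> s0 _ A mA; rewrite setTI; apply: sub_sigma_algebra.
  by exists s, A.
by apply: measurable_funB; apply: mB.
Qed.

Lemma dyadic_le (b : R -> R) (s h c : R) : continuous b -> 0 < h ->
  (forall n i, (i <= 2 ^ n)%N -> b (s + h * (i%:R / (2 ^ n)%:R)) <= c) ->
  forall u, s <= u -> u <= s + h -> b u <= c.
Proof.
move=> cb h0 hb u su ush; rewrite leNgt; apply/negP => cu.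
have e0 : 0 < b u - c by rewrite subr_gt0.
have [r r0 hr] := continuous_dist u cb e0.
have [n hn] := exists_large_nat (divr_gt0 r0 h0).
have N0 : (0 < 2 ^ n)%N by rewrite expn_gt0.
have N0' : 0 < (2 ^ n)%:R :> R by rewrite ltr0n.
have [_ hN] := hn (2 ^ n)%N (ltnW (ltn_expl n (ltnSn 1))).
pose v := (u - s) / h * (2 ^ n)%:R.
have v0 : 0 <= v by rewrite mulr_ge0// divr_ge0 ?subr_ge0// ltW.
have vN : v <= (2 ^ n)%:R.
  by rewrite ler_piMl ?(ltW N0')// ler_pdivrMr// mul1r lerBlDl.
have /andP[i1 i2] := truncn_itv v0.
have iN : (Num.truncn v <= 2 ^ n)%N by rewrite -(ler_nat R) (le_trans i1).
have := hb n _ iN; rewrite leNgt => /negP; apply.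
have : `|u - (s + h * ((Num.truncn v)%:R / (2 ^ n)%:R))| < r.
  have -> : u - (s + h * ((Num.truncn v)%:R / (2 ^ n)%:R)) =
      h * (2 ^ n)%:R^-1 * (v - (Num.truncn v)%:R).
    by rewrite /v; field; rewrite !gt_eqF.
  rewrite normrM gtr0_norm ?mulr_gt0 ?invr_gt0// ger0_norm ?subr_ge0//.
  apply: (@le_lt_trans _ _ (h * (2 ^ n)%:R^-1)).
    rewrite ler_piMr ?mulr_ge0 ?invr_ge0 ?(ltW h0)//.
    by move: i2; rewrite -natr1; move: (Num.truncn v)%:R => q; lra.
  by rewrite mulrC -ltr_pdivlMr.
by move=> /hr; rewrite ltr_norml => /andP[_]; lra.
Qed.

End setting.

(** * Paths that leave early and do not return *)

Section separation.
Context {R : realType}.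
Notation Omega := (@paths R R `[0, 1]%classic).
Notation leb := (@lebesgue_measure R).

(* Up to time h the path stays below sqrt h and ends below -3 sqrt h with an
   occupation density of order sqrt h; afterwards it stays below -2 sqrt h. *)
Definition separated (K h : R) : set (R -> R) :=
  shift 0 h @^-1` (stays_below 1 4 `&` occ_bounded K) `&`
  shift h (1 - h) @^-1` stays_below (Num.sqrt h) 0.

Lemma measurable_separated K h : 0 < h -> h <= 1 ->
  measurable (separated K h : set Omega).
Proof.
move=> h0 h1; apply: measurableI.
  apply: measurable_shift.
  - by rewrite /= in_itv/= lexx ler01.
  - move=> s s0 s1; rewrite /= in_itv/= add0r mulr_ge0 ?(ltW h0)//=.
    by rewrite mulr_ile1// ltW.
  - apply: measurableI; first exact: measurable_stays_below.
    exact: measurable_occ_bounded.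
apply: measurable_shift; last exact: measurable_stays_below.
  by rewrite /= in_itv/= h1 ltW.
move=> s s0 s1; rewrite /= in_itv/=; apply/andP; split.
  by rewrite addr_ge0 ?(ltW h0)// mulr_ge0// subr_ge0.
by rewrite -lerBrDl ler_piMr// subr_ge0.
Qed.

(** Put [a = sqrt h]. The path is at most [a] up to time [h] and at most [-3 * a] at [h]. Later it
    rises by at most [a], as [sqrt (1 - h) <= 1], so it keeps at distance [a] from [[- a, a]], where
    the local time no longer changes. *)
Lemma separated_local_time (b : R -> R) (l : R -> R -> R) (K h : R) :
  local_time b l -> b 0 = 0 -> 0 <= K -> 0 < h -> h < 1 -> separated K h b ->
  (forall x, `|x| <= Num.sqrt h -> l 1 x <= 2 * K * Num.sqrt h) /\
  (forall x, Num.sqrt h < x -> l 1 x = 0).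
Proof.
move=> hl b0 K0 h0 h1 [[[sb1 sb2] ob] [sf _]].
have cb : continuous b by case: hl.
pose a := Num.sqrt h; have a0 : 0 < a by rewrite sqrtr_gt0.
have a'0 : 0 < Num.sqrt (1 - h) by rewrite sqrtr_gt0 subr_gt0.
have a'1 : Num.sqrt (1 - h) <= 1.
  by rewrite -[leRHS]sqrtr1 ler_wsqrtr// gerBl ltW.
have blow u : 0 <= u -> u <= h -> b u <= a.
  move=> u0 uh; apply: (dyadic_le cb h0 (s := 0)) => //; last by rewrite add0r.
  move=> n i ni; have := sb1 n i ni; rewrite /shift b0 subr0 ltr_pdivrMr// mul1r.
  exact: ltW.
have bh : b h <= - 3 * a.
  by move: sb2; rewrite /shift b0 subr0 mulr1 add0r -/a ler_pdivrMr//; lra.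
have bhigh u : h <= u -> u <= 1 -> b u <= - 2 * a.
  move=> hu u1; apply: (@dyadic_le _ b h (1 - h)) => //.
  - by rewrite subr_gt0.
  - move=> n i ni; have := sf n i ni; rewrite /shift ltr_pdivrMr// -/a => bi.
    have : a * Num.sqrt (1 - h) <= a by rewrite ler_piMr// ltW.
    by move: bi bh; lra.
  - by rewrite addrC subrK.
split.
  move=> x; rewrite -/a => xa.
  apply: (@le_trans _ _ (l h x)).
    apply: (@local_time_avoid _ b l hl h 1 x a) => //; [exact: ltW|exact: ltW|].
    move=> r hr r1; have := bhigh r (ltW hr) r1; move: xa; rewrite ler_norml => /andP[xa _] br.
    by rewrite distrC ger0_norm; lra.
  have ya : `|x / a| <= 1.
    by rewrite normrM normfV (gtr0_norm a0) ler_pdivrMr// mul1r.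
  have := @occ_bounded_local_time _ b l hl 0 h (lexx 0) h0 K (x / a) K0 ya ob.
  rewrite -/a b0 !add0r (local_time_start hl) add0r.
  by rewrite mulrC divfK ?gt_eqF.
move=> x; rewrite -/a => ax; apply/le_anti/andP; split; last exact: (local_time_ge0 hl).
rewrite -(local_time_start hl x).
have xa0 : 0 < x - a by rewrite subr_gt0.
apply: (@local_time_avoid _ b l hl 0 1 x (x - a)) => // r r0 r1.
have : b r <= a.
  have [rh|hr] := leP r h; first by apply: blow => //; exact: ltW.
  by have := bhigh r (ltW hr) r1; lra.
by move=> br; rewrite distrC ger0_norm; lra.
Qed.

Variables (mu : probability Omega R) (hmu : wiener mu).

Lemma wiener_shift0 (h : R) (C : set (R -> R)) : 0 < h -> h <= 1 ->
  measurable (C : set Omega) -> pr mu (shift 0 h @^-1` C) = pr mu C.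
Proof.
have [_ mk _ _] := hmu => h0 h1 mC.
have := mk 0 h setT C (lexx 0) h0; rewrite add0r setTI pr_setT mul1r.
by apply.
Qed.

(** Markov property at time [h]. By scaling the first factor does not depend on [h]; the second is
    of order [sqrt h]. *)
Lemma wiener_separated (K h : R) : 0 < h -> h < 1 ->
  pr mu (separated K h) =
  pr mu (stays_below 1 4 `&` occ_bounded K) * pr mu (stays_below (Num.sqrt h) 0).
Proof.
move=> h0 h1; have [_ mk _ _] := hmu.
have mC : measurable (stays_below 1 4 `&` occ_bounded K : set Omega).
  by apply: measurableI; [exact: measurable_stays_below|exact: measurable_occ_bounded].
rewrite /separated mk.
- by rewrite wiener_shift0// ltW.
- exact: ltW.
- by rewrite subr_gt0.
- by rewrite addrC subrK.
- apply: measurable_shift mC.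
    by rewrite /= in_itv/= lexx ltW.
  move=> s s0 s1; rewrite /= in_itv/= add0r mulr_ge0 ?(ltW h0)//=.
  by rewrite ler_piMr// ltW.
- exact: measurable_stays_below.
Qed.

End separation.

(** * Reflected processes, independence and null sets *)

Section signed.
Context (R : realType) (d : measure_display) (T : measurableType d).
Variable P : probability T R.
Notation Omega := (@paths R R `[0, 1]%classic).

Definition flip (e : bool) (x : R) : R := if e then - x else x.

Definition signed (e : bool) (B : R -> {RV P >-> R}) : R -> T -> R :=
  fun t w => flip e (centered B t w).

Lemma brownian_signed e (B : R -> {RV P >-> R}) : standard_brownian_motion B ->
  brownian P (signed e B).
Proof.
move=> hB; have bW := brownian_centered hB; case: e => //.
exact: brownianN bW.
Qed.

Lemma ae_local_time_signed e (B : R -> {RV P >-> R}) (L : R -> R -> {RV P >-> R}) :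
  standard_brownian_motion B -> is_local_time B L ->
  {ae P, forall w, local_time (fun t => signed e B t w) (fun t x => L t (flip e x) w)}.
Proof.
move=> hB hL; apply: filterS (ae_local_time hB hL) => w; case: e => //.
exact: local_timeN.
Qed.

Lemma signed0 e (B : R -> {RV P >-> R}) w : signed e B 0 w = 0.
Proof. by rewrite /signed /centered normr0 subrr; case: e; rewrite /= ?oppr0. Qed.

Lemma sigma_process_signed e (B : R -> {RV P >-> R}) (C : set (R -> R)) :
  measurable (C : set Omega) -> sigma_process B (path (signed e B) @^-1` C).
Proof.
apply: sigma_process_path => t; have mB := @measurable_centered_process _ _ _ _ B t.
by case: e; [exact: (measurable_funN mB)|exact: mB].
Qed.

Lemma pr_independent (B B' : R -> {RV P >-> R}) (E F : set T) :
  standard_brownian_motion B -> standard_brownian_motion B' ->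
  independent_processes B B' -> measurable E -> measurable F ->
  sigma_process B E -> sigma_process B' F -> pr P (E `&` F) = pr P E * pr P F.
Proof.
move=> hB hB' ind mE mF sE sF.
by rewrite /pr ind// fineM// fin_num_measure.
Qed.

Lemma measurable_path_signed e (B : R -> {RV P >-> R}) (C : set (R -> R)) :
  standard_brownian_motion B -> measurable (C : set Omega) ->
  measurable (path (signed e B) @^-1` C).
Proof.
move=> hB; have [mW _ _ _] := brownian_signed e hB.
exact: (measurable_preimageT (measurable_pathT (D := `[0, 1]%classic) mW)).
Qed.

Lemma ae_null_set (Q : T -> Prop) : {ae P, forall w, Q w} ->
  exists N : set T, [/\ measurable N, pr P N = 0 & forall w, ~ N w -> Q w].
Proof.
move=> [N [mN N0 sN]]; exists N; split => //; first by rewrite /pr N0.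
by move=> w nw; apply: contrapT => nq; apply: nw; exact: sN.
Qed.

Lemma pr_setD_null (A N : set T) : measurable A -> measurable N -> pr P N = 0 ->
  pr P (A `\` N) = pr P A.
Proof.
move=> mA mN N0; rewrite [RHS](pr_setDI P mA mN).
suff -> : pr P (A `&` N) = 0 by rewrite addr0.
apply/le_anti; rewrite pr_ge0 -{1}N0 andbT; apply: le_pr => //.
exact: measurableI.
Qed.

(** Turns constants that depend on the path into deterministic ones that work with positive
    probability. *)
Lemma pr_pos_of_cover (A N : set T) (F : nat -> set T) :
  measurable A -> measurable N -> (forall n, measurable (F n)) ->
  pr P N = 0 -> 0 < pr P A -> A `\` N `<=` \bigcup_n F n -> exists n, 0 < pr P (F n).
Proof.
move=> mA mN mF N0 A0 AF; apply: contrapT => /forallNP h.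
have F0 n : pr P (F n) = 0.
  by apply/le_anti; rewrite pr_ge0 andbT leNgt; apply/negP; exact: h.
have : pr P (A `\` N) <= pr P (\bigcup_n F n).
  by apply: le_pr AF; [exact: measurableD|exact: bigcupT_measurable].
by rewrite pr_setD_null// pr_bigcup0// leNgt A0.
Qed.

End signed.

Section small_intersection.
Context (R : realType) (d : measure_display) (T : measurableType d).
Variables (P : probability T R) (B B' : R -> {RV P >-> R}).
Variables (L L' : R -> R -> {RV P >-> R}).
Hypotheses (hB : standard_brownian_motion B) (hB' : standard_brownian_motion B').
Hypothesis hBB' : independent_processes B B'.
Hypotheses (hL : is_local_time B L) (hL' : is_local_time B' L').
Notation Omega := (@paths R R `[0, 1]%classic).
Notation leb := (@lebesgue_measure R).
Let X := mutual_intersection_local_time L L'.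

(** The product vanishes outside [[- a, a]], on the right because of [l] and on the left because of
    [l']. *)
Lemma intersection_le (l l' : R -> R) (a M : R) : 0 <= a -> 0 <= M ->
  measurable_fun setT l -> measurable_fun setT l' ->
  (forall x, 0 <= l x) -> (forall x, 0 <= l' x) ->
  (forall x, `|x| <= a -> l x <= M) -> (forall x, `|x| <= a -> l' x <= M) ->
  (forall x, a < x -> l x = 0) -> (forall x, x < - a -> l' x = 0) ->
  (\int[leb]_x (l x * l' x)%:E <= (2 * a * M ^+ 2)%:E)%E.
Proof.
move=> a0 M0 ml ml' l0 l'0 lM l'M lz l'z.
have mll : measurable_fun setT (fun x => (l x * l' x)%:E).
  by apply/measurable_EFinP; exact: measurable_funM.
apply: (@le_trans _ _ (\int[leb]_(x in `[(- a)%R, a]) (M ^+ 2)%:E)%E); last first.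
  rewrite integral_cst//= lebesgue_measure_itv/= lte_fin.
  case: ifP => _; last by rewrite mule0 lee_fin mulr_ge0 ?mulr_ge0 ?exprn_ge0.
  rewrite -EFinD -EFinM lee_fin le_eqVlt; apply/orP; left; apply/eqP; ring.
rewrite [leRHS]integral_mkcond; apply: ge0_le_integral => //.
- by move=> x _; rewrite lee_fin mulr_ge0.
- by apply/(measurable_restrictT _ _).1 => //; exact: measurable_cst.
- move=> x _; rewrite patchE; case: ifPn.
    rewrite inE/= in_itv/= -ler_norml => xa; rewrite lee_fin expr2.
    by rewrite ler_pM// ?lM ?l'M.
  rewrite notin_setE/= in_itv/= => /negP; rewrite negb_and -!ltNge => /orP[xa|xa].
    by rewrite (l'z _ xa) mulr0.
  by rewrite (lz _ xa) mul0r.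
Qed.

Lemma intersection_small : exists c K : R, [/\ 0 < c, 0 < K &
  forall a : R, 0 < a -> a < 1 -> exists E : set T, [/\ measurable E,
    c * a ^+ 2 <= pr P E & forall w, E w -> (0 <= X w <= (K * a ^+ 3)%:E)%E] ].
Proof.
have bW := brownian_signed false hB.
have cW : {ae P, forall w, continuous (fun t => signed false B t w)}.
  exact: continuous_centered.
have [mu [hmu law]] := wiener_law bW cW.
have good : {ae P, forall w,
    local_time (fun t => signed false B t w) (fun t x => L t (flip false x) w) /\
    local_time (fun t => signed true B' t w) (fun t x => L' t (flip true x) w)}.
  by apply: filterS2 (ae_local_time_signed false hB hL) (ae_local_time_signed true hB' hL') => w.
have [N [mN N0 gN]] := ae_null_set good.
have [K K0] : exists K : nat, 0 < pr mu (stays_below 1 4 `&` occ_bounded K%:R).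
  pose F n := path (signed false B) @^-1` (stays_below 1 4 `&` occ_bounded n%:R).
  have mC n : measurable (stays_below 1 4 `&` occ_bounded n%:R : set Omega).
    by apply: measurableI; [exact: measurable_stays_below|exact: measurable_occ_bounded].
  have mS := @measurable_stays_below R 1 4.
  have [||||||n hn] := @pr_pos_of_cover _ _ _ P
      (path (signed false B) @^-1` stays_below 1 4) N F.
  - exact: measurable_path_signed.
  - by [].
  - by move=> n; exact: measurable_path_signed.
  - exact: N0.
  - rewrite (law _ bW _ mS) (lt_le_trans _ (wiener_stays_below hmu ler01 _))//.
    have [c c0 hc] := @normal_prob_itv_ge R 5.
    have hc' : ((c * (4 + 1 - (4 - 1)))%:E <= normal_prob 0 1 `[(4 - 1)%R, (4 + 1)%R[)%E.
      by apply: hc; lra.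
    rewrite -lte_fin -prE// (lt_le_trans _ hc')// lte_fin mulr_gt0//; lra.
  - move=> w [sw /gN[lw _]].
    have [n hn] := exists_occ_bounded lw (signed0 false B w).
    by exists n.
  - by exists n; rewrite -(law _ bW _ (mC n)).
have [c1 c10 hc1] := @normal_prob_itv_ge R 1.
pose p0 := pr mu (stays_below 1 4 `&` occ_bounded K%:R).
(* The intersection is at most [2 * a * (2 * K * a) ^+ 2], that is [8 * K ^+ 2 * a ^+ 3]; the added
   1 keeps the constant positive when [K] is 0. *)
exists (p0 ^+ 2 * (c1 * 2) ^+ 2), (8 * K%:R ^+ 2 + 1); split.
- by rewrite mulr_gt0 ?exprn_gt0 ?mulr_gt0.
- by rewrite ltr_wpDl// mulr_ge0// exprn_ge0.
move=> a a0 a1; pose h := a ^+ 2.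
have h0 : 0 < h by rewrite exprn_gt0.
have h1 : h < 1 by rewrite expr_lt1// ltW.
have sh : Num.sqrt h = a by rewrite sqrtr_sqr gtr0_norm.
have mS := @measurable_separated R K%:R h h0 (ltW h1).
(* [B'] enters with the opposite sign, so that the two paths leave on opposite sides. *)
pose E0 := path (signed false B) @^-1` separated K%:R h `&`
           path (signed true B') @^-1` separated K%:R h.
have m1 := measurable_path_signed false hB mS.
have m2 := measurable_path_signed true hB' mS.
exists (E0 `\` N); split.
- by apply: measurableD => //; exact: measurableI.
- rewrite pr_setD_null//; last exact: measurableI.
  rewrite (pr_independent hB hB' hBB' m1 m2); last 2 first.
  + exact: sigma_process_signed.
  + exact: sigma_process_signed.
  rewrite (law _ bW _ mS) (law _ (brownian_signed true hB') _ mS).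
  rewrite (wiener_separated hmu)// sh -/p0.
  have pa : c1 * 2 * a <= pr mu (stays_below a 0).
    apply: le_trans (wiener_stays_below hmu (ltW a0) (lexx 0)).
    have hc' : ((c1 * (0 + a - (0 - a)))%:E <= normal_prob 0 1 `[(0 - a)%R, (0 + a)%R[)%E.
      by apply: hc1; lra.
    rewrite -lee_fin -prE//= (le_trans _ hc')// lee_fin; lra.
  have -> : p0 ^+ 2 * (c1 * 2) ^+ 2 * a ^+ 2 = (p0 * (c1 * 2 * a)) * (p0 * (c1 * 2 * a)).
    by ring.
  have pc0 : 0 <= p0 * (c1 * 2 * a) by rewrite !mulr_ge0 ?(ltW K0) ?(ltW c10) ?(ltW a0).
  by apply: ler_pM => //; rewrite ler_wpM2l// ltW.
- move=> w [[s1 s2] /gN[l1 l2]].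
  have K0' : 0 <= K%:R :> R by [].
  have [u1 z1] := separated_local_time l1 (signed0 false B w) K0' h0 h1 s1.
  have [u2 z2] := separated_local_time l2 (signed0 true B' w) K0' h0 h1 s2.
  rewrite sh in u1 z1 u2 z2.
  have l1_ge0 x : 0 <= L 1 x w by exact: (local_time_ge0 l1).
  have l2_ge0 x : 0 <= L' 1 x w.
    by have := @local_time_ge0 _ _ _ l2 1 (- x) ler01; rewrite /flip opprK.
  apply/andP; split; first by apply: integral_ge0 => x _; rewrite lee_fin mulr_ge0.
  apply: (@le_trans _ _ (2 * a * (2 * K%:R * a) ^+ 2)%:E); last first.
    rewrite lee_fin; have -> : 2 * a * (2 * K%:R * a) ^+ 2 = 8 * K%:R ^+ 2 * a ^+ 3 by ring.
    by rewrite ler_pM2r ?exprn_gt0// lerDl.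
  apply: intersection_le => //.
  + exact: ltW.
  + by rewrite !mulr_ge0// ltW.
  + have [_ cl _] := l1; exact: (continuous_measurable_fun (cl 1 ler01)).
  + have l2' := local_timeN l2; have [_ cl _] := l2'.
    have := continuous_measurable_fun (cl 1 ler01).
    by under eq_fun do rewrite /flip opprK.
  + move=> x xa; have := u2 (- x); rewrite normrN /flip opprK; exact.
  + move=> x xa; have := z2 (- x); rewrite /flip opprK ltrNr; exact.
Qed.

End small_intersection.

(** * Probability of a large intersection *)

Section no_common.
Context d (T : measurableType d) (R : realType) (P : probability T R).
Variables (M : nat) (M0 : (0 < M)%N).
Let N := (M * M)%N.
Variables (G G' : nat -> set T) (H H' : set T) (beta : R).
Hypotheses (mG : forall k, measurable (G k)) (mG' : forall k, measurable (G' k)).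
Hypotheses (mH : measurable H) (mH' : measurable H').

Definition avoids (G : nat -> set T) (S : pred nat) : set T :=
  [set x | forall k, (k < N)%N /\ S k -> (~` G k) x].

(** Records the whole outcome of [G]. Outcomes that differ below [N] are disjoint events, so one may
    sum over them. *)
Definition trace_is (G : nat -> set T) (S : pred nat) : set T :=
  [set x | forall k, (k < N)%N -> (if S k then G k else ~` G k) x].

Lemma measurable_avoids (F : nat -> set T) S : (forall k, measurable (F k)) ->
  measurable (avoids F S).
Proof. by move=> mF; apply: measurable_forall_imp => k _; exact: measurableC. Qed.

Lemma measurable_trace_is (F : nat -> set T) S : (forall k, measurable (F k)) ->
  measurable (trace_is F S).
Proof.
by move=> mF; apply: measurable_forall_imp => k _; case: ifP => _ //; exact: measurableC.
Qed.

Hypothesis beta0 : 0 <= beta.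
Hypothesis hG : forall S : pred nat, (M <= count S (iota 0 N))%N ->
  pr P (H `&` avoids G S) <= beta.
Hypothesis hG' : forall S : pred nat, (M <= count S (iota 0 N))%N ->
  pr P (H' `&` avoids G' S) <= beta.
Hypothesis indep : forall S : pred nat,
  pr P ((H `&` avoids G S) `&` trace_is G' S) =
  pr P (H `&` avoids G S) * pr P (trace_is G' S).

Let group (g : nat) : pred nat := [pred k | (k %/ M)%N == g].

Let count_of_groups (S : pred nat) :
  (forall g, (g < M)%N -> exists k, [/\ (k < N)%N, (k %/ M)%N = g & S k]) ->
  (M <= count S (iota 0 N))%N.
Proof.
move=> h.
have hc (g : nat) : exists k, (g < M)%N -> [/\ (k < N)%N, (k %/ M)%N = g & S k].
  have [gM|gM] := boolP (g < M)%N; last by exists 0%N.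
  by have [k hk] := h g gM; exists k.
have [c hc'] := choice hc.
rewrite -[X in (X <= _)%N](size_iota 0) -(size_map c) -size_filter.
apply: uniq_leq_size.
  rewrite map_inj_in_uniq ?iota_uniq// => i j.
  rewrite !mem_iota/= !add0n => iM jM cij.
  by have [_ <- _] := hc' i iM; have [_ <- _] := hc' j jM; rewrite cij.
move=> _ /mapP[g + ->]; rewrite mem_iota/= add0n => gM.
by have [cN _ Sc] := hc' g gM; rewrite mem_filter Sc mem_iota.
Qed.

Let count_group g : (g < M)%N -> (M <= count (group g) (iota 0 N))%N.
Proof.
move=> gM.
rewrite -[X in (X <= _)%N](size_iota (g * M)) -size_filter.
apply: uniq_leq_size; first exact: iota_uniq.
move=> k; rewrite mem_iota => /andP[k1 k2].
rewrite mem_filter mem_iota/= add0n; apply/andP; split.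
  apply/eqP/eqP; rewrite eqn_leq leq_divRL// k1 andbT -ltnS ltn_divLR//.
  by rewrite mulSn addnC.
by rewrite (leq_trans k2)// addnC -mulSn leq_mul2r gM orbT.
Qed.

Let pred_of (S : {set 'I_N}) : pred nat := fun k => k \in [seq val i | i <- enum S].

Let pred_ofE (S : {set 'I_N}) (i : 'I_N) : pred_of S i = (i \in S).
Proof. by rewrite /pred_of mem_map ?mem_enum//; exact: val_inj. Qed.

(* Split the M * M indices into M groups of size M. If no index is common, then
   either G' fails on a whole group, or G' succeeds at one index of each group at
   least, and G fails at these M indices. *)
Lemma pr_no_common :
  pr P (H `&` H' `&` [set x | forall k, (k < N)%N -> (~` (G k `&` G' k)) x])
  <= M.+1%:R * beta.
Proof.
have mNC : measurable [set x | forall k, (k < N)%N -> (~` (G k `&` G' k)) x].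
  by apply: measurable_forall_imp => k _; apply: measurableC; exact: measurableI.
pose U1 := [set x | exists2 g, (g < M)%N & (H' `&` avoids G' (group g)) x].
have mg g : measurable (H' `&` avoids G' (group g)).
  by apply: measurableI => //; exact: measurable_avoids.
have mU1 : measurable U1 by exact: measurable_exists_and.
pose V (S : {set 'I_N}) := (H `&` avoids G (pred_of S)) `&` trace_is G' (pred_of S).
have mV S : measurable (V S).
  apply: measurableI; last exact: measurable_trace_is.
  by apply: measurableI => //; exact: measurable_avoids.
pose SS := [seq S <- index_enum {set 'I_N} | (M <= count (pred_of S) (iota 0 N))%N].
set A := (X in pr P X).
have mA : measurable A by apply: measurableI => //; exact: measurableI.
rewrite (pr_setDI P mA mU1) -natr1 mulrDl mul1r addrC lerD//.
  apply: (@le_trans _ _ (\sum_(g <- iota 0 M) pr P (H' `&` avoids G' (group g)))).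
    apply: pr_le_cover => //; first exact: measurableI.
    by move=> x [_ [g gM hx]]; exists g => //; rewrite mem_iota/= add0n.
  have -> : M%:R * beta = \sum_(g <- iota 0 M) beta.
    by rewrite big_const_seq count_predT size_iota iter_addr_0 mulr_natl.
  rewrite big_seq [leRHS]big_seq; apply: ler_sum => g.
  by rewrite mem_iota/= add0n => gM; exact/hG'/count_group.
apply: (@le_trans _ _ (\sum_(S <- SS) pr P (V S))).
  apply: pr_le_cover; [exact: measurableD|by move=> S _; exact: mV|].
  move=> x [[[Hx H'x] nc] nU].
  pose S : {set 'I_N} := finset (fun i : 'I_N => `[< G' i x >]).
  have SE k : (k < N)%N -> pred_of S k = `[< G' k x >].
    by move=> kN; rewrite -[k]/(val (Ordinal kN)) pred_ofE inE.
  exists S.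
    rewrite mem_filter mem_index_enum andbT; apply: count_of_groups => g gM.
    apply: contrapT => hn; apply: nU; exists g => //; split => // k [kN /eqP kg] Gk.
    by apply: hn; exists k; split => //; rewrite SE//; apply/asboolP.
  split; last first.
    by move=> k kN; rewrite SE//; case: asboolP.
  split => // k [kN]; rewrite SE// => /asboolP G'k Gk.
  by apply: (nc k kN); split.
(* Given the outcome [S] of [G'], independence bounds by [beta] the probability that [G] fails on
   [S]. The probabilities of the outcomes add up to at most 1, so their number does not matter. *)
apply: (@le_trans _ _ (\sum_(S <- SS) beta * pr P (trace_is G' (pred_of S)))).
  rewrite big_seq [leRHS]big_seq; apply: ler_sum => S.
  rewrite mem_filter => /andP[cS _]; rewrite /V indep ler_wpM2r ?pr_ge0//.
  exact: hG.
rewrite -mulr_sumr ler_piMr//.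
rewrite -(pr_setT P); apply: sum_pr_le_disjoint => //.
- by rewrite filter_uniq// index_enum_uniq.
- by move=> S _; exact: measurable_trace_is.
- move=> S S' x _ _ hS hS'; apply/setP => i.
  have := hS i (ltn_ord i); have := hS' i (ltn_ord i); rewrite !pred_ofE.
  by case: ifP; case: ifP.
Qed.

End no_common.

Section charged_paths.
Context {R : realType}.
Notation Omega := (@paths R R `[0, 1]%classic).
Notation leb := (@lebesgue_measure R).

(* Natural parameters, so that countably many such sets cover almost all paths. *)
Definition charged (N j1 j2 lam : nat) : set (R -> R) :=
  occ_charged ((j1%:R - j2%:R) / N%:R) N%:R^-1 `&` stays_below lam%:R 0.

Lemma measurable_charged N j1 j2 lam : measurable (charged N j1 j2 lam : set Omega).
Proof.
by apply: measurableI; [exact: measurable_occ_charged|exact: measurable_stays_below].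
Qed.

Lemma integral_mul_ge (l l' : R -> R) (u v c : R) : 0 <= c -> u <= v ->
  measurable_fun setT l -> measurable_fun setT l' ->
  (forall x, 0 <= l x) -> (forall x, 0 <= l' x) ->
  (forall x, u < x -> x < v -> c <= l x) ->
  (forall x, u < x -> x < v -> c <= l' x) ->
  ((c ^+ 2 * (v - u))%:E <= \int[leb]_x (l x * l' x)%:E)%E.
Proof.
move=> c0 uv ml ml' l0 l'0 lc l'c.
have mll : measurable_fun setT (fun x => (l x * l' x)%:E).
  by apply/measurable_EFinP; exact: measurable_funM.
apply: (@le_trans _ _ (\int[leb]_(x in `]u, v[) (c ^+ 2)%:E)%E).
  rewrite integral_cst//= lebesgue_measure_itv/= lte_fin.
  move: uv; rewrite le_eqVlt => /predU1P[->|uv].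
    by rewrite subrr mulr0 ltxx mule0.
  by rewrite uv -EFinD -EFinM.
rewrite integral_mkcond; apply: ge0_le_integral => //.
- move=> x _; rewrite patchE; case: ifPn => // _; first by rewrite lee_fin exprn_ge0.
- by apply/(measurable_restrictT _ _).1 => //; exact: measurable_cst.
- move=> x _; rewrite patchE; case: ifPn; last by rewrite lee_fin mulr_ge0.
  rewrite inE/= in_itv/= => /andP[ux xv]; rewrite lee_fin expr2.
  by rewrite ler_pM// ?lc ?l'c.
Qed.

(** The passage value exceeds the level by at most [a * delta], the bound on jumps. Whatever this
    overshoot, the charged interval of radius [a * delta] around [b t + a * y0] contains the one
    from [lev + a * y0] to [lev + a * (y0 + delta)]. The latter depends on the level only, hence is
    common to both paths. *)
Lemma lucky_local_time (b : R -> R) (l : R -> R -> R) (r q m N j1 j2 lam k : nat) (Lam : R) :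
  (0 < r)%N -> (0 < q)%N -> (0 < N)%N -> (m + r <= r * q)%N -> 0 < Lam ->
  local_time b l -> b 0 = 0 ->
  let a := Num.sqrt q%:R^-1 in
  let delta := N%:R^-1 in
  let y0 := (j1%:R - j2%:R) / N%:R in
  let lev := k.+1%:R * Lam in
  ~ jumps (r * q) (a * delta) b ->
  lucky r q m (charged N j1 j2 lam) Lam k b ->
  forall x, lev + a * y0 < x -> x < lev + a * (y0 + delta) ->
  delta * a / 2 <= l 1 x.
Proof.
move=> r0 q0 N0 mrq Lam0 hl b0 a delta y0 lev nj [i im [[ki hi] [oc _]]] x x1 x2.
set n := (r * q)%N in nj ki hi.
pose t : R := i%:R / n%:R.
have h0 : 0 < q%:R^-1 :> R by rewrite invr_gt0 ltr0n.
have a0 : 0 < a by rewrite sqrtr_gt0.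
have d0 : 0 < delta by rewrite invr_gt0 ltr0n.
have t0 : 0 <= t by rewrite divr_ge0.
have th : t + q%:R^-1 <= 1.
  have -> : t + q%:R^-1 = (i + r)%:R / n%:R.
    rewrite /t /n natrM natrD; field.
    by rewrite !pnatr_eq0 -!lt0n r0 q0.
  by have /andP[] := @grid_itv R n (i + r) (leq_trans (leq_add im (leqnn r)) mrq).
have bt : b t <= lev + a * delta.
  rewrite /t; case: i {oc t t0 th} im ki hi => [|i] im ki hi.
    by rewrite mul0r b0 addr_ge0 ?mulr_ge0// ltW.
  have := hi i (ltnSn i); rewrite -/lev.
  have ni : (i < n)%N by rewrite (leq_trans im)// (leq_trans _ mrq)// leq_addr.
  have : b (i.+1%:R / n%:R) - b (i%:R / n%:R) <= a * delta.
    by rewrite leNgt; apply/negP => hh; apply: nj; exists i.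
  lra.
have kt : lev <= b t by exact: ki.
pose y := (x - b t) / a.
have xE : b t + a * y = x by rewrite /y mulrC divfK ?gt_eqF// addrC subrK.
have yy : `|y - y0| < delta.
  have -> : y - y0 = (x - b t - a * y0) / a by rewrite /y; field; rewrite gt_eqF.
  rewrite normrM normfV (gtr0_norm a0) ltr_pdivrMr// ltr_norml (mulrC delta).
  by apply/andP; split; move: x1 x2 bt kt; rewrite mulrDr;
    move: (a * y0) (a * delta) (b t) => u v z; lra.
have := @occ_charged_local_time _ b l hl t q%:R^-1 t0 h0 y0 delta y d0 yy oc.
rewrite -/a xE => ge1.
have lt0 : 0 <= l t x by exact: (local_time_ge0 hl).
have le1 : l (t + q%:R^-1) x <= l 1 x.
  by apply: (local_time_nondecreasing hl) => //; rewrite addr_ge0// ltW.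
by apply: le_trans le1; apply: le_trans ge1; rewrite lerDr.
Qed.

End charged_paths.

Section large_intersection.
Context (R : realType) (d : measure_display) (T : measurableType d).
Variables (P : probability T R) (B B' : R -> {RV P >-> R}).
Variables (L L' : R -> R -> {RV P >-> R}).
Hypotheses (hB : standard_brownian_motion B) (hB' : standard_brownian_motion B').
Hypothesis hBB' : independent_processes B B'.
Hypotheses (hL : is_local_time B L) (hL' : is_local_time B' L').
Notation Omega := (@paths R R `[0, 1]%classic).
Variables (mu : probability Omega R) (hmu : wiener mu).
Hypothesis law : forall W : R -> T -> R, brownian P W ->
  forall C : set (R -> R), measurable (C : set Omega) ->
  pr P (path W @^-1` C) = pr mu C.

(** Almost every path is charged for some naturals [N], [j1], [j2] and [lam]; [pickle] enumerates
    the quadruples, and [pr_pos_of_cover] selects one. *)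
Lemma exists_charged : exists N j1 j2 lam : nat,
  (0 < N)%N /\ 0 < pr mu (charged N j1 j2 lam).
Proof.
have bW := brownian_signed false hB.
have [Z [mZ Z0 gZ]] := ae_null_set (ae_local_time_signed false hB hL).
pose C n : set (R -> R) :=
  if unpickle n is Some (N, j1, j2, lam) then
    if (0 < N)%N then charged N j1 j2 lam else set0
  else set0.
have mC n : measurable (C n : set Omega).
  rewrite /C; case: unpickle => [[[[N j1] j2] lam]|]; last exact: measurable0.
  by case: ifP => _; [exact: measurable_charged|exact: measurable0].
have [||||||n] := @pr_pos_of_cover _ _ _ P setT Z
    (fun n => path (signed false B) @^-1` C n).
- exact: measurableT.
- exact: mZ.
- by move=> n; exact: measurable_path_signed.
- exact: Z0.
- by rewrite pr_setT.
- move=> w [_ /gZ lw].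
  have [N [j1 [j2 [N0 oc]]]] := exists_occ_charged lw (signed0 false B w).
  have cb : continuous (fun t => signed false B t w) by case: lw.
  have [lam hlam] := continuous_bounded_segment cb (@ler01 R).
  exists (pickle (N, j1, j2, lam)) => //=.
  rewrite /preimage/= /C pickleK N0; split => //; split.
    by move=> n i ni; have /andP[? ?] := @grid_itv R _ _ ni; exact: hlam.
  by rewrite subr0 ltW// hlam// ler01.
- rewrite (law bW (mC n)) /C; case: unpickle => [[[[N j1] j2] lam]|]; last first.
    by rewrite pr_set0 ltxx.
  case: ifP => [N0 ?|_]; last by rewrite pr_set0 ltxx.
  by exists N, j1, j2, lam.
Qed.

Definition attains (n m : nat) (c : R) : set (R -> R) :=
  [set x | exists2 i, (i <= m)%N & c <= x (i%:R / n%:R)].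

Lemma measurable_attains n m c : (m <= n)%N -> measurable (attains n m c : set Omega).
Proof.
move=> mn; apply: measurable_exists_and => j jm.
exact: (measurable_set_ge c (measurable_ev (grid_itv (leq_trans jm mn)))).
Qed.

(** [pr_no_lucky] for each path feeds [pr_no_common] with [M * M] levels. Both paths have to attain
    the level of index [M * M], just above those tested, so that all the blocks are decided. [e]
    selects the side. *)
Lemma pr_no_common_lucky (e : bool) (M r q m : nat) (D : set (R -> R)) (lam eta Lam : R) :
  (0 < M)%N -> (0 < r)%N -> (0 < q)%N -> (m + r <= r * q)%N ->
  measurable (D : set Omega) -> 0 < Lam ->
  (forall x, D x -> forall j, (j <= r)%N -> x (j%:R / r%:R) < lam) ->
  lam * Num.sqrt q%:R^-1 + eta <= Lam ->
  pr P (path (signed e B) @^-1` attains (r * q) m ((M * M).+1%:R * Lam) `&`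
        path (signed e B') @^-1` attains (r * q) m ((M * M).+1%:R * Lam) `&`
        [set w | forall k, (k < M * M)%N ->
          (~` (path (signed e B) @^-1` lucky r q m D Lam k `&`
               path (signed e B') @^-1` lucky r q m D Lam k)) w])
  <= M.+1%:R * ((1 - pr mu D) ^+ M + (M * M)%:R * pr mu (jumps (r * q) eta)).
Proof.
move=> M0 r0 q0 mrq mD Lam0 D_lam Lam_ge.
have bW := brownian_signed e hB; have bW' := brownian_signed e hB'.
have mn : (m <= r * q)%N by rewrite (leq_trans _ mrq)// leq_addr.
have mA := measurable_attains ((M * M).+1%:R * Lam) mn.
set A := attains _ _ _ in mA *.
have mG k : measurable (lucky r q m D Lam k : set Omega) by exact: measurable_lucky.
have rho0 : 0 <= 1 - pr mu D by rewrite subr_ge0 pr_le1.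
have rho1 : 1 - pr mu D <= 1 by rewrite gerBl pr_ge0.
have mC (S : pred nat) : measurable (A `&` [set x | forall k, (k < M * M)%N /\ S k ->
    (~` lucky r q m D Lam k) x] : set Omega).
  apply: measurableI => //.
  by apply: measurable_forall_imp => k _; apply: measurableC; exact: mG.
have mC' (S : pred nat) : measurable ([set x | forall k, (k < M * M)%N ->
    (if S k then lucky r q m D Lam k else ~` lucky r q m D Lam k) x] : set Omega).
  apply: measurable_forall_imp => k _; case: ifP => _; first exact: mG.
  by apply: measurableC; exact: mG.
have bnd (W : R -> T -> R) (S : pred nat) : brownian P W ->
    (M <= count S (iota 0 (M * M)))%N ->
    pr P (path W @^-1` (A `&` [set x | forall k, (k < M * M)%N /\ S k ->
      (~` lucky r q m D Lam k) x])) <=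
    (1 - pr mu D) ^+ M + (M * M)%:R * pr mu (jumps (r * q) eta).
  move=> bV cS; rewrite (law bV (mC S)).
  rewrite (le_trans (pr_no_lucky hmu r0 q0 mrq mD Lam0 D_lam Lam_ge S (M * M)))//.
  by rewrite lerD2r ler_wiXn2l.
apply: pr_no_common => //.
- by move=> k; exact: measurable_path_signed.
- by move=> k; exact: measurable_path_signed.
- exact: measurable_path_signed.
- exact: measurable_path_signed.
- by rewrite addr_ge0 ?exprn_ge0// mulr_ge0// pr_ge0.
- by move=> S cS; exact: (bnd _ S bW cS).
- by move=> S cS; exact: (bnd _ S bW' cS).
- move=> S; pose C' := [set x | forall k, (k < M * M)%N ->
    (if S k then lucky r q m D Lam k else ~` lucky r q m D Lam k) x].
  have -> : avoids M (fun k => path (signed e B) @^-1` lucky r q m D Lam k) S =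
     path (signed e B) @^-1` [set x | forall k, (k < M * M)%N /\ S k ->
    (~` lucky r q m D Lam k) x] by [].
  rewrite -preimage_setI.
  have -> : trace_is M (fun k => path (signed e B') @^-1` lucky r q m D Lam k) S =
     path (signed e B') @^-1` C'.
    by apply/seteqP; split => w h k kM; have := h k kM; rewrite /C'; case: ifP.
  apply: (pr_independent hB hB' hBB').
  + exact: (measurable_path_signed e hB (mC S)).
  + exact: (measurable_path_signed e hB' (mC' S)).
  + by apply: sigma_process_signed; exact: mC.
  + by apply: sigma_process_signed; exact: mC'.
Qed.

(* Heights are required to be attained before time 1/2, so that the blocks started
   at the passage times end before time 1. *)
Lemma wiener_le_half (A C : set (R -> R)) :
  measurable (A : set Omega) -> measurable (C : set Omega) ->
  (forall x, x 0 = 0 -> A x -> C (shift 0 2^-1 x)) -> pr mu A <= pr mu C.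
Proof.
move=> mA mC AC; have [mu0 _ _ _] := hmu.
have half0 : 0 < 2^-1 :> R by rewrite invr_gt0.
have half1 : 2^-1 <= 1 :> R by rewrite invf_le1// ler1n.
rewrite -(wiener_shift0 hmu half0 half1 mC).
have m0 : measurable ([set x | x 0 <> 0] : set Omega).
  rewrite (_ : [set x | _] = (fun x : Omega => x 0) @^-1` (~` [set 0]))//.
  apply: measurable_preimageT => //; last exact: measurableC.
  by apply: measurable_ev; rewrite lexx ler01.
have mS : measurable (shift 0 2^-1 @^-1` C : set Omega).
  apply: measurable_shift => //.
    by rewrite /= in_itv/= lexx ler01.
  move=> s s0 s1; rewrite /= in_itv/= add0r mulr_ge0 ?(ltW half0)//=.
  by rewrite mulr_ile1// ltW.
apply: (@le_trans _ _ (pr mu ([set x | x 0 <> 0] `|` shift 0 2^-1 @^-1` C))).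
  apply: le_pr => //; first exact: measurableU.
  by move=> x Ax; have [x0|x0] := pselect (x 0 = 0); [right; exact: AC|left].
by rewrite (le_trans (pr_setU_le _ m0 mS))// mu0 add0r.
Qed.

(** Rescaling the first half of the path divides it by [sqrt (1 / 2) >= 1 / 2], which at most
    doubles a height. *)
Lemma shift_half_lt (x : R -> R) (s c : R) : x 0 = 0 -> 0 < c -> x (2^-1 * s) < c ->
  shift 0 2^-1 x s < 2 * c.
Proof.
move=> x0 c0 xc; rewrite /shift x0 subr0 add0r.
have half0 : 0 < 2^-1 :> R by rewrite invr_gt0.
have hs : 2^-1 <= Num.sqrt 2^-1 :> R.
  have : 2^-1 * 2^-1 <= 2^-1 :> R by rewrite ler_piMr ?(ltW half0)// invf_le1// ler1n.
  by rewrite -(ler_sqrt _ (ltW half0)) -expr2 sqrtr_sqr gtr0_norm.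
rewrite ltr_pdivrMr ?sqrtr_gt0// (lt_le_trans xc)//.
by rewrite mulrC mulrA ler_peMl ?(ltW c0)// -ler_pdivrMr// div1r.
Qed.

Lemma wiener_not_attains (m : nat) (c eta : R) : (0 < m)%N -> 0 < c -> 0 < eta ->
  pr mu (~` attains (2 * m) m c) <= 2 * (2 * c + eta) + 2 * pr mu (jumps m eta).
Proof.
move=> m0 c0 eta0.
have mm : (m <= 2 * m)%N by rewrite leq_pmull.
have c20 : 0 < 2 * c by rewrite mulr_gt0.
rewrite (le_trans _ (wiener_not_reaches hmu m0 c20 eta0))//.
apply: wiener_le_half.
- by apply: measurableC; exact: measurable_attains.
- by apply: measurableC; exact: measurable_reaches.
- move=> x x0 nA [i im]; apply/negP; rewrite -ltNge; apply: shift_half_lt => //.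
  have -> : 2^-1 * (i%:R / m%:R) = i%:R / (2 * m)%:R :> R.
    by rewrite natrM; field; rewrite pnatr_eq0 -lt0n.
  by rewrite ltNge; apply/negP => hi; apply: nA; exists i.
Qed.

Lemma measurable_attains2 n m c : (m <= n)%N ->
  measurable ([set x | (~` attains n m c) x /\
    (~` attains n m c) (fun t => - x t)] : set Omega).
Proof.
move=> mn; apply: measurableI; first by apply: measurableC; exact: measurable_attains.
apply: (@measurableC _ Omega [set x | exists2 i, (i <= m)%N & c <= - x (i%:R / n%:R)]).
apply: measurable_exists_and => j jm.
apply: (measurable_set_ge c (f := fun x : Omega => - x (j%:R / n%:R))).
by apply: (measurable_funN (measurable_ev _)); apply: grid_itv; exact: leq_trans mn.
Qed.

(** The steps [m] and [2 * m] out of [4 * m] are the times 1/4 and 1/2, which rescale to the times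
    1/2 and 1 of [wiener_confined]. *)
Lemma wiener_confined_grid (m : nat) (c : R) : (0 < m)%N -> 0 < c ->
  pr mu [set x | (~` attains (4 * m) (2 * m) c) x /\
                 (~` attains (4 * m) (2 * m) c) (fun t => - x t)] <= 64 * c ^+ 2.
Proof.
move=> m0 c0.
have c20 : 0 <= 2 * c by rewrite mulr_ge0// ltW.
have -> : 64 * c ^+ 2 = 16 * (2 * c) ^+ 2 by ring.
rewrite (le_trans _ (wiener_confined hmu c20))//.
apply: wiener_le_half.
- by apply: measurable_attains2; rewrite leq_mul2r orbT.
- have mabs s : 0 <= s <= 1 -> measurable ([set x | `|x s| < 2 * c] : set Omega).
    move=> s01; apply: (measurable_set_lt (2 * c) (f := fun x : Omega => `|x s|)).
    apply: (measurableT_comp (@normr_measurable R setT)).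
    exact: measurable_ev.
  apply: measurableI; apply: mabs; last by rewrite ler01 lexx.
  by rewrite divr_ge0//= ler_pdivrMr// mul1r ler1n.
- move=> x x0 [n1 n2].
  have E (i : nat) : (i <= 2 * m)%N -> `|shift 0 2^-1 x (i%:R / (2 * m)%:R)| < 2 * c.
    move=> im.
    have tE : 2^-1 * (i%:R / (2 * m)%:R) = i%:R / (4 * m)%:R :> R.
      by rewrite !natrM; field; rewrite pnatr_eq0 -lt0n.
    rewrite ltr_norml; apply/andP; split.
      rewrite ltrNl.
      have -> : - shift 0 2^-1 x (i%:R / (2 * m)%:R) =
          shift 0 2^-1 (fun t => - x t) (i%:R / (2 * m)%:R).
        by rewrite /shift -mulNr; congr (_ / _); ring.
      apply: shift_half_lt => //; first by rewrite x0 oppr0.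
      by rewrite tE ltNge; apply/negP => hi; apply: n2; exists i.
    apply: shift_half_lt => //.
    by rewrite tE ltNge; apply/negP => hi; apply: n1; exists i.
  have m0' : m%:R != 0 :> R by rewrite pnatr_eq0 -lt0n.
  split.
    have := E m (leq_pmull m (ltn0Sn 1)).
    suff -> : m%:R / (2 * m)%:R = 1 / 2 :> R by [].
    by rewrite natrM; field.
  have := E (2 * m)%N (leqnn _).
  by rewrite natrM divff// mulf_neq0.
Qed.

Lemma measurable_pr_setU_le (A C : set T) (x y : R) :
  measurable A /\ pr P A <= x -> measurable C /\ pr P C <= y ->
  measurable (A `|` C) /\ pr P (A `|` C) <= x + y.
Proof.
move=> [mA Ax] [mC Cy]; split; first exact: measurableU.
by rewrite (le_trans (pr_setU_le _ mA mC))// lerD.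
Qed.

Lemma ae_local_time_signs (V : R -> {RV P >-> R}) (l : R -> R -> {RV P >-> R}) :
  standard_brownian_motion V -> is_local_time V l ->
  {ae P, forall w, forall e,
    local_time (fun t => signed e V t w) (fun t x => l t (flip e x) w)}.
Proof.
move=> hV hl; apply: filterS2 (ae_local_time_signed true hV hl) (ae_local_time_signed false hV hl).
by move=> w lt lf [].
Qed.


(** [F] gathers a null set, the jumps, the failure of one path to attain [c] on both sides, the
    failures of the two paths on opposite sides, and the absence of a common lucky level. The side
    is decided only off [F], so both sides are counted. *)
Lemma intersection_large_at (N j1 j2 lam q' M : nat) :
  (0 < N)%N -> (0 < q')%N -> (0 < M)%N ->
  let a := Num.sqrt (4 * q')%:R^-1 in
  let delta := N%:R^-1 in
  exists F : set T, [/\ measurable F,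
    pr P F <= (256 * (lam%:R + delta) ^+ 2 + 1) * ((M * M).+1%:R * a) ^+ 2 +
      2 * (M.+1%:R * (1 - pr mu (charged N j1 j2 lam)) ^+ M) &
    forall w, ~ F w ->
      ((delta ^+ 3 / 4 * a ^+ 3)%:E <= mutual_intersection_local_time L L' w)%E].
Proof.
move=> N0 q'0 M0 a delta; set D := charged N j1 j2 lam.
have q0 : (0 < 4 * q')%N by rewrite muln_gt0.
have h0 : 0 < (4 * q')%:R^-1 :> R by rewrite invr_gt0 ltr0n.
have a0 : 0 < a by rewrite sqrtr_gt0.
have d0 : 0 < delta by rewrite invr_gt0 ltr0n.
pose eta := a * delta; have eta0 : 0 < eta by rewrite mulr_gt0.
pose Lam := lam%:R * a + eta.
have Lam0 : 0 < Lam by rewrite ltr_wpDl// mulr_ge0// ltW.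
pose c := (M * M).+1%:R * Lam.
have Lamc : Lam <= c by rewrite ler_peMl ?(ltW Lam0)// ler1n.
have c0 : 0 < c by exact: lt_le_trans Lamc.
have etac : eta <= c by rewrite (le_trans _ Lamc)// lerDr mulr_ge0// ltW.
(* The total weight of [eps] in the bound for [F]: four jump events, and on each of the two sides
   the jump terms of [pr_no_common_lucky]. *)
pose K : R := 4 + 2 * (M.+1%:R * (M * M)%:R).
have K0 : 0 < K by rewrite ltr_wpDr// mulr_ge0.
pose eps := Num.min eta (a ^+ 2 / K).
have eps0 : 0 < eps by rewrite lt_min eta0/= divr_gt0// exprn_gt0.
have epseta : eps <= eta by rewrite /eps ge_min lexx.
have epsK : eps * K <= a ^+ 2 by rewrite -ler_pdivlMr// /eps ge_min lexx orbT.
(* The mesh is chosen here, after [a] and [M], to make jumps rarer than [eps]. *)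
have [_ _ _ hj] := hmu; have [n0 hn0] := hj eta eps eta0 eps0.
pose r := (2 ^ n0)%N.
have r0 : (0 < r)%N by rewrite expn_gt0.
have nr : (n0 <= r)%N by rewrite ltnW// ltn_expl.
pose m0 := (r * q')%N; have m00 : (0 < m0)%N by rewrite muln_gt0 r0.
have rm : (r <= m0)%N by rewrite leq_pmulr.
have nE : (r * (4 * q') = 4 * m0)%N by rewrite /m0 mulnCA.
(* The number of steps is a multiple of 4, so that 1/4 and 1/2 are grid times. *)
pose n := (4 * m0)%N; pose m := (2 * m0)%N.
have mE : (2 * m = n)%N by rewrite mulnA.
have mrq : (m + r <= r * (4 * q'))%N by rewrite nE (leq_trans (leq_add (leqnn m) rm))// -mulSnr leq_mul2r orbT.
have mn : (m <= n)%N by rewrite leq_mul2r orbT.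
have mA := measurable_attains c mn.
have mD : measurable (D : set Omega) by exact: measurable_charged.
have rho0 : 0 <= 1 - pr mu D by rewrite subr_ge0 pr_le1.
have jn : pr mu (jumps n eta) <= eps.
  by apply/ltW/hn0; rewrite (leq_trans nr)// (leq_trans rm)// leq_pmull.
have jm : pr mu (jumps m eta) <= eps.
  by apply/ltW/hn0; rewrite (leq_trans nr)// (leq_trans rm)// leq_pmull.
pose A := attains n m c.
pose bB e := brownian_signed e hB; pose bB' e := brownian_signed e hB'.
(* [2 * (2 * c + eta) + 2 * eps <= 8 * c], since [eps <= eta <= c]. *)
have nA : pr mu (~` A) <= 8 * c.
  have m_gt0 : (0 < m)%N by rewrite muln_gt0.
  by have := wiener_not_attains m_gt0 c0 eta0; rewrite mE -/A; lra.
have good : {ae P, forall w, (forall e,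
    local_time (fun t => signed e B t w) (fun t x => L t (flip e x) w)) /\
    (forall e, local_time (fun t => signed e B' t w) (fun t x => L' t (flip e x) w))}.
  by apply: filterS2 (ae_local_time_signs hB hL) (ae_local_time_signs hB' hL').
have [Z [mZ Z0 gZ]] := ae_null_set good.
pose A2 : set (R -> R) := [set x | (~` A) x /\ (~` A) (fun t => - x t)].
have mA2 : measurable (A2 : set Omega) by exact: measurable_attains2.
pose NA e := path (signed e B) @^-1` (~` A).
pose NA' e := path (signed e B') @^-1` (~` A).
pose none e := path (signed e B) @^-1` A `&` path (signed e B') @^-1` A `&`
  [set w | forall k, (k < M * M)%N ->
     (~` (path (signed e B) @^-1` lucky r (4 * q') m D Lam k `&`
          path (signed e B') @^-1` lucky r (4 * q') m D Lam k)) w].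
pose J e := path (signed e B) @^-1` jumps n eta.
pose J' e := path (signed e B') @^-1` jumps n eta.
have bJ e : measurable (J e) /\ pr P (J e) <= eps.
  have mJ := @measurable_jumps R n eta.
  by split; [exact: measurable_path_signed|rewrite (law (bB e) mJ)].
have bJ' e : measurable (J' e) /\ pr P (J' e) <= eps.
  have mJ := @measurable_jumps R n eta.
  by split; [exact: measurable_path_signed|rewrite (law (bB' e) mJ)].
have bA2 : measurable (path (signed false B) @^-1` A2) /\
    pr P (path (signed false B) @^-1` A2) <= 64 * c ^+ 2.
  split; first exact: measurable_path_signed.
  by rewrite (law (bB false) mA2); exact: wiener_confined_grid.
have bA2' : measurable (path (signed false B') @^-1` A2) /\
    pr P (path (signed false B') @^-1` A2) <= 64 * c ^+ 2.
  split; first exact: measurable_path_signed.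
  by rewrite (law (bB' false) mA2); exact: wiener_confined_grid.
have mCA : measurable (~` A : set Omega) by exact: measurableC.
have bNA e : measurable (NA e `&` NA' (~~ e)) /\ pr P (NA e `&` NA' (~~ e)) <= 64 * c ^+ 2.
  have m1 : measurable (NA e) by exact: measurable_path_signed.
  have m2 : measurable (NA' (~~ e)) by exact: measurable_path_signed.
  split; first exact: measurableI.
  rewrite (pr_independent hB hB' hBB' m1 m2); last 2 first.
  - by apply: sigma_process_signed; exact: mCA.
  - by apply: sigma_process_signed; exact: mCA.
  rewrite (law (bB e) mCA) (law (bB' (~~ e)) mCA).
  have -> : 64 * c ^+ 2 = (8 * c) * (8 * c) by ring.
  by rewrite ler_pM// pr_ge0.
have bnone e : measurable (none e) /\ pr P (none e) <=
    M.+1%:R * (1 - pr mu D) ^+ M + M.+1%:R * (M * M)%:R * eps.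
  split.
    apply: measurableI.
      by apply: measurableI; exact: measurable_path_signed.
    apply: measurable_forall_imp => k _; apply: measurableC.
    have mG : measurable (lucky r (4 * q') m D Lam k : set Omega) by exact: measurable_lucky.
    by apply: measurableI; exact: measurable_path_signed.
  have D_lam x : D x -> forall j, (j <= r)%N -> x (j%:R / r%:R) < lam%:R.
    by move=> [_ [+ _]] j jr; apply.
  have := pr_no_common_lucky e M0 r0 q0 mrq mD Lam0 D_lam (lexx _).
  rewrite -/a -/c nE -/n -/A -/(none e) => /le_trans; apply.
  by rewrite mulrDr lerD2l -mulrA ler_wpM2l// ler_wpM2l.
have bZ : measurable Z /\ pr P Z <= 0 by split => //; rewrite Z0.
have [mF prF] := measurable_pr_setU_le bZ (measurable_pr_setU_le
  (measurable_pr_setU_le (measurable_pr_setU_le (bJ false) (bJ true))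
     (measurable_pr_setU_le (bJ' false) (bJ' true)))
  (measurable_pr_setU_le
     (measurable_pr_setU_le (measurable_pr_setU_le bA2 bA2')
        (measurable_pr_setU_le (bNA false) (bNA true)))
     (measurable_pr_setU_le (bnone false) (bnone true)))).
eexists; split; first exact: mF.
  apply: (le_trans prF).
  have cE : c ^+ 2 = (lam%:R + delta) ^+ 2 * ((M * M).+1%:R * a) ^+ 2.
    by rewrite /c /Lam /eta; ring.
  have a2 : a ^+ 2 <= ((M * M).+1%:R * a) ^+ 2.
    by rewrite ler_sqr ?nnegrE ?mulr_ge0 ?(ltW a0)// ler_peMl ?(ltW a0)// ler1n.
  move: epsK a2 cE; rewrite /K.
  move: (c ^+ 2) (a ^+ 2) (((M * M).+1%:R * a) ^+ 2) ((lam%:R + delta) ^+ 2)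
    (M.+1%:R * (M * M)%:R) (M.+1%:R * (1 - pr mu D) ^+ M) => u v x y z t.
  move=> e1 e2 ->; lra.
move=> w nF.
have [lB lB'] : (forall e, local_time (fun t => signed e B t w) (fun t x => L t (flip e x) w)) /\
    (forall e, local_time (fun t => signed e B' t w) (fun t x => L' t (flip e x) w)).
  by apply: gZ => Zw; apply: nF; left.
have nJ e : ~ J e w by case: e => Jw; apply: nF; right; left; left; [right|left].
have nJ' e : ~ J' e w by case: e => Jw; apply: nF; right; left; right; [right|left].
have nN e : ~ none e w by case: e => Nw; apply: nF; do 3 right; [right|left].
have nX e : ~ (NA e w /\ NA' (~~ e) w).
  by case: e => h; apply: nF; right; right; left; right; [right|left].
have n2 : ~ (NA false w /\ NA true w).
  by move=> h; apply: nF; right; right; left; left; left.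
have n2' : ~ (NA' false w /\ NA' true w).
  by move=> h; apply: nF; right; right; left; left; right.
(* Any two failures on opposite sides are excluded, be they of one path or of both. So all failures
   lie on one side, and the other side is good for both paths. *)
have [e [Ae Ae']] : exists e, ~ NA e w /\ ~ NA' e w.
  have [a1|a1] := pselect (NA false w).
    exists true; split => h; first exact: n2.
    exact: (nX false).
  have [a2|a2] := pselect (NA' false w); last by exists false.
  exists true; split => h; first exact: (nX true).
  exact: n2'.
have [k [kM [lk lk']]] : exists k, (k < M * M)%N /\
   (lucky r (4 * q') m D Lam k (path (signed e B) w) /\
    lucky r (4 * q') m D Lam k (path (signed e B') w)).
  apply: contrapT => /forallNP hn; apply: (nN e); split.
    by split; apply: contrapT.
  by move=> k kM [l1 l2]; apply: (hn k).
rewrite /J /n -nE in nJ; rewrite /J' /n -nE in nJ'.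
have llt (V : R -> {RV P >-> R}) (l : R -> R -> {RV P >-> R}) :=
  @lucky_local_time R (fun t => signed e V t w) (fun t x => l t (flip e x) w)
    r (4 * q') m N j1 j2 lam k Lam r0 q0 N0 mrq Lam0.
have h1 := llt B L (lB e) (signed0 e B w) (nJ e) lk.
have h2 := llt B' L' (lB' e) (signed0 e B' w) (nJ' e) lk'.
move: h1 h2; rewrite -/a -/delta; set y0 := (_ - _ : R) / _.
set u := _ + a * y0; set v := _ + a * (y0 + delta) => h1 h2.
have vu : v - u = a * delta.
  by rewrite /v /u (mulrDr a y0) opprD addrACA subrr add0r addrAC subrr add0r.
have uv : u <= v by rewrite -subr_ge0 vu ltW.
(* The square of the common lower bound on the local times, times the length [a * delta] of the
   interval. *)
have -> : delta ^+ 3 / 4 * a ^+ 3 = (delta * a / 2) ^+ 2 * (v - u) by rewrite vu; field.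
have cd : 0 <= delta * a / 2 by rewrite divr_ge0// mulr_ge0// ltW.
have meas (V : R -> {RV P >-> R}) (l : R -> R -> {RV P >-> R}) :
    local_time (fun t => signed false V t w) (fun t x => l t (flip false x) w) ->
    measurable_fun setT (fun x => l 1 x w).
  by move=> [_ cl _]; exact: (continuous_measurable_fun (cl 1 ler01)).
have mL := meas B L (lB false); have mL' := meas B' L' (lB' false).
have L0 x : 0 <= L 1 x w by exact: (local_time_ge0 (lB false) x ler01).
have L'0 x : 0 <= L' 1 x w by exact: (local_time_ge0 (lB' false) x ler01).
rewrite /mutual_intersection_local_time.
case: e h1 h2 {Ae Ae' lk lk' llt} => h1 h2; last exact: integral_mul_ge.
have -> : v - u = - u - (- v) by ring.
apply: integral_mul_ge => //; first by rewrite lerN2.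
- by move=> x x1 x2; have := h1 (- x); rewrite /flip opprK; apply; [rewrite ltrNr|rewrite ltrNl].
- by move=> x x1 x2; have := h2 (- x); rewrite /flip opprK; apply; [rewrite ltrNr|rewrite ltrNl].
Qed.

End large_intersection.

(** * Negative moments *)

Section geometric_bounds.
Context {R : realType}.

(** Each of the [n] terms of the geometric sum [(1 - v ^+ n) / (1 - v)] is at least [v ^+ n]. *)
Lemma mulrn_expr_le (v : R) (n : nat) : 0 <= v -> v < 1 -> n%:R * v ^+ n <= (1 - v)^-1.
Proof.
move=> v0 v1; have v1' : 0 < 1 - v by rewrite subr_gt0.
rewrite -[leRHS]mul1r ler_pdivlMr//.
apply: (@le_trans _ _ (1 - v ^+ n)); last by rewrite gerBl exprn_ge0.
elim: n => [|n IH]; first by rewrite mul0r mul0r expr0 subrr.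
rewrite -natr1 mulrDl mul1r mulrDl exprS.
have : n%:R * (v * v ^+ n) * (1 - v) <= v * (1 - v ^+ n).
  by rewrite mulrCA -mulrA ler_wpM2l.
have : 0 <= (1 - v) * (1 - v * v ^+ n).
  by rewrite mulr_ge0 ?(ltW v1')// subr_ge0 -exprS exprn_ile1// ltW.
by move: (v ^+ n) => x; lra.
Qed.

Lemma expr_small (v e : R) : 0 <= v -> v < 1 -> 0 < e -> exists2 n, (0 < n)%N & v ^+ n <= e.
Proof.
move=> v0 v1 e0; have v1' : 0 < 1 - v by rewrite subr_gt0.
have [n hn] := exists_large_nat (mulr_gt0 v1' e0).
have [n0 ne] := hn n (leqnn n); exists n => //.
have := mulrn_expr_le n v0 v1; rewrite mulrC -ler_pdivlMr ?ltr0n// => /le_trans; apply.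
by rewrite ler_pdivrMl// ltW.
Qed.

(** With [v] the eighth root of [x], half of the powers of [v] absorbs the polynomial, as
    [k * v ^+ k] is bounded, and the other half leaves a geometric series of ratio [v ^+ 4]. *)
Lemma sum_poly_geometric_le (x : R) : 0 <= x -> x < 1 ->
  exists2 K : R, 0 < K & forall n, \sum_(k < n) k.+1%:R ^+ 4 * x ^+ k.+1 <= K.
Proof.
move=> x0 x1; pose v := Num.sqrt (Num.sqrt (Num.sqrt x)).
have v0 : 0 <= v by exact: sqrtr_ge0.
have vx : v ^+ 8 = x.
  by rewrite (exprM v 2 4) (exprM _ 2 2) !sqr_sqrtr ?sqrtr_ge0.
have v1 : v < 1 by rewrite -(@expr_lt1 _ 8)// vx.
have v1' : 0 < 1 - v by rewrite subr_gt0.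
have y0 : 0 <= v ^+ 4 by rewrite exprn_ge0.
have y1 : v ^+ 4 < 1 by rewrite expr_lt1.
have y1' : 0 < 1 - v ^+ 4 by rewrite subr_gt0.
exists ((1 - v)^-1 ^+ 4 * (1 - v ^+ 4)^-1).
  by rewrite mulr_gt0 ?exprn_gt0 ?invr_gt0.
move=> n; apply: (@le_trans _ _ (\sum_(k < n) (1 - v)^-1 ^+ 4 * (v ^+ 4) ^+ k)).
  apply: ler_sum => k _.
  have -> : k.+1%:R ^+ 4 * x ^+ k.+1 = (k.+1%:R * v ^+ k.+1) ^+ 4 * (v ^+ 4) ^+ k.+1.
    have -> : x ^+ k.+1 = (v ^+ k.+1) ^+ 4 * (v ^+ 4) ^+ k.+1.
      by rewrite -{1}vx -(exprM v 8) -(exprM v k.+1) -(exprM v 4) -exprD; congr (v ^+ _); lia.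
    by rewrite (exprMn 4 k.+1%:R) (mulrA (k.+1%:R ^+ 4)).
  apply: ler_pM.
  - by rewrite exprn_ge0// mulr_ge0// exprn_ge0.
  - exact: exprn_ge0.
  - rewrite lerXn2r ?nnegrE ?invr_ge0 ?(ltW v1')//; last exact: mulrn_expr_le.
    by rewrite mulr_ge0// exprn_ge0.
  - by rewrite exprS ler_piMl ?exprn_ge0// ltW.
rewrite -mulr_sumr ler_pM2l ?exprn_gt0 ?invr_gt0//.
rewrite -[leRHS]mul1r ler_pdivlMr// mulrC -opprB mulNr -subrX1 opprB.
by rewrite gerBl exprn_ge0.
Qed.

End geometric_bounds.

Section negative_moment.
Context (R : realType) (d : measure_display) (T : measurableType d).
Variables (P : probability T R) (B B' : R -> {RV P >-> R}).
Variables (L L' : R -> R -> {RV P >-> R}).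
Hypotheses (hB : standard_brownian_motion B) (hB' : standard_brownian_motion B').
Hypothesis hBB' : independent_processes B B'.
Hypotheses (hL : is_local_time B L) (hL' : is_local_time B' L').
Let X := mutual_intersection_local_time L L'.

(** For [k > 0] the scale is [a = 2 ^ - k] and [M = c * k], where [(1 - rho) ^+ c <= 1 / 4]. The
    chance that all levels fail is then at most of order [M * a ^+ 2], and [M ^ 4] yields the fourth
    power. *)
Lemma intersection_large : exists (C kappa : R) (F : nat -> set T),
  [/\ 0 < kappa, F 0%N = setT & forall k, [/\ measurable (F k),
    pr P (F k) <= C * (k.+1%:R ^+ 4 * 4^-1 ^+ k) &
    forall w, ~ F k w -> ((kappa * 8^-1 ^+ k)%:E <= X w)%E] ].
Proof.
have bW := brownian_signed false hB.
have cW : {ae P, forall w, continuous (fun t => signed false B t w)}.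
  exact: continuous_centered.
have [mu [hmu law]] := wiener_law bW cW.
have [N [j1 [j2 [lam [N0 rho0]]]]] := exists_charged hB hL law.
set rho := pr mu _ in rho0.
have rho1 : rho <= 1 by apply: pr_le1; exact: measurable_charged.
have v0 : 0 <= 1 - rho by rewrite subr_ge0.
have v1 : 1 - rho < 1 by rewrite gtrBl.
have q4 : 0 < 4^-1 :> R by rewrite invr_gt0.
have [c c0 hc] := expr_small v0 v1 q4.
pose A := 256 * (lam%:R + N%:R^-1) ^+ 2 + 1 : R.
have A0 : 0 <= A by rewrite addr_ge0// mulr_ge0// exprn_ge0// addr_ge0.
pose C := A * (c%:R ^+ 2 + 1) ^+ 2 + 2 * (c%:R + 1) + 1 : R.
have step k : exists F : set T, [/\ measurable F,
    pr P F <= C * (k.+2%:R ^+ 4 * 4^-1 ^+ k.+1) &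
    forall w, ~ F w -> ((N%:R^-1 ^+ 3 / 4 * 8^-1 ^+ k.+1)%:E <= X w)%E].
  have q0 : (0 < 4 ^ k)%N by rewrite expn_gt0.
  have M0 : (0 < c * k.+1)%N by rewrite muln_gt0 c0.
  have := intersection_large_at hB hB' hBB' hL hL' hmu law j1 j2 lam N0 q0 M0.
  have -> : Num.sqrt (4 * 4 ^ k)%:R^-1 = 2^-1 ^+ k.+1 :> R.
    rewrite -expnS natrX -exprVn.
    have -> : 4^-1 = 2^-1 ^+ 2 :> R by rewrite exprVn -natrX.
    by rewrite -exprM mulnC exprM sqrtr_sqr ger0_norm ?exprn_ge0.
  move=> [F [mF pF hF]]; exists F; split => //; last first.
    move=> w /hF; congr (_ <= _)%E; congr (_%:E); congr (_ * _).
    by rewrite -exprM mulnC exprM; congr (_ ^+ _); rewrite exprVn -natrX.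
  apply: (le_trans pF); rewrite -/rho -/A.
  have y0 : 0 <= 4^-1 ^+ k.+1 :> R by rewrite exprn_ge0// ltW.
  have -> : (((c * k.+1) * (c * k.+1)).+1%:R * 2^-1 ^+ k.+1) ^+ 2 =
      ((c%:R * k.+1%:R) ^+ 2 + 1) ^+ 2 * 4^-1 ^+ k.+1 :> R.
    rewrite (exprMn 2) -natr1 !natrM -expr2; congr (_ * _).
    by rewrite -exprM mulnC exprM; congr (_ ^+ _); rewrite exprVn -natrX.
  have hr : (1 - rho) ^+ (c * k.+1) <= 4^-1 ^+ k.+1.
    by rewrite exprM lerXn2r ?nnegrE ?exprn_ge0// ltW.
  have k1 : 1 <= k.+2%:R :> R by rewrite ler1n.
  have kk : k.+1%:R <= k.+2%:R :> R by rewrite ler_nat.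
  have k12 : 1 <= k.+2%:R ^+ 2 :> R by rewrite exprn_ege1.
  have e1 : ((c%:R * k.+1%:R) ^+ 2 + 1) ^+ 2 <= (c%:R ^+ 2 + 1) ^+ 2 * k.+2%:R ^+ 4 :> R.
    rewrite (exprM k.+2%:R 2 2) -(exprMn 2); rewrite lerXn2r ?nnegrE//.
    rewrite (exprMn 2) mulrDl mul1r lerD// ler_wpM2l ?exprn_ge0//.
    by rewrite ler_sqr ?nnegrE.
  have e2 : (c * k.+1).+1%:R <= (c%:R + 1) * k.+2%:R ^+ 4 :> R.
    have k4 : k.+2%:R <= k.+2%:R ^+ 4 :> R by rewrite -[leLHS]expr1 ler_weXn2l.
    rewrite -natr1 natrM mulrDl mul1r lerD//; last exact: le_trans k4.
    by rewrite ler_wpM2l// (le_trans kk).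
  rewrite [C * _]mulrDl mul1r [X in _ <= X + _]mulrDl.
  have t1 : A * (((c%:R * k.+1%:R) ^+ 2 + 1) ^+ 2 * 4^-1 ^+ k.+1) <=
      A * (c%:R ^+ 2 + 1) ^+ 2 * (k.+2%:R ^+ 4 * 4^-1 ^+ k.+1).
    by rewrite -mulrA ler_wpM2l// mulrA ler_wpM2r.
  have t2 : 2 * ((c * k.+1).+1%:R * (1 - rho) ^+ (c * k.+1)) <=
      2 * (c%:R + 1) * (k.+2%:R ^+ 4 * 4^-1 ^+ k.+1).
    by rewrite -mulrA ler_wpM2l// mulrA ler_pM// exprn_ge0.
  by rewrite -[leLHS]addr0 lerD ?lerD// mulr_ge0// exprn_ge0.
have [G hG] := choice step.
exists C, (N%:R^-1 ^+ 3 / 4), (fun k => if k is j.+1 then G j else setT); split => //.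
  by rewrite divr_gt0// exprn_gt0// invr_gt0 ltr0n.
case=> [|k]; last exact: hG.
split => [//||w []//]; rewrite pr_setT expr1n expr0 !mulr1 /C lerDr.
by rewrite addr_ge0// mulr_ge0// ?exprn_ge0 ?addr_ge0 ?exprn_ge0.
Qed.

End negative_moment.

Section step_functions.
Context d (T : measurableType d) (R : realType) (P : probability T R).
Import HBNNSimple.

(* The integrand of [neg_moment] is not known to be measurable. *)
Lemma le_integral_nonmeasurable (f g : T -> \bar R) :
  (forall w, (0 <= f w)%E) -> (forall w, (f w <= g w)%E) ->
  (\int[P]_w f w <= \int[P]_w g w)%E.
Proof.
move=> f0 fg; rewrite !ge0_integralTE//; last first.
  by move=> w; exact: le_trans (fg w).
apply: ereal_sup_le => _ [h hf <-]; exists h => // w.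
exact: le_trans (fg w).
Qed.

Lemma integral_steps (c : nat -> R) (E : nat -> set T) (n : nat) :
  (forall k, 0 <= c k) -> (forall k, measurable (E k)) ->
  (\int[P]_w (\sum_(k < n) c k * \1_(E k) w)%:E)%E = (\sum_(k < n) c k * pr P (E k))%:E.
Proof.
move=> c0 mE; under eq_integral do rewrite -sumEFin.
rewrite ge0_integral_sum//.
- rewrite -sumEFin; apply: eq_bigr => k _; under eq_integral do rewrite EFinM.
  rewrite ge0_integralZl//.
  + rewrite integral_indic// setIT EFinM; congr (_ * _)%E; exact: (prE P (mE k)).
  + by apply/measurable_EFinP; exact: measurable_indic.
  + by rewrite lee_fin.
- by move=> k; apply/measurable_EFinP; apply: measurable_funM => //; exact: measurable_indic.
- by move=> k w _; rewrite lee_fin mulr_ge0.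
Qed.

(** Reduces to bounded measurable minorants [h]. The bound [b] is what copes with [X = 0], where the
    integrand is infinite. *)
Lemma integral_le_of_simple (f : T -> \bar R) (C : R) : (forall w, (0 <= f w)%E) ->
  (forall (h : T -> R) (b : R), measurable_fun setT h -> (forall w, 0 <= h w) ->
    (forall w, h w <= b) -> (forall w, ((h w)%:E <= f w)%E) ->
    (\int[P]_w (h w)%:E <= C%:E)%E) ->
  (\int[P]_w f w <= C%:E)%E.
Proof.
move=> f0 hf; rewrite ge0_integralTE//; apply: ge_ereal_sup => _ [h hh <-].
have [M [Mr Mh]] := simple_bounded h.
rewrite -integralT_nnsfun; apply: (hf h (M + 1)) => //.
by move=> w; rewrite (le_trans (ler_norm _))// (Mh (M + 1)) ?ltrDl.
Qed.

End step_functions.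

Section exponent.
Context {R : realType}.

Lemma powR_geometric (y p x : R) (n : nat) : 0 < y -> 0 < x ->
  (y * x ^+ n) `^ p = y `^ p * (x `^ p) ^+ n.
Proof.
move=> y0 x0; rewrite powRM ?(ltW y0) ?exprn_ge0 ?(ltW x0)//; congr (_ * _).
by rewrite -powR_mulrn ?(ltW x0)// -powRrM mulrC powRrM powR_mulrn ?powR_ge0.
Qed.

(** The origin of [2 / 3]: sizes of order [8 ^ - k] against probabilities of order [4 ^ - k], that
    is [3 * p] against 2. *)
Lemma powR_eighth_gt (p : R) : (4^-1 < 8^-1 `^ p) = (p < 2 / 3).
Proof.
have l0 : ln 2 > 0 :> R by rewrite ln_gt0// ltr1n.
rewrite -[4^-1](@lnK R) ?posrE ?invr_gt0// /powR invr_eq0 pnatr_eq0/= ltr_expR.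
have -> : ln (4^-1) = - (2 * ln 2) :> R.
  by rewrite lnV ?posrE// (_ : 4 = 2 ^+ 2) ?lnXn// -?natrX// mulr_natl.
have -> : ln (8^-1) = - (3 * ln 2) :> R.
  by rewrite lnV ?posrE// (_ : 8 = 2 ^+ 3) ?lnXn// -?natrX// mulr_natl.
by rewrite mulrN ltrN2 mulrA ltr_pM2r// ltr_pdivlMr.
Qed.

Lemma inve_poweR_EFin (y p : R) : 0 < y -> ((y%:E `^ p)^-1 = ((y `^ p)^-1)%:E)%E.
Proof. by move=> y0; rewrite poweR_EFin inver gt_eqF// powR_gt0. Qed.

Lemma le_inve_poweR (x y : \bar R) (p : R) : 0 < p -> (0 <= x)%E -> (x <= y)%E ->
  ((y `^ p)^-1 <= (x `^ p)^-1)%E.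
Proof.
move=> p0 x0 xy; have y0 := le_trans x0 xy.
rewrite lee_pV2 ?inE ?poweR_ge0//; apply: gt0_ler_poweR => //; first exact: ltW.
- by rewrite in_itv/= x0 leey.
- by rewrite in_itv/= y0 leey.
Qed.

End exponent.

Section moment_criteria.
Context d (T : measurableType d) (R : realType) (P : probability T R).
Variables (X : T -> \bar R) (p : R).
Hypothesis p0 : 0 < p.
Let gamma : R := 8^-1 `^ p.
Let beta := gamma^-1.

Let gamma0 : 0 < gamma. Proof. by rewrite powR_gt0 ?invr_gt0. Qed.
Let beta0 : 0 < beta. Proof. by rewrite invr_gt0. Qed.

Let gamma1 : gamma < 1.
Proof.
rewrite /gamma /powR invr_eq0 pnatr_eq0/= -[ltRHS]expR0 ltr_expR pmulr_rlt0// ln_lt0//.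
by rewrite invr_gt0 ltr0n/= invf_lt1 ?ltr1n.
Qed.

Let beta1 : 1 < beta. Proof. by rewrite invf_gt1. Qed.

Let inve_powRE (y : R) (k : nat) : 0 < y ->
  ((((y * 8^-1 ^+ k)%:E) `^ p)^-1 = ((y `^ p)^-1 * beta ^+ k)%:E)%E.
Proof.
move=> y0; rewrite inve_poweR_EFin ?mulr_gt0 ?exprn_gt0 ?invr_gt0//.
by rewrite powR_geometric ?invr_gt0// invfM -exprVn.
Qed.

Let integrand_ge0 w : (0 <= (X w `^ p)^-1)%E.
Proof. by rewrite inve_ge0 poweR_ge0. Qed.

(** Let [k.+1] be the first index whose event fails at a point. Then [F k] holds there and the
    integrand is at most [c k]. The resulting series is polynomial times geometric, of ratio
    [beta / 4 < 1]. *)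
Lemma neg_moment_finite (C kappa : R) (F : nat -> set T) :
  p < 2 / 3 -> 0 < kappa -> F 0%N = setT ->
  (forall k, [/\ measurable (F k), pr P (F k) <= C * (k.+1%:R ^+ 4 * 4^-1 ^+ k) &
    forall w, ~ F k w -> ((kappa * 8^-1 ^+ k)%:E <= X w)%E]) ->
  (neg_moment P X p < +oo)%E.
Proof.
move=> p23 k0 F0 hF.
have g4 : 4^-1 < gamma by rewrite powR_eighth_gt.
have C0 : 0 <= C.
  have [_ + _] := hF 0%N; rewrite F0 pr_setT expr1n expr0 !mulr1.
  exact: le_trans.
pose A := (kappa `^ p)^-1; have A0 : 0 < A by rewrite invr_gt0 powR_gt0.
have x0 : 0 <= 4^-1 * beta by rewrite mulr_ge0// ltW.
have x1 : 4^-1 * beta < 1 by rewrite ltr_pdivrMr// mul1r.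
have [K K0 hK] := sum_poly_geometric_le x0 x1.
apply: (@le_lt_trans _ _ (A * C * 4 * K)%:E); last exact: ltry.
apply: integral_le_of_simple => // h b mh h0 hb hX.
have [n bn] : exists n : nat, b <= A * n%:R.
  exists (Num.truncn (b / A)).+1; rewrite mulrC -ler_pdivrMr//.
  by rewrite ltW// truncnS_gt.
pose c k := A * beta ^+ k.+1.
have c0 k : 0 <= c k by rewrite mulr_ge0 ?exprn_ge0 ?(ltW beta0) ?(ltW A0).
have mF k : measurable (F k) by case: (hF k).
apply: (@le_trans _ _ (\int[P]_w (\sum_(k < n) c k * \1_(F k) w)%:E)%E).
  apply: le_integral_nonmeasurable => w; first by rewrite lee_fin.
  rewrite lee_fin.
  have [ex|nex] := pselect (exists k, (k < n)%N && ~~ `[< F k w >]).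
    case: (ex_minnP ex) => -[|k] /andP[kn /asboolPn nFk] hmin; first by case: nFk; rewrite F0.
    have Fk : F k w.
      apply: contrapT => nF; suff : (k.+1 <= k)%N by rewrite ltnn.
      by apply: hmin; rewrite (ltnW kn); apply/asboolPn.
    rewrite (bigD1 (Ordinal (ltnW kn)))//= indicE mem_set// mulr1.
    apply: ler_wpDr; first by apply: sumr_ge0 => i _; rewrite mulr_ge0.
    have [_ _ /(_ w nFk) hk] := hF k.+1.
    rewrite -lee_fin (le_trans (hX w))// /c -inve_powRE//.
    apply: le_inve_poweR => //.
    by rewrite lee_fin mulr_ge0 ?exprn_ge0 ?invr_ge0 ?(ltW k0).
  (* Here all the indicators are 1 and each [c k] is at least [A], so the sum is at least [A * n],
     hence at least [b]. *)
  rewrite (le_trans (hb w))// (le_trans bn)//.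
  have -> : A * n%:R = \sum_(k < n) A.
    by rewrite sumr_const card_ord mulr_natr.
  apply: ler_sum => k _; rewrite indicE mem_set ?mulr1.
    by rewrite /c ler_peMr ?(ltW A0)// exprn_ege1// ltW.
  by apply: contrapT => nF; apply: nex; exists k; rewrite ltn_ord; apply/asboolPn.
rewrite integral_steps// lee_fin.
apply: (@le_trans _ _ (\sum_(k < n) A * C * 4 * (k.+1%:R ^+ 4 * (4^-1 * beta) ^+ k.+1))).
  apply: ler_sum => k _; have [_ + _] := hF k => /(ler_wpM2l (c0 k)) /le_trans; apply.
  rewrite le_eqVlt; apply/orP; left; apply/eqP.
  rewrite /c exprMn [4^-1 ^+ k.+1]exprS.
  move: (4^-1 ^+ k) (beta ^+ k.+1) (k.+1%:R ^+ 4) => u v t.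
  by field.
by rewrite -mulr_sumr ler_wpM2l// mulr_ge0// mulr_ge0// ltW.
Qed.

(** The events [E k] may overlap, so their contributions cannot just be added. The factor
    [s = 1 - gamma] in [t k] makes the partial sums at most [A * beta ^+ n], which the integrand
    exceeds on the last event that holds. As [beta / 4 >= 1], also at [p = 2 / 3], every term
    contributes at least [s * A * c]. *)
Lemma neg_moment_infinite (c K : R) : 2 / 3 <= p -> 0 < c -> 0 < K ->
  (forall a : R, 0 < a -> a < 1 -> exists E : set T, [/\ measurable E,
     c * a ^+ 2 <= pr P E & forall w, E w -> (0 <= X w <= (K * a ^+ 3)%:E)%E]) ->
  neg_moment P X p = +oo%E.
Proof.
move=> p23 c0 K0 hE.
have g4 : gamma <= 4^-1 by rewrite leNgt powR_eighth_gt -leNgt.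
have half k : 0 < 2^-1 ^+ k.+1 :> R /\ 2^-1 ^+ k.+1 < 1 :> R.
  rewrite exprn_gt0 ?invr_gt0//; split => //.
  by rewrite expr_lt1// invf_lt1// ltr1n.
have [E hE'] := choice (fun k => hE _ (half k).1 (half k).2).
pose A := (K `^ p)^-1; have A0 : 0 < A by rewrite invr_gt0 powR_gt0.
pose s : R := 1 - gamma; have s0 : 0 < s by rewrite subr_gt0.
pose t k := s * A * beta ^+ k.+1.
have t0 k : 0 <= t k by rewrite !mulr_ge0 ?exprn_ge0 ?(ltW beta0) ?(ltW A0) ?(ltW s0).
have mE k : measurable (E k) by case: (hE' k).
have geo n : \sum_(k < n) t k <= A * beta ^+ n.
  elim: n => [|n IH]; first by rewrite big_ord0 mulr_ge0 ?exprn_ge0 ?(ltW A0) ?(ltW beta0).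
  rewrite big_ord_recr/= (le_trans (lerD IH (lexx _)))//.
  have e : beta ^+ n = gamma * beta ^+ n.+1.
    by rewrite exprS mulrA divff ?mul1r// gt_eqF.
  rewrite /t /s e; move: (beta ^+ n.+1) => u.
  by rewrite le_eqVlt; apply/orP; left; apply/eqP; ring.
have key w n : ((\sum_(k < n) t k * \1_(E k) w)%:E <= (X w `^ p)^-1)%E.
  elim: n => [|n IH]; first by rewrite big_ord0 integrand_ge0.
  have [Ew|nEw] := pselect (E n w); last first.
    by rewrite big_ord_recr/= indicE memNset// mulr0 addr0.
  have [_ _ /(_ w Ew) /andP[X0 XK]] := hE' n.
  rewrite (le_trans _ (le_inve_poweR p0 X0 XK))//.
  have -> : K * 2^-1 ^+ n.+1 ^+ 3 = K * 8^-1 ^+ n.+1.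
    congr (_ * _); rewrite -exprM mulnC exprM; congr (_ ^+ _).
    by rewrite exprVn -natrX.
  rewrite inve_powRE// lee_fin (le_trans _ (geo n.+1))//.
  by apply: ler_sum => k _; rewrite ler_piMr// indicE; case: (_ \in _).
have lower n : ((s * A * c * n%:R)%:E <= neg_moment P X p)%E.
  rewrite (le_trans _ (le_integral_nonmeasurable P _ (key^~ n)))//; last first.
    by move=> w; rewrite lee_fin sumr_ge0// => k _; rewrite mulr_ge0.
  rewrite integral_steps// lee_fin.
  have -> : s * A * c * n%:R = \sum_(k < n) s * A * c.
    by rewrite sumr_const card_ord mulr_natr.
  apply: ler_sum => k _; have [_ pE _] := hE' k.
  apply: (le_trans _ (ler_wpM2l (t0 k) pE)).
  have -> : t k * (c * 2^-1 ^+ k.+1 ^+ 2) = s * A * c * (4^-1 * beta) ^+ k.+1.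
    rewrite /t exprMn -exprM mulnC exprM.
    have -> : 2^-1 ^+ 2 = 4^-1 :> R by rewrite exprVn -natrX.
    by move: (4^-1 ^+ k.+1) (beta ^+ k.+1) => u v; ring.
  rewrite ler_peMr ?mulr_ge0 ?(ltW s0) ?(ltW A0) ?(ltW c0)// exprn_ege1//.
  by rewrite ler_pdivlMr// mul1r.
have sAc0 : 0 < s * A * c by rewrite !mulr_gt0.
move: lower; case: neg_moment => [r| |] lower //; last by have := lower 0%N; rewrite leeNy_eq.
have := lower (Num.truncn (r / (s * A * c))).+1.
by rewrite lee_fin mulrC -ler_pdivlMr// leNgt truncnS_gt.
Qed.

End moment_criteria.

Theorem corollary1p2 (R : realType) (d : measure_display)
    (T : measurableType d) (P : probability T R)
    (B B' : R -> {RV P >-> R}) (L L' : R -> R -> {RV P >-> R})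
    (hB : standard_brownian_motion B) (hB' : standard_brownian_motion B')
    (hBB' : independent_processes B B')
    (hL : is_local_time B L) (hL' : is_local_time B' L')
    (p : R) (hp : 0 < p) :
  (neg_moment P (mutual_intersection_local_time L L') p < +oo)%E
  <-> p < 2 / 3.
Proof.
have [c [K [c0 K0 small]]] := intersection_small hB hB' hBB' hL hL'.
have [C [kappa [F [k0 F0 large]]]] := intersection_large hB hB' hBB' hL hL'.
split => [fin|p23]; last exact: neg_moment_finite p23 k0 F0 large.
rewrite ltNge; apply/negP => p23.
by rewrite (neg_moment_infinite hp p23 c0 K0 small) ltxx in fin.
Qed.
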